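(* Let $V=\tilde L_{(4,0,0)}$ be the $32$-dimensional $U_q\tilde{\mathrm G}_{2|1}$-module described in the context and let $\check R(z):V(z)\otimes V\to V\otimes V(z)$ be the intertwiner of $U_q\tilde{\mathrm G}_{2|1}$-modules normalized by $\check R(z)(v_1\otimes v_1)=v_1\otimes v_1$, regarded as a rational function of $z$. Then $$\begin{aligned}\check R(z)=\;&P^q_{(8,0,0)}-q^8\frac{1-q^{-8}z}{1-q^8z}P^q_{(8,1,0)}+q^{14}\frac{(1-q^{-6}z)(1-q^{-8}z)}{(1-q^6z)(1-q^8z)}P^q_{(7,0,1)}\\&+\frac{q^5f_1(z)}{(1-q^{-4}z)(1-q^6z)(1-q^8z)}\otimes P^q_{(4,0,0)}+\frac{q^2f_0(z)}{(1-q^{-4}z)(1-q^{-6}z)(1-q^6z)(1-q^8z)}\otimes P^q_{(0,0,0)},\end{aligned}$$ where $$f_1(z)=\begin{bmatrix}-q^{-3}+\alpha_qz-\alpha_{q^{-1}}z^2+q^3z^3&\beta z(1-z)&\beta z(1-z)\\\gamma z(1-z)&\mu z(q^3+q^{-3}z)&(1-z)(q^3-\nu z+q^{-3}z^2)\\\gamma z(1-z)&(1-z)(q^3-\nu z+q^{-3}z^2)&\mu z(q^3+q^{-3}z)\end{bmatrix},$$ $$f_0(z)=\begin{bmatrix}q^{-6}-q^{-3}\zeta z+\xi z^2-q^3\zeta z^3+q^6z^4&\eta z(1-z^2)\\\rho z(1-z^2)&q^6-q^3\zeta z+\xi z^2-q^{-3}\zeta z^3+q^{-6}z^4\end{bmatrix},$$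 and $$\alpha_q=\frac{(q^5-q+2q^{-7}-q^{-9})[3]}{[3]^{\mathrm i}},\quad\beta=\frac{([2]^{\mathrm i})^3[2]_2[4]}{[3]^{\mathrm i}},\quad\gamma=\frac{[2]^{\mathrm i}[3]_2^{\mathrm i}[2][3]^2}{[3]^{\mathrm i}},\quad\mu=\frac{([2]^{\mathrm i})^3[3][4]}{[3]^{\mathrm i}},\quad\nu=\frac{[2]_7+[2]_3-[2]}{[3]^{\mathrm i}},$$ $$\zeta=\frac{[4][3]_2^{\mathrm i}}{[3]^{\mathrm i}},\quad\xi=\frac{[2]_2[3]_2([2]_8-[2]_6-[2]_4+[3])}{[3]^{\mathrm i}},\quad\eta=\frac{([2]^{\mathrm i})^5[4]}{[3]^{\mathrm i}},\quad\rho=\frac{[2]^{\mathrm i}[3]^2[3]_3[4]}{[3]^{\mathrm i}}.$$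
   Context: **Notation.** $q\in\mathbb C^\times$ is not a root of unity, $\log q$ fixed, $q^a=e^{a\log q}$; $[m]_k=\frac{q^{km}-q^{-km}}{q^k-q^{-k}}$, $[m]=[m]_1$, $[n]^{\mathrm i}_k=\frac{q^{kn}+(-1)^{n-1}q^{-kn}}{q^k+q^{-k}}$, $[n]^{\mathrm i}=[n]^{\mathrm i}_1$; $\alpha_{q^{-1}}$ is $\alpha_q$ with $q$ replaced by $q^{-1}$. **Algebra.** $U_q\tilde{\mathrm G}_{2|1}$ (level zero, distinguished diagram, $K^{1/2}$'s adjoined) has generators $K_i^{\pm1/2},E_i,F_i$, $i=0,1,2,3$ ($E_1,F_1$ odd, others even; $s_1=1$, $s_i=0$ otherwise), with commuting $K$'s, $K_0K_1^2K_2^4K_3^2=1$, $K_iE_jK_i^{-1}=q^{\tilde B_{ij}}E_j$, $K_iF_jK_i^{-1}=q^{-\tilde B_{ij}}F_j$, $E_iF_j-(-1)^{s_is_j}F_jE_i=\delta_{ij}\frac{K_i-K_i^{-1}}{q_i-q_i^{-1}}$, and Serre-type relations (not needed to state the theorem), where $q_i=q^{d_i}$, $(d_0,\dots,d_3)=(-4,-1,1,3)$, $$\tilde B=\begin{bmatrix}-8&4&0&0\\4&0&-1&0\\0&-1&2&-3\\0&0&-3&6\end{bmatrix}.$$ $U_q\mathrm G_{2|1}$ is the subalgebra generated by the generators with $i\ge1$. Coproduct: $\Delta(K_i^{\pm1/2})=K_i^{\pm1/2}\otimes K_i^{\pm1/2}$, $\Delta(X)=X\otimes K_i^{1/2}+K_i^{-1/2}\otimes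 X$ for $X=E_i,F_i$; sign rule $(A\otimes B)(v\otimes w)=(-1)^{p_Bp_v}Av\otimes Bw$. $L_\lambda$ is the irreducible $U_q\mathrm G_{2|1}$-module with highest weight vector $v$, $E_iv=0$, $K_iv=q_i^{\lambda_i}v$. **Module $V(z)$**, $z\in\mathbb C^\times$; $V=V(1)$. Basis $v_1,\dots,v_{32}$; $\bar i=32-i$ for $i\le31$; $v_8,\dots,v_{14},v_{\overline{14}},\dots,v_{\bar8}$ are odd, the others even. Unlisted basis vectors are annihilated. $F_1$: $v_1\mapsto[4]v_8$, $v_9\mapsto[3]v_2$, $v_{10}\mapsto[3]v_3$, $v_{11}\mapsto[2]v_4$, $v_{12}\mapsto v_5$, $v_{13}\mapsto v_6$, $v_{14}\mapsto v_{15}$, $v_{16}\mapsto v_{\overline{14}}$, $v_{\bar6}\mapsto v_{\overline{13}}$, $v_{\bar5}\mapsto v_{\overline{12}}$, $v_{\bar4}\mapsto v_{\overline{11}}$, $v_{\bar3}\mapsto v_{\overline{10}}$, $v_{\bar2}\mapsto v_{\bar9}$, $v_{\bar8}\mapsto v_{\bar1}$; $F_2$: $v_8\mapsto v_9$, $v_{10}\mapsto v_{11}$, $v_{11}\mapsto[2]v_{12}$, $v_3\mapsto v_4$, $v_4\mapsto[2]v_5$, $v_5\mapsto[3]v_7$, $v_{13}\mapsto v_{14}$, $v_6\mapsto v_{16}$, $v_{15}\mapsto v_{\bar6}$, $v_{16}\mapsto[2]v_{\bar6}$, $v_{17}\mapsto v_{\bar6}$, $v_{\overline{14}}\mapsto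 v_{\overline{13}}$, $v_{\bar7}\mapsto v_{\bar5}$, $v_{\bar5}\mapsto[2]v_{\bar4}$, $v_{\bar4}\mapsto[3]v_{\bar3}$, $v_{\overline{12}}\mapsto v_{\overline{11}}$, $v_{\overline{11}}\mapsto[2]v_{\overline{10}}$, $v_{\bar9}\mapsto v_{\bar8}$; $F_3$: $v_9\mapsto v_{10}$, $v_2\mapsto v_3$, $v_{12}\mapsto v_{13}$, $v_5\mapsto v_6$, $v_7\mapsto v_{17}$, $v_{16}\mapsto[3]v_{\bar7}$, $v_{17}\mapsto[2]_3v_{\bar7}$, $v_{\bar6}\mapsto v_{\bar5}$, $v_{\overline{13}}\mapsto v_{\overline{12}}$, $v_{\bar3}\mapsto v_{\bar2}$, $v_{\overline{10}}\mapsto v_{\bar9}$. For $i\ge1$: for $1\le j,k\le14$, $E_iv_j=a\,v_k$ iff $F_iv_{\bar j}=a\,v_{\bar k}$; for $18\le j,k\le31$, $E_iv_j=(-1)^{s_i}a\,v_k$ iff $F_iv_{\bar j}=a\,v_{\bar k}$; for $15\le j\le17$, $k\in\{6,7,14\}$, $E_iv_j=a\,v_k$ iff $F_iv_j=a\,v_{\bar k}$, and $E_iv_{\bar k}=(-1)^{s_i}a\,v_j$ iff $F_iv_k=a\,v_j$. With matrix units $e_{a,b}v_c=\delta_{bc}v_a$: $$E_0=z\bigg(-\frac{[2]_6}{[3]^{\mathrm i}}e_{15,1}+[4]e_{16,1}-\frac{[2]_2[3]}{[3]^{\mathrm i}}e_{17,1}+\frac{[3]}{[3]^{\mathrm i}}e_{32,1}+e_{\bar1,15}+([2]^{\mathrm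 i})^2e_{\bar1,32}+\sum_{i=8}^{14}e_{10+i,i}\bigg),$$ $$F_0=z^{-1}\bigg(\frac{[2]_6}{[3]^{\mathrm i}}e_{15,\bar1}-[4]e_{16,\bar1}+\frac{[2]_2[3]}{[3]^{\mathrm i}}e_{17,\bar1}-\frac{[3]}{[3]^{\mathrm i}}e_{32,\bar1}-e_{1,15}-([2]^{\mathrm i})^2e_{1,32}+\sum_{i=8}^{14}e_{i,10+i}\bigg).$$ All $v_j$ are weight vectors ($K_iv_j=q_i^{\lambda_i}v_j$, $K_i^{1/2}v_j=q_i^{\lambda_i/2}v_j$ for $i\ge1$): $v_1$ has weight $(4,0,0)$, $v_{32}$ has weight $0$, the other weights are determined by $K_iF_j=q^{-\tilde B_{ij}}F_jK_i$; $K_0^{1/2}=(K_1^2K_2^4K_3^2)^{-1/2}$ (acting through the half-weights). **Intertwiner.** For generic $z$ the map $\check R(z)$ commuting with the action of all generators (through $\Delta$) is unique up to a scalar. **Projectors.** As $U_q\mathrm G_{2|1}$-module, $V\otimes V\cong L_{(8,0,0)}\oplus L_{(8,1,0)}\oplus L_{(7,0,1)}\oplus3L_{(4,0,0)}\oplus2L_{(0,0,0)}$. For the three multiplicity-one $\lambda$, $P^q_\lambda$ is the projector onto $L_\lambda$. For $\lambda=(4,0,0)$ (resp. $(0,0,0)$) and a $3\times3$ (resp. $2\times2$) matrix $f$, $f\otimes P^q_\lambda$ is the $U_q\mathrm G_{2|1}$-linear map vanishing on the other isotypic components and acting on singular vectors of weight $\lambda$ by $f$ in the ordered basis $(u_{4a},u_{4b},u_{4c})$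 (resp. $(u_{5a},u_{5b})$), columns of $f$ being images of basis vectors. Here $u_{4b}=v_1\otimes v_{32}$, $u_{4c}=v_{32}\otimes v_1$, $u_{5b}=v_{32}\otimes v_{32}$, $$\begin{aligned}u_{4a}=\;&-[3]_2^{\mathrm i}(q^3v_1\otimes v_{15}-q^{-3}v_{15}\otimes v_1)+[2]_3(q^3v_1\otimes v_{16}-q^{-3}v_{16}\otimes v_1)-[3](q^3v_1\otimes v_{17}-q^{-3}v_{17}\otimes v_1)\\&-[2]_3(q^5v_8\otimes v_{14}+q^{-5}v_{14}\otimes v_8-q^4v_9\otimes v_{13}-q^{-4}v_{13}\otimes v_9+qv_{10}\otimes v_{12}+q^{-1}v_{12}\otimes v_{10})+[3]^{\mathrm i}v_{11}\otimes v_{11},\end{aligned}$$ $$\begin{aligned}u_{5a}=\;&[3]^{\mathrm i}(q^{10}v_1\otimes v_{\bar1}+q^{-10}v_{\bar1}\otimes v_1)+[3]_2[4]\big(q^9v_2\otimes v_{\bar2}+q^{-9}v_{\bar2}\otimes v_2-q^6v_3\otimes v_{\bar3}-q^{-6}v_{\bar3}\otimes v_3\\&+q^3v_7\otimes v_{\bar7}+q^{-3}v_{\bar7}\otimes v_7\big)+[4][3]^{\mathrm i}\big(q^5v_4\otimes v_{\bar4}+q^{-5}v_{\bar4}\otimes v_4-q^4v_5\otimes v_{\bar5}-q^{-4}v_{\bar5}\otimes v_5+qv_6\otimes v_{\bar6}+q^{-1}v_{\bar6}\otimes v_6\\&+q^{10}v_8\otimes v_{\bar8}-q^{-10}v_{\bar8}\otimes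 v_8-q^9v_9\otimes v_{\bar9}+q^{-9}v_{\bar9}\otimes v_9+q^6v_{10}\otimes v_{\overline{10}}-q^{-6}v_{\overline{10}}\otimes v_{10}+q^4v_{12}\otimes v_{\overline{12}}-q^{-4}v_{\overline{12}}\otimes v_{12}\\&-qv_{13}\otimes v_{\overline{13}}+q^{-1}v_{\overline{13}}\otimes v_{13}+v_{14}\otimes v_{\overline{14}}-v_{\overline{14}}\otimes v_{14}-v_{15}\otimes v_{16}-v_{16}\otimes v_{15}\big)\\&-[2]_2[3]^{\mathrm i}(q^5v_{11}\otimes v_{\overline{11}}-q^{-5}v_{\overline{11}}\otimes v_{11})+[2]_2[3]_2^{\mathrm i}v_{15}\otimes v_{15}+[2]_2[3](v_{15}\otimes v_{17}+v_{17}\otimes v_{15}-v_{17}\otimes v_{17}).\end{aligned}$$ *)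

(* Defs.v *)
From HB Require Import structures.
From mathcomp Require Import all_boot all_order all_algebra.
From mathcomp Require Import complex mxtens.
From mathcomp Require Import boolp classical_sets reals sequences exp trigo.

Set Implicit Arguments.
Unset Strict Implicit.
Unset Printing Implicit Defensive.

Import Order.TTheory GRing.Theory Num.Theory.
Local Open Scope ring_scope.

Definition cexp (R : realType) (w : R[i]) : R[i] :=
  Complex (expR (complex.Re w) * cos (complex.Im w))
          (expR (complex.Re w) * sin (complex.Im w)).

(* q^a for a fixed choice of log q *)
Definition qpow (R : realType) (logq a : R[i]) : R[i] := cexp (a * logq).

Section QNumbers.
Context (K : fieldType) (q : K).

(* [m]_k *)
Definition qn (m k : nat) : K :=
  (q ^+ (k * m) - q ^- (k * m)) / (q ^+ k - q ^- k).

(* [n]^i_k *)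
Definition qi (n k : nat) : K :=
  (q ^+ (k * n) + (-1) ^+ n.-1 * q ^- (k * n)) / (q ^+ k + q ^- k).

End QNumbers.

(* [weight] lists (lambda_1, lambda_2, lambda_3); [coord l i] is lambda_i for
   i = 1, 2, 3. *)
Definition weight := (int * int * int)%type.
Definition coord (l : weight) (i : nat) : int :=
  nth 0 [:: l.1.1; l.1.2; l.2] i.-1.

Definition sgen (i : nat) : bool := i == 1%N.

Definition dgen (i : nat) : int := nth 0 [:: -4; -1; 1; 3] i.

Definition Btilde (i j : nat) : int :=
  nth 0 (nth [::] [:: [:: -8;  4;  0;  0];
                      [::  4;  0; -1;  0];
                      [::  0; -1;  2; -3];
                      [::  0;  0; -3;  6]] i) j.

(* The basis vectors v_1, ..., v_32 are referred to by their labels 1..32;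
   [ix a] is the corresponding (0-based) index. *)
Definition ix (a : nat) : 'I_32 := inord a.-1.
Definition bar (a : nat) : nat := (32 - a)%N.

Definition vodd (a : nat) : bool := (8 <= a <= 14)%N || (18 <= a <= 24)%N.

(* The weights of v_1, ..., v_32; see [vweightE]. *)
Definition vweight (a : nat) : weight :=
  nth (0, 0, 0)
   [:: ( 4,  0,  0); ( 3,  0,  1); ( 3,  3, -1); ( 2,  1,  0);
       ( 1, -1,  1); ( 1,  2, -1); ( 0, -3,  2); ( 4,  1,  0);
       ( 3, -1,  1); ( 3,  2, -1); ( 2,  0,  0); ( 1, -2,  1);
       ( 1,  1, -1); ( 0, -1,  0); ( 0,  0,  0); ( 0,  0,  0);
       ( 0,  0,  0); ( 0,  1,  0); (-1, -1,  1); (-1,  2, -1);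
       (-2,  0,  0); (-3, -2,  1); (-3,  1, -1); (-4, -1,  0);
       ( 0,  3, -2); (-1, -2,  1); (-1,  1, -1); (-2, -1,  0);
       (-3, -3,  1); (-3,  0, -1); (-4,  0,  0); ( 0,  0,  0)] a.-1.

Section Module.
Context (K : fieldType) (q : K).
Local Notation qn1 m := (qn q m 1).
Local Notation b := bar.
Local Notation arr j a k := (j%N, a%R : K, k%N).

(* An entry (j, a, k) of [Ftab i] means F_i v_j = a v_k. *)
Definition Ftab (i : nat) : seq (nat * K * nat) :=
  match i with
  | 1 => [:: arr 1 (qn1 4) 8; arr 9 (qn1 3) 2; arr 10 (qn1 3) 3;
           arr 11 (qn1 2) 4; arr 12 1 5; arr 13 1 6; arr 14 1 15;
           arr 16 1 (b 14); arr (b 6) 1 (b 13); arr (b 5) 1 (b 12);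
           arr (b 4) 1 (b 11); arr (b 3) 1 (b 10); arr (b 2) 1 (b 9);
           arr (b 8) 1 (b 1)]
  | 2 => [:: arr 8 1 9; arr 10 1 11; arr 11 (qn1 2) 12; arr 3 1 4;
           arr 4 (qn1 2) 5; arr 5 (qn1 3) 7; arr 13 1 14; arr 6 1 16;
           arr 15 1 (b 6); arr 16 (qn1 2) (b 6); arr 17 1 (b 6);
           arr (b 14) 1 (b 13); arr (b 7) 1 (b 5); arr (b 5) (qn1 2) (b 4);
           arr (b 4) (qn1 3) (b 3); arr (b 12) 1 (b 11);
           arr (b 11) (qn1 2) (b 10); arr (b 9) 1 (b 8)]
  | 3 => [:: arr 9 1 10; arr 2 1 3; arr 12 1 13; arr 5 1 6; arr 7 1 17;
           arr 16 (qn1 3) (b 7); arr 17 (qn q 2 3) (b 7); arr (b 6) 1 (b 5);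
           arr (b 13) 1 (b 12); arr (b 3) 1 (b 2); arr (b 10) 1 (b 9)]
  | _ => [::]
  end.

(* F_j lowers the exponent of q in K_i by Btilde i j; as every v_a is linked to
   v_1 by arrows of [Ftab], or is v_32, this determines [vweight]. *)
Lemma vweightE (i j : nat) : (0 < i < 4)%N -> (0 < j < 4)%N ->
  all (fun t => dgen i * coord (vweight t.2) i ==
                dgen i * coord (vweight t.1.1) i - Btilde i j) (Ftab j).
Proof. by case: i => [|[|[|[|]]]] //; case: j => [|[|[|[|]]]]. Qed.

Definition e (a c : nat) : 'M[K]_32 := delta_mx (ix a) (ix c).

Definition F0 : 'M[K]_32 :=
    (qn q 2 6 / qi q 3 1) *: e 15 (b 1) - qn1 4 *: e 16 (b 1)
  + (qn q 2 2 * qn1 3 / qi q 3 1) *: e 17 (b 1)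
  - (qn1 3 / qi q 3 1) *: e 32 (b 1) - e 1 15
  - (qi q 2 1) ^+ 2 *: e 1 32 + \sum_(8 <= i < 15) e i (10 + i).

Definition E0 : 'M[K]_32 :=
  - ((qn q 2 6 / qi q 3 1) *: e 15 1) + qn1 4 *: e 16 1
  - (qn q 2 2 * qn1 3 / qi q 3 1) *: e 17 1
  + (qn1 3 / qi q 3 1) *: e 32 1 + e (b 1) 15
  + (qi q 2 1) ^+ 2 *: e (b 1) 32 + \sum_(8 <= i < 15) e (10 + i) i.

Definition Fpos (i : nat) : 'M[K]_32 :=
  \sum_(t <- Ftab i) t.1.2 *: e t.2 t.1.1.

Definition Ecoef (i k j : nat) : K :=
  let f a c := Fpos i (ix a) (ix c) in
  if (j <= 14)%N && (k <= 14)%N then f (b k) (b j)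
  else if (18 <= j <= 31)%N && (18 <= k <= 31)%N then
    (-1) ^+ sgen i * f (b k) (b j)
  else if (15 <= j <= 17)%N && (k \in [:: 6; 7; 14]%N) then f (b k) j
  else if (15 <= k <= 17)%N && (b j \in [:: 6; 7; 14]%N) then
    (-1) ^+ sgen i * f k (b j)
  else 0.

Definition Epos (i : nat) : 'M[K]_32 :=
  \matrix_(k, j) Ecoef i k.+1 j.+1.

(* The action of F_i and E_i on V(z). *)
Definition Fact (z : K) (i : nat) : 'M[K]_32 :=
  if i == 0%N then z^-1 *: F0 else Fpos i.
Definition Eact (z : K) (i : nat) : 'M[K]_32 :=
  if i == 0%N then z *: E0 else Epos i.

Definition parmx : 'M[K]_32 :=
  diag_mx (\row_(j < 32) (-1) ^+ vodd j.+1).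

(* A (x) B for B of parity p, with (A (x) B)(v (x) w) = (-1)^(p p_v) Av (x) Bw;
   the basis of V (x) V is indexed through [mxtens_index]. *)
Definition stens (A : 'M[K]_32) (p : bool) (B : 'M[K]_32) : 'M[K]_(32 * 32) :=
  (if p then A *m parmx else A) *t B.

(* v_a (x) v_c *)
Definition vv (a c : nat) : 'cV[K]_(32 * 32) :=
  delta_mx (mxtens_index (ix a, ix c)) 0.

Definition u4a : 'cV[K]_(32 * 32) :=
  - (qi q 3 2 *: (q ^+ 3 *: vv 1 15 - q ^- 3 *: vv 15 1))
  + qn q 2 3 *: (q ^+ 3 *: vv 1 16 - q ^- 3 *: vv 16 1)
  - qn1 3 *: (q ^+ 3 *: vv 1 17 - q ^- 3 *: vv 17 1)
  - qn q 2 3 *: (q ^+ 5 *: vv 8 14 + q ^- 5 *: vv 14 8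
                 - q ^+ 4 *: vv 9 13 - q ^- 4 *: vv 13 9
                 + q *: vv 10 12 + q^-1 *: vv 12 10)
  + qi q 3 1 *: vv 11 11.

Definition u5a : 'cV[K]_(32 * 32) :=
  qi q 3 1 *: (q ^+ 10 *: vv 1 (b 1) + q ^- 10 *: vv (b 1) 1)
  + (qn q 3 2 * qn1 4) *:
      (q ^+ 9 *: vv 2 (b 2) + q ^- 9 *: vv (b 2) 2
       - q ^+ 6 *: vv 3 (b 3) - q ^- 6 *: vv (b 3) 3
       + q ^+ 3 *: vv 7 (b 7) + q ^- 3 *: vv (b 7) 7)
  + (qn1 4 * qi q 3 1) *:
      (q ^+ 5 *: vv 4 (b 4) + q ^- 5 *: vv (b 4) 4
       - q ^+ 4 *: vv 5 (b 5) - q ^- 4 *: vv (b 5) 5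
       + q *: vv 6 (b 6) + q^-1 *: vv (b 6) 6
       + q ^+ 10 *: vv 8 (b 8) - q ^- 10 *: vv (b 8) 8
       - q ^+ 9 *: vv 9 (b 9) + q ^- 9 *: vv (b 9) 9
       + q ^+ 6 *: vv 10 (b 10) - q ^- 6 *: vv (b 10) 10
       + q ^+ 4 *: vv 12 (b 12) - q ^- 4 *: vv (b 12) 12
       - q *: vv 13 (b 13) + q^-1 *: vv (b 13) 13
       + vv 14 (b 14) - vv (b 14) 14
       - vv 15 16 - vv 16 15)
  - (qn q 2 2 * qi q 3 1) *:
      (q ^+ 5 *: vv 11 (b 11) - q ^- 5 *: vv (b 11) 11)
  + (qn q 2 2 * qi q 3 2) *: vv 15 15
  + (qn q 2 2 * qn1 3) *: (vv 15 17 + vv 17 15 - vv 17 17).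

(* (u_4a, u_4b, u_4c) and (u_5a, u_5b) *)
Definition u4 (j : 'I_3) : 'cV[K]_(32 * 32) :=
  nth 0 [:: u4a; vv 1 32; vv 32 1] j.
Definition u5 (j : 'I_2) : 'cV[K]_(32 * 32) :=
  nth 0 [:: u5a; vv 32 32] j.

Definition mx_of (n : nat) (rows : seq (seq K)) : 'M[K]_n :=
  \matrix_(i, j) nth 0 (nth [::] rows i) j.

Definition alpha (x : K) : K :=
  (x ^+ 5 - x + 2%:R * x ^- 7 - x ^- 9) * qn x 3 1 / qi x 3 1.
Definition beta : K := (qi q 2 1) ^+ 3 * qn q 2 2 * qn1 4 / qi q 3 1.
Definition gamma : K :=
  qi q 2 1 * qi q 3 2 * qn1 2 * (qn1 3) ^+ 2 / qi q 3 1.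
Definition mu : K := (qi q 2 1) ^+ 3 * qn1 3 * qn1 4 / qi q 3 1.
Definition nu : K := (qn q 2 7 + qn q 2 3 - qn1 2) / qi q 3 1.
Definition zeta : K := qn1 4 * qi q 3 2 / qi q 3 1.
Definition xi : K :=
  qn q 2 2 * qn q 3 2 * (qn q 2 8 - qn q 2 6 - qn q 2 4 + qn1 3) / qi q 3 1.
Definition eta : K := (qi q 2 1) ^+ 5 * qn1 4 / qi q 3 1.
Definition rho : K :=
  qi q 2 1 * (qn1 3) ^+ 2 * qn q 3 3 * qn1 4 / qi q 3 1.

Definition f1 (z : K) : 'M[K]_3 :=
  let s := mu * z * (q ^+ 3 + q ^- 3 * z) in
  let t := (1 - z) * (q ^+ 3 - nu * z + q ^- 3 * z ^+ 2) in
  mx_of 3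
   [:: [:: - q ^- 3 + alpha q * z - alpha q^-1 * z ^+ 2 + q ^+ 3 * z ^+ 3;
           beta * z * (1 - z); beta * z * (1 - z)];
       [:: gamma * z * (1 - z); s; t];
       [:: gamma * z * (1 - z); t; s]].

Definition f0 (z : K) : 'M[K]_2 :=
  mx_of 2
   [:: [:: q ^- 6 - q ^- 3 * zeta * z + xi * z ^+ 2 - q ^+ 3 * zeta * z ^+ 3
           + q ^+ 6 * z ^+ 4;
           eta * z * (1 - z ^+ 2)];
       [:: rho * z * (1 - z ^+ 2);
           q ^+ 6 - q ^+ 3 * zeta * z + xi * z ^+ 2 - q ^- 3 * zeta * z ^+ 3
           + q ^- 6 * z ^+ 4]].

End Module.

(* K_i^{1/2}, K_i^{-1/2}, E_i, F_i for i = 0, 1, 2, 3 *)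
Inductive generator :=
  | GK of 'I_4 | GKV of 'I_4 | GE of 'I_4 | GF of 'I_4.

Definition gen_index (x : generator) : 'I_4 :=
  match x with GK i | GKV i | GE i | GF i => i end.

Section Intertwiner.
Context (R : realType).
Local Notation C := R[i].
Local Notation VV := 'cV[C]_(32 * 32).
Context (q logq : C).

(* The exponent m such that K_i v_a = q^m v_a; for i = 0 it comes from
   K_0 = (K_1^2 K_2^4 K_3^2)^{-1}. *)
Definition kexp (i a : nat) : int :=
  let m i := dgen i * coord (vweight a) i in
  if i == 0%N then - (2 * m 1%N + 4 * m 2%N + 2 * m 3%N) else m i.

Definition Khalf (i : nat) : 'M[C]_32 :=
  diag_mx (\row_(j < 32) qpow logq ((kexp i j.+1)%:~R / 2%:R)).
Definition KhalfV (i : nat) : 'M[C]_32 :=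
  diag_mx (\row_(j < 32) qpow logq (- (kexp i j.+1)%:~R / 2%:R)).

(* The action of a generator on V(z1) (x) V(z2) *)
Definition coact (z1 z2 : C) (x : generator) : 'M[C]_(32 * 32) :=
  match x with
  | GK i => stens (Khalf i) false (Khalf i)
  | GKV i => stens (KhalfV i) false (KhalfV i)
  | GE i => stens (Eact q z1 i) false (Khalf i)
            + stens (KhalfV i) (sgen i) (Eact q z2 i)
  | GF i => stens (Fact q z1 i) false (Khalf i)
            + stens (KhalfV i) (sgen i) (Fact q z2 i)
  end.

Definition intertwiner (z : C) (X : 'M[C]_(32 * 32)) : Prop :=
  forall x, X *m coact z 1 x = coact 1 z x *m X.

(* Below, V (x) V is regarded as a module over the subalgebra generated by the
   generators of nonzero index. *)
Definition submodule (W : {vspace VV}) : Prop :=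
  forall x, gen_index x != ord0 ->
  forall w, w \in W -> coact 1 1 x *m w \in W.

Definition irreducible (W : {vspace VV}) : Prop :=
  [/\ submodule W, W != 0%VS
    & forall W', submodule W' -> (W' <= W)%VS -> W' = 0%VS \/ W' = W].

Definition singular (l : weight) (w : VV) : Prop :=
  forall i : 'I_4, i != ord0 ->
    coact 1 1 (GE i) *m w = 0 /\
    coact 1 1 (GK i) *m (coact 1 1 (GK i) *m w) = q ^ (dgen i * coord l i) *: w.

(* W is isomorphic to L_l *)
Definition isL (l : weight) (W : {vspace VV}) : Prop :=
  irreducible W /\ exists w, [/\ w \in W, w != 0 & singular l w].

Definition kills_others (l : weight) (X : 'M[C]_(32 * 32)) : Prop :=
  forall W, irreducible W -> ~ isL l W -> forall w, w \in W -> X *m w = 0.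

Definition is_proj (l : weight) (P : 'M[C]_(32 * 32)) : Prop :=
  (forall W, isL l W -> forall w, w \in W -> P *m w = w) /\ kills_others l P.

Definition is_ftens (l : weight) (n : nat) (u : 'I_n -> VV) (f : 'M[C]_n)
    (X : 'M[C]_(32 * 32)) : Prop :=
  [/\ forall x, gen_index x != ord0 -> X *m coact 1 1 x = coact 1 1 x *m X,
      kills_others l X
    & forall j, X *m u j = \sum_i f i j *: u i].

(* P^q_l and f (x) P^q_l: the maps determined by the above conditions *)
Definition proj (l : weight) : 'M[C]_(32 * 32) :=
  xget 0 [set P | is_proj l P]%classic.
Definition ftens (l : weight) (n : nat) (u : 'I_n -> VV) (f : 'M[C]_n) :
    'M[C]_(32 * 32) :=
  xget 0 [set X | is_ftens l u f X]%classic.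

End Intertwiner.

(* Main.v *)
Require Import Defs.
From Stdlib Require Import ZArith.
From mathcomp Require Import all_boot all_order all_algebra.
From mathcomp Require Import complex mxtens ssrZ zify ring.
From mathcomp Require Import boolp classical_sets reals exp trigo.

Set Implicit Arguments.
Unset Strict Implicit.
Unset Printing Implicit Defensive.

Import GRing.Theory Num.Theory.
Local Open Scope ring_scope.
Delimit Scope Z_scope with ZZ.

(** Let T = V (x) V and h = q^(1/2). A symmetric form on V for which E_i and F_i are
    adjoint up to sign induces a form on T, and an explicit basis s_k of the singular
    vectors of T is orthogonal with non-zero norms. As the E_i raise a height, it follows
    that T is generated from the s_k by the F_i and that each map of the s_k preserving
    the weights extends uniquely to an endomorphism of T; the projectors and the maps
    f (x) P are such extensions, so both sides of the theorem are determined by 8 x 8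
    matrices.

    The adjoint action of the E_i, i > 0, on E_0 spans a 31-dimensional space. For an
    operator X_n of this space acting on V(z) (x) V, and a candidate solution R, put
    y_n = R X_n s_k - X_n R s_k. A downward induction shows that y_n is singular, so
    y_n = 0 follows from the orthogonality to the s_j, which is a finite list of
    identities between Laurent polynomials in h and polynomials in z. In particular R
    commutes with E_0; the statement for F_0 is its transpose at 1/z, since R(z) is
    self-adjoint and R(z) R(1/z) = 1. Conversely, the pairings of s_j with R X_n s_k
    for a few n force the coefficients of an intertwiner one isotypic component after
    the other, if z is not one of q^4, q^6, q^-6, q^-8; the same values are excluded
    for 1/z, where R(1/z) is used.

    The identities are checked by computation with sparse matrices over Z[h, 1/h]; a
    coefficient is shown to be non-zero by factoring it into cyclotomic polynomials. *)

(** There is no complete reducibility to start from, and [proj] and [ftens] are chosen among all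
    maps with given properties; so the splitting of T, and the existence and uniqueness of these
    maps, have to be derived. The form replaces semisimplicity: images of the F_i are orthogonal to
    singular vectors, so non-zero norms of the s_k forbid a singular vector generated from below.

    The orbit of E_0 answers an obstacle. E_0 commutes with the F_i, i > 0, so its relation with R
    need only be tested on the s_k; but E_0 s_k is in general not singular, and pairings with the
    s_j see a vector only modulo the images of the F_i. Since E_i s_k = 0, applying E_i to X_n s_k
    gives a multiple of a later X_m s_k, and this stops, the orbit having the 31 weights of v_1,
    ..., v_31. The two tensor legs of X_n require different q-commutators, which is harmless on
    singular vectors.

    T has dimension 1024; it is read as the space of 32 x 32 matrices x, on which the tensor product
    of A and B acts by A x B^T. E_0 and F_0 are multiplied by [3]^i, so that all coefficients are
    Laurent polynomials. *)

Section LinearClosure.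
Context (C : fieldType) (n : nat).
Implicit Types (P : 'cV[C]_n -> Prop).

Definition lin_closed P :=
  P 0 /\ forall a x y, P x -> P y -> P (a *: x + y).

(** The predicate need not be decidable, so the subspace is taken of maximal dimension among those
    contained in P: a further vector of P could be adjoined to it. *)
Lemma lin_closed_vspace P : lin_closed P ->
  exists W : {vspace 'cV[C]_n}, forall x, (x \in W) <-> P x.
Proof.
move=> [P0 PD].
pose Q d := `[< exists W : {vspace 'cV[C]_n},
                 \dim W = d /\ forall x, x \in W -> P x >].
have Q0 : exists d, Q d.
  exists 0%N; apply/asboolP; exists 0%VS; split; first by rewrite dimv0.
  by move=> x; rewrite memv0 => /eqP ->.
have Qub d : Q d -> (d <= \dim {:'cV[C]_n})%N.
  by move=> /asboolP [W [<- _]]; rewrite dimvS ?subvf.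
case: (ex_maxnP Q0 Qub) => d /asboolP [W [dW WP]] dmax.
exists W => x; split; first exact: WP.
move=> Px.
have Qx : Q (\dim (W + <[x]>)).
  apply/asboolP; exists (W + <[x]>)%VS; split=> // y.
  move=> /memv_addP [w wW [u /vlineP [a ->] ->]].
  by rewrite addrC; apply: PD => //; apply: WP.
have WE : (W == (W + <[x]>)%VS).
  by rewrite eqEdim addvSl /= dW dmax.
by rewrite (eqP WE); apply: (subvP (addvSr W <[x]>)); rewrite memv_line.
Qed.

(** The functional is a non-zero coordinate of x minus its projection to the subspace. The dichotomy
    reduces a statement of generation to one about the vectors orthogonal to everything
    generated. *)
Lemma lin_closed_annihilator P : lin_closed P ->
  (forall x, P x) \/
  exists2 xi : 'rV[C]_n, xi != 0 & forall x, P x -> xi *m x = 0.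
Proof.
move=> /lin_closed_vspace [W WP].
have [WT|WnT] := eqVneq W fullv.
  by left=> x; apply/WP; rewrite WT memvf.
right; pose f x := x - projv W x.
have [x0 fx0] : exists x, f x != 0.
  apply: contrapT => nf; case/negP: WnT; rewrite eqEsubv subvf /=; apply/subvP => x _.
  apply: contrapT => /negP xW; apply: nf; exists x.
  apply: contraNneq xW => /eqP; rewrite subr_eq0 => /eqP ->.
  exact: memv_proj.
have [k fk] : exists k, f x0 k 0 != 0.
  apply: contrapT => nf; case/negP: fx0; apply/eqP/colP => k.
  rewrite [RHS]mxE; apply: contrapT => h; apply: nf; exists k.
  exact/eqP.
pose xi : 'rV[C]_n := \row_j f (delta_mx j 0) k 0.
have fE x : f x = \sum_j x j 0 *: f (delta_mx j 0).
  rewrite {1}/f {1 2}[x]matrix_sum_delta linear_sum /= -sumrB.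
  apply: eq_bigr => j _; rewrite !big_ord1 linearZ /= -scalerBr.
  by congr (_ *: _).
have xiE x : xi *m x = (f x k 0)%:M.
  apply/matrixP => i j; rewrite !ord1 mxE [RHS]mxE eqxx mulr1n fE summxE.
  by apply: eq_bigr => l _; rewrite [xi _ _]mxE [RHS]mxE mulrC.
exists xi.
  apply: contraNneq fk => xi0; move: (xiE x0).
  by rewrite xi0 mul0mx => /matrixP /(_ 0 0); rewrite !mxE eqxx mulr1n => <-.
move=> x /WP xW; rewrite xiE /f projv_id // subrr mxE.
by apply/matrixP => i j; rewrite !mxE mul0rn.
Qed.

End LinearClosure.

(** * Modules with a triangular structure and a form: extension of maps, isotypic projectors *)

Section Triangular.
Context (C : fieldType) (n r : nat) (I : finType) (T : eqType).
Local Notation V := 'cV[C]_n.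
Context (E F K Kv : I -> 'M[C]_n) (G : 'M[C]_n).
Context (c sg : I -> I -> C) (a eps : I -> C) (ht : 'I_n -> nat).
Context (s : 'I_r -> V) (cls : 'I_r -> T) (chi : I -> T -> C) (gam : 'I_r -> C).

Definition singularv (x : V) := forall i, E i *m x = 0.
Definition imF (x : V) := exists y : I -> V, x = \sum_i F i *m y i.
Definition commutes (X : 'M[C]_n) := forall i,
  [/\ X *m E i = E i *m X, X *m F i = F i *m X,
      X *m K i = K i *m X & X *m Kv i = Kv i *m X].

(** What is used about T. The K_i play the role of the half powers K_i^(1/2), which is why their
    squares occur in [tri_EF]; [sg] is the super sign. [cls k] is the weight of s_k, shared by
    several k when there is multiplicity, and [chi i t] is the eigenvalue of K_i at the weight t. *)
Record triangular : Prop := Triangular {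
  tri_KKv : forall i, K i *m Kv i = 1%:M;
  tri_c : forall i j, c i j != 0;
  tri_KF : forall i j, K i *m F j = c i j *: (F j *m K i);
  tri_EF : forall i j, E i *m F j = sg i j *: (F j *m E i)
    + (if i == j then a i *: (K i *m K i - Kv i *m Kv i) else 0);
  tri_ht : forall i k j, E i k j != 0 -> (ht j < ht k)%N;
  tri_Gsym : G^T = G;
  tri_G : G \in unitmx;
  tri_GE : forall i, G *m E i = eps i *: ((F i)^T *m G);
  tri_s : forall k, singularv (s k);
  tri_sK : forall i k, K i *m s k = chi i (cls k) *: s k;
  tri_chi : forall i t, chi i t != 0;
  tri_gram : forall j k, (s j)^T *m G *m s k = (if j == k then gam k else 0)%:M;
  tri_gam : forall k, gam k != 0;
  tri_eps : forall i, eps i != 0;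
  tri_span : forall x, singularv x -> exists b : 'I_r -> C, x = \sum_k b k *: s k
}.

Hypothesis (tri : triangular).

Lemma imF_lin : lin_closed imF.
Proof.
split; first by exists (fun=> 0); rewrite big1 // => i _; rewrite mulmx0.
move=> b x y [fx ->] [fy ->]; exists (fun i => b *: fx i + fy i).
rewrite scaler_sumr -big_split /=; apply: eq_bigr => i _.
by rewrite mulmxDr -scalemxAr.
Qed.

Lemma imF_F i x : imF (F i *m x).
Proof.
exists (fun j => if j == i then x else 0).
rewrite (bigD1 i) //= eqxx big1 ?addr0 // => j /negPf ->.
by rewrite mulmx0.
Qed.

(* The E_i raise ht, so any sufficiently long word in them kills x. *)
Lemma Estable_singular (P : V -> Prop) :
  (forall i x, P x -> P (E i *m x)) ->
  forall x, P x -> x != 0 -> exists y, [/\ P y, y != 0 & singularv y].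
Proof.
move=> PE.
pose B := (\max_k ht k).+1.
suff H d : forall x, P x -> x != 0 ->
    (forall k, x k 0 != 0 -> (B <= ht k + d)%N) ->
    exists y, [/\ P y, y != 0 & singularv y].
  by move=> x Px x0; apply: (H B x Px x0) => k _; rewrite leq_addl.
elim: d => [|d IH] x Px x0 xB.
  case/eqP: x0; apply/colP => k; rewrite [RHS]mxE; apply: contrapT => /eqP xk.
  have := xB k xk; rewrite addn0 leqNgt ltnS => /negP; apply.
  exact: leq_bigmax.
have [xs|/existsNP [i /eqP xi]] := pselect (singularv x).
  by exists x.
apply: (IH _ (PE i x Px) xi) => k; rewrite mxE => xk.
have [j /negP xj] : exists j, ~ (E i k j * x j 0 == 0).
  apply/existsNP => h; case/eqP: xk; apply: big1 => j _.
  by apply/eqP; have := h j.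
move: xj; rewrite mulf_eq0 negb_or => /andP [Ekj xj].
have := xB j xj; rewrite addnS => /leq_trans; apply.
by rewrite -addSn leq_add2r (tri_ht tri Ekj).
Qed.

Lemma gram_span k (b : 'I_r -> C) :
  (s k)^T *m G *m (\sum_j b j *: s j) = (b k * gam k)%:M.
Proof.
rewrite mulmx_sumr (bigD1 k) //= -scalemxAr (tri_gram tri) eqxx.
rewrite big1 ?addr0 ?scale_scalar_mx // => j /negPf jk.
by rewrite -scalemxAr (tri_gram tri) eq_sym jk scale_scalar_mx mulr0 raddf0.
Qed.

Lemma span_free (b : 'I_r -> C) : \sum_k b k *: s k = 0 -> forall k, b k = 0.
Proof.
move=> b0 k; have := gram_span k b; rewrite b0 mulmx0 => /matrixP /(_ 0 0).
rewrite !mxE eqxx mulr1n => /esym /eqP; rewrite mulf_eq0 => /orP [/eqP //|].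
by rewrite (negPf (tri_gam tri k)).
Qed.

Lemma tri_GF i : (E i)^T *m G = eps i *: (G *m F i).
Proof.
have /(congr1 trmx) := tri_GE tri i.
by rewrite trmx_mul linearZ /= trmx_mul trmxK (tri_Gsym tri).
Qed.

Lemma imF_orth k x : imF x -> (s k)^T *m G *m x = 0.
Proof.
case=> y ->; rewrite mulmx_sumr big1 // => i _.
have := congr1 (fun M => (s k)^T *m M *m y i) (tri_GF i).
rewrite /= mulmxA -trmx_mul (tri_s tri) trmx0 !mul0mx -scalemxAr -scalemxAl.
move=> /esym /eqP; rewrite scaler_eq0 (negPf (tri_eps tri i)) /= => /eqP.
by rewrite !mulmxA.
Qed.

(** The coefficients of x along the s_k are its pairings with them divided by the norms, and these
    pairings vanish because the form turns F_i into E_i. *)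
Lemma singular_imF x : singularv x -> imF x -> x = 0.
Proof.
move=> /(tri_span tri) [b xE] xF; rewrite xE big1 // => k _.
have := gram_span k b; rewrite -xE (imF_orth k xF) => /matrixP /(_ 0 0).
rewrite !mxE eqxx mulr1n => /esym /eqP.
by rewrite mulf_eq0 (negPf (tri_gam tri k)) orbF => /eqP ->; rewrite scale0r.
Qed.

(** Induction on the generation from the s_k by the F_i. If P is proper, the non-zero vectors
    orthogonal to it exist and are permuted by the E_i up to zero, so one of them is singular; being
    orthogonal to all s_k it vanishes. *)
Lemma Fgen_ind (P : V -> Prop) : lin_closed P ->
  (forall i x, P x -> P (F i *m x)) -> (forall k, P (s k)) -> forall x, P x.
Proof.
move=> Plin PF Ps; case: (lin_closed_annihilator Plin) => // -[xi xi0 Pxi].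
pose y := (xi *m invmx G)^T.
have yG : y^T *m G = xi by rewrite trmxK mulmxKV // (tri_G tri).
have y0 : y != 0.
  by apply: contraNneq xi0 => y0; rewrite -yG y0 trmx0 mul0mx.
have [||z [zP z0 zs]] := @Estable_singular
    (fun y => forall u, P u -> y^T *m G *m u = 0) _ y _ y0.
- move=> i w wP u Pu; rewrite trmx_mul -(mulmxA w^T) tri_GF -scalemxAr.
  by rewrite -scalemxAl mulmxA -(mulmxA _ (F i)) wP ?scaler0 //; apply: PF.
- by move=> u Pu; rewrite yG; apply: Pxi.
case/eqP: z0; have [b zE] := tri_span tri zs.
rewrite zE big1 // => k _.
have /(congr1 trmx) := zP _ (Ps k).
rewrite !trmx_mul trmxK trmx0 (tri_Gsym tri) mulmxA zE gram_span.
move=> /matrixP /(_ 0 0); rewrite !mxE eqxx mulr1n => /eqP.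
by rewrite mulf_eq0 (negPf (tri_gam tri k)) orbF => /eqP ->; rewrite scale0r.
Qed.

Lemma span_imF x : exists (b : 'I_r -> C) (u : V),
  imF u /\ x = \sum_k b k *: s k + u.
Proof.
move: x; apply: Fgen_ind.
- split.
    exists (fun=> 0), 0; split; first exact: (imF_lin).1.
    by rewrite addr0 big1 // => k _; rewrite scale0r.
  move=> e x y [bx [ux [Fx ->]]] [b' [u' [F' ->]]].
  exists (fun k => e * bx k + b' k), (e *: ux + u').
  split; first exact: (imF_lin).2.
  rewrite scalerDr addrACA scaler_sumr -big_split /=; congr (_ + _).
  by apply: eq_bigr => k _; rewrite scalerDl scalerA.
- move=> i x _; exists (fun=> 0), (F i *m x); split; first exact: imF_F.
  by rewrite big1 ?add0r // => k _; rewrite scale0r.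
- move=> k; exists (fun j => (j == k)%:R), 0; split; first exact: (imF_lin).1.
  rewrite addr0 (bigD1 k) //= eqxx scale1r big1 ?addr0 // => j /negPf ->.
  by rewrite scale0r.
Qed.

Definition acts_by (X : 'M[C]_n) (phi : 'M[C]_r) :=
  forall k, X *m s k = \sum_j phi j k *: s j.

Lemma acts_byD (X Y : 'M[C]_n) (f g : 'M[C]_r) :
  acts_by X f -> acts_by Y g -> acts_by (X + Y) (f + g).
Proof.
move=> Xf Yg k; rewrite mulmxDl Xf Yg -big_split; apply: eq_bigr => j _.
by rewrite mxE scalerDl.
Qed.

Lemma acts_byZ b (X : 'M[C]_n) (f : 'M[C]_r) : acts_by X f -> acts_by (b *: X) (b *: f).
Proof.
move=> Xf k; rewrite -scalemxAl Xf scaler_sumr; apply: eq_bigr => j _.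
by rewrite mxE scalerA.
Qed.

Lemma commutesD X Y : commutes X -> commutes Y -> commutes (X + Y).
Proof.
move=> cX cY i; have [h1 h2 h3 h4] := cX i; have [g1 g2 g3 g4] := cY i.
by split; rewrite mulmxDl mulmxDr; congr (_ + _).
Qed.

Lemma commutesZ b X : commutes X -> commutes (b *: X).
Proof.
move=> cX i; have [h1 h2 h3 h4] := cX i.
by split; rewrite -scalemxAl -scalemxAr; congr (_ *: _).
Qed.

Lemma comm_eq (X Y : 'M[C]_n) (phi : 'M[C]_r) :
  (forall i, X *m F i = F i *m X) -> (forall i, Y *m F i = F i *m Y) ->
  acts_by X phi -> acts_by Y phi -> X = Y.
Proof.
move=> XF YF Xs Ys.
have XY : forall x : V, X *m x = Y *m x.
  apply: (Fgen_ind (P := fun x => X *m x = Y *m x)).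
  - by split=> [|e x y hx hy]; rewrite ?mulmx0 // !mulmxDr -!scalemxAr hx hy.
  - by move=> i x h; rewrite !mulmxA XF YF -!mulmxA h.
  - by move=> k; rewrite Xs Ys.
apply/matrixP => i j; have /colP /(_ i) := XY (delta_mx j 0).
by rewrite -!colE !mxE.
Qed.

(** X preserves the sum of the images of the F_i, which is orthogonal to s_j; only the components of
    x along the s_k contribute, and these are pairings divided by norms. *)
Lemma pair_comm (X : 'M[C]_n) (phi : 'M[C]_r) j (x : V) :
  (forall i, X *m F i = F i *m X) -> acts_by X phi ->
  (s j)^T *m G *m (X *m x) =
    \sum_k (gam j * phi j k / gam k) *: ((s k)^T *m G *m x).
Proof.
move=> XF Xs; have [b [u [Fu ->]]] := span_imF x.
have XFu : imF (X *m u).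
  case: Fu => y ->; exists (fun i => X *m y i).
  by rewrite mulmx_sumr; apply: eq_bigr => i _; rewrite !mulmxA XF.
rewrite mulmxDr mulmxDr (imF_orth j XFu) addr0.
have -> : X *m (\sum_k b k *: s k) = \sum_i (\sum_k phi i k * b k) *: s i.
  rewrite mulmx_sumr; under eq_bigr => k _ do
    rewrite -scalemxAr Xs scaler_sumr.
  rewrite exchange_big /=; apply: eq_bigr => i _.
  by rewrite scaler_suml; apply: eq_bigr => k _; rewrite scalerA mulrC.
rewrite gram_span.
under [RHS]eq_bigr => k _ do
  rewrite mulmxDr (imF_orth k Fu) addr0 gram_span scale_scalar_mx.
rewrite mulr_suml raddf_sum /=; apply: eq_bigr => k _; congr (_%:M).
by rewrite (mulrC (b k)) [RHS]mulrA divfK ?(tri_gam tri) // mulrC mulrA.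
Qed.

(** Both sides are compared on the left against x, by induction on the generation of x. The form
    trades F_i^T for E_i in the inductive step; for x = s_j the left side is computed by [pair_comm]
    and the right side by the action of Y on s_j. *)
Lemma self_adjoint (Y : 'M[C]_n) (phi : 'M[C]_r) : commutes Y -> acts_by Y phi ->
  (forall j k, gam j * phi j k = gam k * phi k j) -> G *m Y = Y^T *m G.
Proof.
move=> cY Ys sym; have YF i : Y *m F i = F i *m Y by have [] := cY i.
have H : forall x : V, x^T *m (G *m Y) = x^T *m (Y^T *m G).
  apply: (Fgen_ind (P := fun x => x^T *m (G *m Y) = x^T *m (Y^T *m G))).
  - split=> [|e x y hx hy]; first by rewrite trmx0 !mul0mx.
    by rewrite linearD linearZ /= !mulmxDl -!scalemxAl hx hy.
  - move=> i x Hx; have [YE _ _ _] := cY i.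
    have FG : (F i)^T *m G = (eps i)^-1 *: (G *m E i).
      by rewrite (tri_GE tri) scalerA mulVf ?scale1r // (tri_eps tri).
    have e1 : (F i)^T *m (G *m Y) = (eps i)^-1 *: (G *m Y *m E i).
      by rewrite mulmxA FG -scalemxAl -!mulmxA YE.
    have e2 : (F i)^T *m (Y^T *m G) = (eps i)^-1 *: (Y^T *m G *m E i).
      by rewrite mulmxA -trmx_mul YF trmx_mul -[LHS]mulmxA FG -scalemxAr mulmxA.
    by rewrite trmx_mul -!(mulmxA x^T) e1 e2 -!scalemxAr (mulmxA x^T (G *m Y))
      (mulmxA x^T (Y^T *m G)) Hx.
  - move=> j; have pairE := pair_comm j _ YF Ys.
    apply/rowP => t; have /matrixP /(_ 0 0) := pairE (delta_mx t 0).
    rewrite !mulmxA -trmx_mul -!colE => H.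
    transitivity ((col t ((s j)^T *m G *m Y)) 0 0); first by rewrite [RHS]mxE.
    rewrite H summxE Ys linear_sum mulmx_suml summxE; apply: eq_bigr => k _.
    rewrite linearZ /= -scalemxAl -colE !mxE; congr (_ * _).
    by rewrite sym mulrAC mulfV ?mul1r // (tri_gam tri).
apply/matrixP => i j; have /matrixP /(_ 0 j) := H (delta_mx i 0).
by rewrite trmx_delta -!rowE !mxE.
Qed.

(* The graph of the extension of phi, generated by the pairs (s_k, phi s_k)
   under the diagonal action of the F_i. *)
Inductive ext_graph (phi : 'M[C]_r) : V -> V -> Prop :=
  | Ext0 : ext_graph phi 0 0
  | ExtS k : ext_graph phi (s k) (\sum_j phi j k *: s j)
  | ExtD e x y x' y' : ext_graph phi x y -> ext_graph phi x' y' ->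
      ext_graph phi (e *: x + x') (e *: y + y')
  | ExtF i x y : ext_graph phi x y -> ext_graph phi (F i *m x) (F i *m y).

Section Extension.
Context (phi : 'M[C]_r).
Hypothesis phi_cls : forall j k, phi j k != 0 -> cls j = cls k.
Local Notation gr := (ext_graph phi).

Lemma phi_eigen k (M : 'M[C]_n) (f : T -> C) :
  (forall k, M *m s k = f (cls k) *: s k) ->
  M *m (\sum_j phi j k *: s j) = f (cls k) *: (\sum_j phi j k *: s j).
Proof.
move=> Ms; rewrite mulmx_sumr scaler_sumr; apply: eq_bigr => j _.
rewrite -scalemxAr Ms !scalerA; have [->|/phi_cls ->] := eqVneq (phi j k) 0.
  by rewrite mulr0 mul0r.
by rewrite mulrC.
Qed.

Lemma Kv_s i k : Kv i *m s k = (chi i (cls k))^-1 *: s k.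
Proof.
have /(congr1 (mulmx (Kv i))) := tri_sK tri i k.
rewrite mulmxA (mulmx1C (tri_KKv tri i)) mul1mx -scalemxAr => {2}->.
by rewrite scalerA mulVf ?scale1r // (tri_chi tri).
Qed.

Lemma tri_KvF i j : Kv i *m F j = (c i j)^-1 *: (F j *m Kv i).
Proof.
have := congr1 (fun M => Kv i *m M *m Kv i) (tri_KF tri i j).
rewrite /= !mulmxA (mulmx1C (tri_KKv tri i)) mul1mx -scalemxAr -scalemxAl.
rewrite mulmxA -(mulmxA _ (K i)) (tri_KKv tri) mulmx1 => ->.
by rewrite scalerA mulVf ?scale1r // (tri_c tri).
Qed.

Lemma ext_graphZ e x y : gr x y -> gr (e *: x) (e *: y).
Proof. by move=> h; have := ExtD e h (Ext0 phi); rewrite !addr0. Qed.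

Lemma ext_graphK i x y : gr x y -> gr (K i *m x) (K i *m y).
Proof.
elim=> [|k|e x1 y1 x2 y2 _ h1 _ h2|j x1 y1 _ h].
- by rewrite mulmx0; apply: Ext0.
- rewrite (phi_eigen k (tri_sK tri i)) (tri_sK tri).
  by apply: ext_graphZ; apply: ExtS.
- by rewrite !mulmxDr -!scalemxAr; apply: ExtD.
- rewrite !mulmxA (tri_KF tri) -!scalemxAl -!mulmxA.
  by apply: ext_graphZ; apply: ExtF.
Qed.

Lemma ext_graphKv i x y : gr x y -> gr (Kv i *m x) (Kv i *m y).
Proof.
elim=> [|k|e x1 y1 x2 y2 _ h1 _ h2|j x1 y1 _ h].
- by rewrite mulmx0; apply: Ext0.
- rewrite (@phi_eigen k _ (fun t => (chi i t)^-1) (Kv_s i)) Kv_s.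
  by apply: ext_graphZ; apply: ExtS.
- by rewrite !mulmxDr -!scalemxAr; apply: ExtD.
- rewrite !mulmxA tri_KvF -!scalemxAl -!mulmxA.
  by apply: ext_graphZ; apply: ExtF.
Qed.

(** E_i is moved through the word in the F_j until it reaches s_k and kills it. The terms left over
    involve squares of K_i and of its inverse, under which the graph is stable because phi preserves
    the weights. *)
Lemma ext_graphE i x y : gr x y -> gr (E i *m x) (E i *m y).
Proof.
elim=> [|k|e x1 y1 x2 y2 _ h1 _ h2|j x1 y1 g h].
- by rewrite mulmx0; apply: Ext0.
- rewrite (tri_s tri) mulmx_sumr big1; first exact: Ext0.
  by move=> j _; rewrite -scalemxAr (tri_s tri) scaler0.
- by rewrite !mulmxDr -!scalemxAr; apply: ExtD.
- rewrite !mulmxA (tri_EF tri) !mulmxDl -!scalemxAl -!mulmxA.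
  apply: ExtD; first exact: ExtF.
  case: ifP => _; last by rewrite !mul0mx; apply: Ext0.
  rewrite -!scalemxAl; apply: ext_graphZ; rewrite !mulmxBl -!mulmxA.
  rewrite ![K i *m _ - _]addrC -!scaleN1r; apply: ExtD.
    by do 2!apply: ext_graphKv.
  by do 2!apply: ext_graphK.
Qed.

Lemma ext_graph_decomp x y : gr x y -> exists (b : 'I_r -> C) (u v : V),
  [/\ imF u, imF v, x = \sum_k b k *: s k + u
    & y = \sum_k b k *: (\sum_j phi j k *: s j) + v].
Proof.
have F0 := (imF_lin).1; have FD := (imF_lin).2.
elim=> [|k|e x1 y1 x2 y2 _ [b1 [u1 [v1 [h1 h2 -> ->]]]] _ [b2 [u2 [v2 [h3 h4 -> ->]]]]|i x1 y1 _ _].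
- exists (fun=> 0), 0, 0; split=> //;
    by rewrite big1 ?addr0 // => k _; rewrite scale0r.
- exists (fun j => (j == k)%:R), 0, 0; split=> //;
    rewrite addr0 [RHS](bigD1 k) //= eqxx scale1r [X in _ + X]big1 ?addr0 //;
    by move=> j /negPf ->; rewrite scale0r.
- exists (fun k => e * b1 k + b2 k), (e *: u1 + u2), (e *: v1 + v2).
  split; [exact: FD|exact: FD| |]; rewrite scalerDr addrACA scaler_sumr;
    rewrite -big_split /=; congr (_ + _);
    by apply: eq_bigr => k _; rewrite scalerDl scalerA.
- exists (fun=> 0), (F i *m x1), (F i *m y1).
  split; [exact: imF_F|exact: imF_F| |];
    by rewrite big1 ?add0r // => k _; rewrite scale0r.
Qed.

(** The y related to 0 form a set stable under the E_i, so a non-zero one yields a non-zero singular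
    one. Modulo the images of the F_i the graph is that of phi on the span of the s_k, so this
    singular vector lies in those images and is 0. *)
Lemma ext_graph_fun y : gr 0 y -> y = 0.
Proof.
move=> g0; apply: contrapT => /eqP y0.
have [|z [gz z0 zs]] := @Estable_singular (gr 0) _ y g0 y0.
  by move=> i x /(ext_graphE i); rewrite mulmx0.
case/eqP: z0; have [b [u [v [Fu Fv e0 zE]]]] := ext_graph_decomp gz.
have b0 : forall k, b k = 0.
  apply: span_free; apply: singular_imF.
    move=> i; rewrite mulmx_sumr big1 // => k _.
    by rewrite -scalemxAr (tri_s tri) scaler0.
  have -> : \sum_k b k *: s k = (-1) *: u + 0.
    by rewrite addr0 scaleN1r; apply/eqP; rewrite -addr_eq0 -e0.
  by apply: (imF_lin).2 => //; apply: (imF_lin).1.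
apply: singular_imF => //; rewrite zE big1 ?add0r // => k _.
by rewrite b0 scale0r.
Qed.

Lemma ext_exists : exists X, commutes X /\ acts_by X phi.
Proof.
have gD x y x' y' : gr x y -> gr x' y' -> gr (x + x') (y + y').
  by move=> h h'; have := ExtD 1 h h'; rewrite !scale1r.
have gB x y y' : gr x y -> gr x y' -> y = y'.
  move=> h h'; apply/eqP; rewrite -subr_eq0; apply/eqP.
  apply: ext_graph_fun; have := ExtD (-1) h' h.
  by rewrite !scaleN1r addNr addrC.
have tot : forall x : V, exists y, gr x y.
  apply: (Fgen_ind (P := fun x => exists y, gr x y)).
  - split; first by exists 0; apply: Ext0.
    by move=> e x x' [y h] [y' h']; exists (e *: y + y'); apply: ExtD.
  - by move=> i x [y h]; exists (F i *m y); apply: ExtF.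
  - by move=> k; eexists; apply: ExtS.
have [f fP] := choice (fun j : 'I_n => tot (delta_mx j 0)).
pose X : 'M[C]_n := \matrix_(i, j) f j i 0.
have gX x : gr x (X *m x).
  have -> : X *m x = \sum_j x j 0 *: f j.
    apply/colP => i; rewrite mxE summxE; apply: eq_bigr => j _.
    by rewrite !mxE mulrC.
  rewrite {1}[x]matrix_sum_delta; under eq_bigr => j _ do rewrite big_ord1.
  elim/big_ind2: _ => [|x1 y1 x2 y2|j _]; [exact: Ext0|exact: gD|].
  by apply: ext_graphZ.
have cX (M : 'M[C]_n) : (forall x y, gr x y -> gr (M *m x) (M *m y)) ->
    X *m M = M *m X.
  move=> gM; apply/matrixP => i j.
  have /colP /(_ i) := gB _ _ _ (gX (M *m delta_mx j 0)) (gM _ _ (gX (delta_mx j 0))).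
  by rewrite !mulmxA -!colE !mxE.
exists X; split=> [i|k].
  split; apply: cX => x y; [exact: ext_graphE|exact: ExtF|exact: ext_graphK|].
  exact: ext_graphKv.
exact: gB (gX _) (ExtS phi k).
Qed.

End Extension.

Definition substable (W : {vspace V}) := forall i w, w \in W ->
  [/\ E i *m w \in W, F i *m w \in W, K i *m w \in W & Kv i *m w \in W].

Definition irrv (W : {vspace V}) :=
  [/\ substable W, W != 0%VS
    & forall W', substable W' -> (W' <= W)%VS -> W' = 0%VS \/ W' = W].

(** A weight is tested by the squares of the K_i, that is by the true Cartan generators and not by
    their half powers; hence also the form of [cls_sep] below. *)
Definition hwv (l : T) (w : V) := singularv w /\
  forall i, K i *m (K i *m w) = (chi i l * chi i l) *: w.

Definition isLv (l : T) (W : {vspace V}) :=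
  irrv W /\ exists w, [/\ w \in W, w != 0 & hwv l w].

Definition killsv (l : T) (X : 'M[C]_n) :=
  forall W, irrv W -> ~ isLv l W -> forall w, w \in W -> X *m w = 0.

Definition is_projv (l : T) (P : 'M[C]_n) :=
  (forall W, isLv l W -> forall w, w \in W -> P *m w = w) /\ killsv l P.

Definition classmx (l : T) : 'M[C]_r :=
  \matrix_(j, k) ((j == k) && (cls k == l))%:R.

Hypothesis cls_sep : forall j k, cls j != cls k ->
  exists i, chi i (cls j) * chi i (cls j) != chi i (cls k) * chi i (cls k).

Lemma hwv_s k : hwv (cls k) (s k).
Proof.
split; first exact: (tri_s tri).
by move=> i; rewrite (tri_sK tri) -scalemxAr (tri_sK tri) scalerA.
Qed.

Lemma hwv_span k0 (b : 'I_r -> C) : hwv (cls k0) (\sum_k b k *: s k) ->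
  forall k, cls k != cls k0 -> b k = 0.
Proof.
move=> [_ Kw] k kl; have [i ikl] := cls_sep kl.
suff H : forall j, b j * (chi i (cls j) * chi i (cls j)
    - chi i (cls k0) * chi i (cls k0)) = 0.
  by have /eqP := H k; rewrite mulf_eq0 subr_eq0 (negPf ikl) orbF => /eqP.
apply: span_free; apply/eqP; under eq_bigr => j _ do
  rewrite mulrBr scalerBl -[_ *: s j]scalerA -(hwv_s j).2 mulrC -scalerA.
rewrite sumrB -scaler_sumr -Kw !mulmx_sumr subr_eq0; apply/eqP.
by apply: eq_bigr => j _; rewrite !scalemxAr.
Qed.

Lemma substable_singular W : substable W -> W != 0%VS ->
  exists2 b : 'I_r -> C, \sum_k b k *: s k \in W & \sum_k b k *: s k != 0.
Proof.
move=> Ws W0; have := memv_pick W; rewrite -vpick0 in W0 => W1.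
have [|z [zW z0 zs]] := @Estable_singular (fun x => x \in W) _ _ W1 W0.
  by move=> i x /(Ws i) [].
by have [b zE] := tri_span tri zs; exists b; rewrite -zE.
Qed.

(* Lagrange interpolation in the K_i isolates the vectors of a given weight. *)
Lemma substable_class W k0 (b : 'I_r -> C) : substable W ->
  \sum_k b k *: s k \in W -> \sum_(k | cls k == cls k0) b k *: s k \in W.
Proof.
move=> Ws bW.
have H (ks : seq 'I_r) : all (fun k => cls k != cls k0) ks ->
    exists g : T -> C, [/\ g (cls k0) = 1, forall k, k \in ks -> g (cls k) = 0
      & \sum_k (g (cls k) * b k) *: s k \in W].
  elim: ks => [_|k ks IH /= /andP [kk0 /IH [g [g1 g0 gW]]]].
    exists (fun=> 1); split=> //.
    by under eq_bigr => k _ do rewrite mul1r.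
  have [i ik] := cls_sep kk0; rewrite eq_sym -subr_eq0 in ik.
  pose d := chi i (cls k0) * chi i (cls k0) - chi i (cls k) * chi i (cls k).
  exists (fun t => g t * ((chi i t * chi i t - chi i (cls k) * chi i (cls k)) / d)).
  split.
  - by rewrite g1 mulfV ?mulr1.
  - move=> j; rewrite inE => /orP [/eqP ->|/g0 ->]; last by rewrite mul0r.
    by rewrite subrr mul0r mulr0.
  - set w := \sum_k _ in gW.
    have dW : d^-1 *: (K i *m (K i *m w) -
        (chi i (cls k) * chi i (cls k)) *: w) \in W.
      by rewrite memvZ // memvB ?memvZ //; case/(Ws i): gW => _ _ /(Ws i) [].
    apply: etrans dW; congr (_ \in W).
    rewrite /w !mulmx_sumr [X in _ - X]scaler_sumr -sumrB scaler_sumr.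
    apply: eq_bigr => j _.
    rewrite -!scalemxAr (hwv_s j).2 !scalerA -scalerBl scalerA; congr (_ *: _).
    by ring.
case: (H [seq k <- enum 'I_r | cls k != cls k0]).
  by apply/allP => k; rewrite mem_filter => /andP [].
move=> g [g1 g0 gW]; rewrite big_mkcond /=.
suff -> : \sum_k (if cls k == cls k0 then b k *: s k else 0) =
    \sum_k (g (cls k) * b k) *: s k by [].
apply: eq_bigr => k _; case: eqVneq => [->|kk0]; first by rewrite g1 mul1r.
by rewrite g0 ?mul0r ?scale0r // mem_filter kk0 mem_enum.
Qed.

Lemma substable_cap W X (d : C) : substable W -> commutes X ->
  substable (W :&: lker (linfun (mulmx (X - d%:M)) : 'Hom(V, V)))%VS.
Proof.
move=> Ws cX i w; rewrite memv_cap => /andP [/(Ws i) [h1 h2 h3 h4]].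
have [c1 c2 c3 c4] := cX i.
have kerE x : (x \in lker (linfun (mulmx (X - d%:M)) : 'Hom(V, V))) =
    ((X - d%:M) *m x == 0) by rewrite memv_ker lfunE.
have comm M : X *m M = M *m X -> (X - d%:M) *m M = M *m (X - d%:M).
  by move=> h; rewrite mulmxBl mulmxBr h scalar_mxC.
rewrite kerE => /eqP wk; split; rewrite memv_cap kerE mulmxA comm //
  -mulmxA wk mulmx0 eqxx andbT //.
Qed.

Lemma memv_lker_mulmx X (x : V) :
  (x \in lker (linfun (mulmx X) : 'Hom(V, V))) = (X *m x == 0).
Proof. by rewrite memv_ker lfunE. Qed.

Lemma classmx_cls l j k : classmx l j k != 0 -> cls j = cls k.
Proof. by rewrite mxE; have [->//|_] := eqVneq j k; rewrite eqxx. Qed.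

Lemma classmx_span X l (b : 'I_r -> C) : acts_by X (classmx l) ->
  X *m (\sum_k b k *: s k) = \sum_(k | cls k == l) b k *: s k.
Proof.
move=> Xs; rewrite mulmx_sumr [RHS]big_mkcond /=; apply: eq_bigr => k _.
rewrite -scalemxAr Xs (bigD1 k) //= mxE eqxx big1 ?addr0 => [|j jk].
  by case: eqP => _; rewrite ?scale1r // scale0r scaler0.
by rewrite mxE (negPf jk) scale0r.
Qed.

(** Schur's argument: an irreducible W meets the kernel of X - d in 0 or in W. A highest weight
    vector of the given weight lies in the kernel for d = 1. If W has none, d = 0 must give W:
    otherwise some singular vector of W has a non-zero component of that weight, and this component
    is again in W. *)
Lemma class_proj k0 X : commutes X -> acts_by X (classmx (cls k0)) ->
  is_projv (cls k0) X.
Proof.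
move=> cX Xs; split=> [W [[Ws W0 Wmin]] [w [wW w0 hw]] x xW|W [Ws W0 Wmin] nW x xW].
  have [b wE] := tri_span tri hw.1.
  have b0 := hwv_span (eq_ind _ (hwv (cls k0)) hw _ wE).
  have wk : w \in (W :&: lker (linfun (mulmx (X - 1%:M)) : 'Hom(V, V)))%VS.
    rewrite memv_cap wW memv_lker_mulmx mulmxBl mul1mx subr_eq0 wE /=.
    apply/eqP; rewrite (classmx_span b Xs) big_mkcond /=.
    by apply: eq_bigr => k _; case: eqVneq => // /b0 ->; rewrite scale0r.
  case: (Wmin _ (substable_cap (d := 1) Ws cX) (capvSl _ _)) => WE.
    by move: wk; rewrite WE memv0 (negPf w0).
  move: xW; rewrite -WE memv_cap memv_lker_mulmx mulmxBl mul1mx subr_eq0.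
  by case/andP => _ /eqP.
case: (Wmin _ (substable_cap (d := 0) Ws cX) (capvSl _ _)) => WE; last first.
  move: xW; rewrite -WE memv_cap memv_lker_mulmx raddf0 subr0.
  by case/andP => _ /eqP.
have [b bW b0] := substable_singular Ws W0.
case: nW; split=> //; exists (\sum_(k | cls k == cls k0) b k *: s k); split.
- exact: substable_class.
- apply: contraNneq b0 => b0; rewrite -memv0 -WE memv_cap bW memv_lker_mulmx.
  by rewrite raddf0 subr0 (classmx_span b Xs) b0 eqxx.
- split=> i; first by rewrite mulmx_sumr big1 // => k _;
    rewrite -scalemxAr (tri_s tri) scaler0.
  rewrite !mulmx_sumr scaler_sumr; apply: eq_bigr => k /eqP kk0.
  by rewrite -!scalemxAr (hwv_s k).2 kk0 !scalerA mulrC.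
Qed.

(** A singular vector of the image agrees with a multiple of s_k modulo the images of the F_i, hence
    equals it. So every non-zero submodule of the image contains s_k, and s_k generates the
    image. *)
Lemma image_irr k X : commutes X -> acts_by X (delta_mx k k) ->
  irrv (limg (linfun (mulmx X) : 'Hom(V, V))) /\
  forall w, w \in limg (linfun (mulmx X) : 'Hom(V, V)) -> singularv w ->
    exists b, w = b *: s k.
Proof.
set W := limg _ => cX Xs.
have WP w : reflect (exists x, w = X *m x) (w \in W).
  apply: (iffP memv_imgP) => [[x _ ->]|[x ->]]; first by exists x; rewrite lfunE.
  by exists x; rewrite ?memvf ?lfunE.
have Xk : X *m s k = s k.
  rewrite Xs (bigD1 k) //= mxE !eqxx scale1r big1 ?addr0 // => j /negPf jk.
  by rewrite mxE jk scale0r.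
have Ws : substable W.
  move=> i w /WP [x ->]; have [h1 h2 h3 h4] := cX i.
  split; apply/WP.
  - by exists (E i *m x); rewrite !mulmxA h1.
  - by exists (F i *m x); rewrite !mulmxA h2.
  - by exists (K i *m x); rewrite !mulmxA h3.
  - by exists (Kv i *m x); rewrite !mulmxA h4.
have skW : s k \in W by apply/WP; exists (s k).
have sing w : w \in W -> singularv w -> exists b, w = b *: s k.
  move=> /WP [x wE] ws; have [b [u [[y uE] xE]]] := span_imF x.
  exists (b k); apply/eqP; rewrite -subr_eq0; apply/eqP.
  apply: singular_imF.
    by move=> i; rewrite mulmxBr ws -scalemxAr (tri_s tri) scaler0 subrr.
  exists (fun i => X *m y i); rewrite wE xE uE mulmxDr !mulmx_sumr (bigD1 k) //=.
  rewrite -scalemxAr Xk big1 => [|j jk]; last first.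
    rewrite -scalemxAr Xs big1 ?scaler0 // => i _.
    by rewrite mxE (negPf jk) andbF scale0r.
  rewrite addr0 addrAC subrr add0r; apply: eq_bigr => i _.
  by rewrite !mulmxA; have [_ ->] := cX i.
split=> //; split=> //.
  apply/eqP => W0; move: skW; rewrite W0 memv0 => /eqP sk0.
  have := tri_gram tri k k; rewrite sk0 mulmx0 eqxx => /matrixP /(_ 0 0).
  by rewrite !mxE eqxx mulr1n => /esym /eqP; rewrite (negPf (tri_gam tri k)).
move=> W' W's W'W; have [->|W'0] := eqVneq W' 0%VS; first by left.
right; apply/eqP; rewrite eqEsubv W'W /=; apply/subvP => w /WP [x ->].
have [b bW b0] := substable_singular W's W'0.
have [|e eE] := sing _ (subvP W'W _ bW).
  by move=> i; rewrite mulmx_sumr big1 // => j _; rewrite -scalemxAr (tri_s tri) scaler0.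
have skW' : s k \in W'.
  have e0 : e != 0 by apply: contraNneq b0 => e0; rewrite eE e0 scale0r.
  by move: bW; rewrite eE => /(memvZ e^-1); rewrite scalerA mulVf // scale1r.
move: x; apply: (Fgen_ind (P := fun x => X *m x \in W')).
- split; first by rewrite mulmx0 mem0v.
  by move=> a' x y hx hy; rewrite mulmxDr -scalemxAr memvD // memvZ.
- move=> i x hx; rewrite mulmxA; have [_ -> _ _] := cX i.
  by rewrite -mulmxA; case/(W's i): hx.
- move=> j; rewrite Xs; apply: memv_suml => i _; rewrite mxE.
  by have [->|_] := eqVneq i k; rewrite ?scale0r ?mem0v // memvZ.
Qed.

(** With [image_irr] this gives complete reducibility, with one irreducible summand for each s_k. *)
Lemma image_cover : exists X : 'I_r -> 'M[C]_n,
  [/\ forall k, commutes (X k), forall k, acts_by (X k) (delta_mx k k)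
    & \sum_k X k = 1%:M].
Proof.
have ex k : exists X, commutes X /\ acts_by X (delta_mx k k).
  apply: ext_exists => i j; rewrite mxE.
  by have [->|_] := eqVneq i k; have [->|_] := eqVneq j k; rewrite ?eqxx.
have [X XP] := choice ex; exists X; split=> [k|k|]; [exact: (XP k).1|exact: (XP k).2|].
apply: (@comm_eq _ _ 1%:M).
- move=> i; rewrite mulmx_suml mulmx_sumr; apply: eq_bigr => k _.
  by have [_ ->] := (XP k).1 i.
- by move=> i; rewrite mul1mx mulmx1.
- move=> k; rewrite mulmx_suml (bigD1 k) //= (XP k).2 [X in _ + X]big1 ?addr0 => [|j jk].
    by apply: eq_bigr => j _; rewrite !mxE eqxx andbT.
  by rewrite (XP j).2 big1 // => i _; rewrite mxE [k == j]eq_sym (negPf jk) andbF scale0r.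
- move=> k; rewrite mul1mx (bigD1 k) //= mxE eqxx scale1r big1 ?addr0 // => j jk.
  by rewrite mxE (negPf jk) scale0r.
Qed.

Lemma image_isL k k0 X : commutes X -> acts_by X (delta_mx k k) ->
  isLv (cls k0) (limg (linfun (mulmx X) : 'Hom(V, V))) <-> cls k = cls k0.
Proof.
move=> cX Xs; have [irr sing] := image_irr cX Xs; split.
  move=> [_ [w [wW w0 hw]]]; have [b wE] := sing w wW hw.1.
  apply: contrapT => /eqP kk0; case/eqP: w0.
  have hw' : hwv (cls k0) (\sum_j (if j == k then b else 0) *: s j).
    rewrite (bigD1 k) //= eqxx big1 ?addr0 -?wE // => j /negPf ->.
    by rewrite scale0r.
  by have := hwv_span hw' kk0; rewrite eqxx wE => ->; rewrite scale0r.
move=> kk0; split=> //; exists (s k); split.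
- have -> : s k = (linfun (mulmx X) : 'Hom(V, V)) (s k).
    rewrite lfunE /= Xs (bigD1 k) //= mxE !eqxx scale1r big1 ?addr0 //.
    by move=> j /negPf jk; rewrite mxE jk scale0r.
  exact: memv_img (memvf _).
- apply/eqP => sk0; have := tri_gram tri k k; rewrite sk0 mulmx0 eqxx.
  move=> /matrixP /(_ 0 0); rewrite !mxE eqxx mulr1n => /esym /eqP.
  by rewrite (negPf (tri_gam tri k)).
- by rewrite -kk0; apply: hwv_s.
Qed.

(** The two conditions prescribe P on each summand of [image_cover], as the identity or as 0, so P
    is unique and equals the extension of the diagonal idempotent. *)
Lemma projv_spec k0 P : is_projv (cls k0) P ->
  commutes P /\ acts_by P (classmx (cls k0)).
Proof.
move=> [P1 P0]; have [X [cX Xs X1]] := image_cover.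
have [Y [cY Ys]] := ext_exists (@classmx_cls (cls k0)).
suff -> : P = Y by [].
have Xin k x : X k *m x \in limg (linfun (mulmx (X k)) : 'Hom(V, V)).
  have -> : X k *m x = (linfun (mulmx (X k)) : 'Hom(V, V)) x by rewrite lfunE.
  exact: memv_img (memvf _).
have PX (Q : 'M[C]_n) : is_projv (cls k0) Q -> Q = \sum_(k | cls k == cls k0) X k.
  move=> [Q1 Q0]; rewrite -[LHS]mulmx1 -X1 mulmx_sumr [RHS]big_mkcond /=.
  apply: eq_bigr => k _; apply/matrixP => i j.
  have : Q *m (X k *m (delta_mx j 0 : V)) =
      (if cls k == cls k0 then X k else 0) *m delta_mx j 0.
    case: eqP => [kk0|kk0].
      by apply: (Q1 _ _ _ (Xin k _)); apply/(image_isL k0 (cX k) (Xs k)).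
    rewrite mul0mx; apply: (Q0 _ _ _ _ (Xin k _)).
      by have [] := image_irr (cX k) (Xs k).
    by move/(image_isL k0 (cX k) (Xs k)).
  by rewrite mulmxA -!colE => /colP /(_ i); rewrite !mxE.
by rewrite (PX _ (conj P1 P0)) (PX _ (class_proj cY Ys)).
Qed.

Lemma projv_exists k0 : exists P, is_projv (cls k0) P.
Proof.
have [Y [cY Ys]] := ext_exists (@classmx_cls (cls k0)).
by exists Y; apply: class_proj.
Qed.

Section Block.
Context (m : nat) (iota : 'I_m -> 'I_r) (f : 'M[C]_m) (k0 : 'I_r).
Hypothesis iota_inj : injective iota.
Hypothesis iota_cls : forall k, (cls k == cls k0) = (k \in codom iota).

Definition blockmx : 'M[C]_r := \sum_i \sum_j f i j *: delta_mx (iota i) (iota j).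

Lemma blockmxE i j : blockmx (iota i) (iota j) = f i j.
Proof.
rewrite summxE (bigD1 i) //= summxE (bigD1 j) //= !mxE !eqxx mulr1.
rewrite !big1 ?addr0 // => [i' ii|j' jj].
  rewrite summxE big1 // => j' _.
  by rewrite !mxE (inj_eq iota_inj) eq_sym (negPf ii) mulr0.
by rewrite !mxE !(inj_eq iota_inj) eqxx [j == _]eq_sym (negPf jj) mulr0.
Qed.

Lemma blockmx0 j k : (j \notin codom iota) || (k \notin codom iota) ->
  blockmx j k = 0.
Proof.
move=> jk; rewrite summxE big1 // => i' _; rewrite summxE big1 // => j' _.
rewrite !mxE; case: eqP => [ji|_]; last by rewrite mulr0.
case: eqP => [kj|_]; last by rewrite mulr0.
by move: jk; rewrite ji kj !codom_f.
Qed.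

Lemma blockmx_cls j k : blockmx j k != 0 -> cls j = cls k.
Proof.
move=> jk; suff /andP [] : (j \in codom iota) && (k \in codom iota).
  by rewrite -!iota_cls => /eqP -> /eqP ->.
by apply: contraNT jk; rewrite negb_and => /blockmx0 ->.
Qed.

Definition is_ftensv (X : 'M[C]_n) := [/\ commutes X, killsv (cls k0) X
  & forall j, X *m s (iota j) = \sum_i f i j *: s (iota i)].

Lemma blockmx_acts X j : acts_by X blockmx ->
  X *m s (iota j) = \sum_i f i j *: s (iota i).
Proof.
move=> Xs; rewrite Xs.
rewrite (bigID (mem (codom iota))) /= [X in _ + X]big1 ?addr0 => [|k kn]; last first.
  by rewrite blockmx0 ?kn ?scale0r.
rewrite -big_uniq /=; last by rewrite map_inj_uniq ?enum_uniq.
rewrite /codom big_image /=; apply: eq_bigr => i _.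
by rewrite blockmxE.
Qed.

(** For k outside the block, s_k lies in an irreducible summand of another weight, which X kills by
    assumption. *)
Lemma ftensv_spec X : is_ftensv X -> acts_by X blockmx.
Proof.
move=> [cX kX Xu] k; have [/codomP [j ->]|kn] := boolP (k \in codom iota).
  have [Y [cY Ys]] := ext_exists blockmx_cls.
  by rewrite Xu -(blockmx_acts j Ys) Ys.
rewrite big1 => [|j _]; last by rewrite blockmx0 ?kn ?orbT ?scale0r.
have [Y [cY Ys Y1]] := image_cover.
have [irr _] := image_irr (cY k) (Ys k).
apply: (kX _ irr).
  move=> /(image_isL k0 (cY k) (Ys k)) /eqP.
  by rewrite iota_cls (negPf kn).
have -> : s k = (linfun (mulmx (Y k)) : 'Hom(V, V)) (s k).
  rewrite lfunE /= Ys (bigD1 k) //= mxE !eqxx scale1r big1 ?addr0 //.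
  by move=> j /negPf jk; rewrite mxE jk scale0r.
exact: memv_img (memvf _).
Qed.

Lemma ftensv_exists : exists X, is_ftensv X.
Proof.
have [X [cX Xs]] := ext_exists blockmx_cls.
have [Y [cY Ys]] := ext_exists (@classmx_cls (cls k0)).
exists X; split=> // [W irr nL w wW|j]; last exact: blockmx_acts.
(* X factors through the projector of its class, and this projector kills the other irreducible
   submodules. *)
have XY : X = X *m Y.
  apply: (@comm_eq _ _ blockmx) => // [i|i|k].
  - by have [] := cX i.
  - have [_ h _ _] := cX i; have [_ h' _ _] := cY i.
    by rewrite -mulmxA h' mulmxA h mulmxA.
  - have -> : X *m Y *m s k = if cls k == cls k0 then X *m s k else 0.
      rewrite -mulmxA Ys (bigD1 k) //= mxE eqxx big1 ?addr0 => [|j jk].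
        by case: eqP => _; rewrite ?scale1r // scale0r mulmx0.
      by rewrite mxE (negPf jk) scale0r.
    case: ifP => [_|]; first exact: Xs.
    rewrite iota_cls => /negbT kn; rewrite big1 // => j _.
    by rewrite blockmx0 ?kn ?orbT ?scale0r.
have [_ kY] := class_proj cY Ys.
by rewrite XY -mulmxA (kY W irr nL w wW) mulmx0.
Qed.

End Block.
End Triangular.

(** * Tensor products as spaces of matrices, and coproducts *)

Section Tensor.
Context (C : fieldType).

Section Bilinear.
Context (m n p r : nat).
Implicit Types (A B : 'M[C]_(m, n)) (D E : 'M[C]_(p, r)).

Lemma tensmxZl a A D : (a *: A) *t D = a *: (A *t D).
Proof. by apply/matrixP => i j; rewrite !mxE mulrA. Qed.
Lemma tensmxZr a A D : A *t (a *: D) = a *: (A *t D).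
Proof. by apply/matrixP => i j; rewrite !mxE mulrCA. Qed.
Lemma tensmxBl A B D : (A - B) *t D = A *t D - B *t D.
Proof. by apply/matrixP => i j; rewrite !mxE mulrBl. Qed.
Lemma tensmxBr A D E : A *t (D - E) = A *t D - A *t E.
Proof. by apply/matrixP => i j; rewrite !mxE mulrBr. Qed.
End Bilinear.

(* Identifies the matrix units with the vectors v_a (x) v_c. *)
Definition tvec m n (x : 'M[C]_(m, n)) : 'cV[C]_(m * n) :=
  \col_i x (mxtens_unindex i).1 (mxtens_unindex i).2.

Definition untvec m n (x : 'cV[C]_(m * n)) : 'M[C]_(m, n) :=
  \matrix_(a, c) x (mxtens_index (a, c)) 0.

Definition dotmx m n (x y : 'M[C]_(m, n)) : C := \sum_a \sum_c x a c * y a c.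

Section Tvec.
Context (m n : nat).
Implicit Types (x y : 'M[C]_(m, n)).

Lemma untvecK : cancel (@untvec m n) (@tvec m n).
Proof. by move=> x; apply/colP => i; rewrite !mxE -surjective_pairing mxtens_unindexK. Qed.

Lemma tvecK : cancel (@tvec m n) (@untvec m n).
Proof. by move=> x; apply/matrixP => a c; rewrite !mxE mxtens_indexK. Qed.

Lemma tvecD x y : tvec (x + y) = tvec x + tvec y.
Proof. by apply/colP => i; rewrite !mxE. Qed.
Lemma tvecB x y : tvec (x - y) = tvec x - tvec y.
Proof. by apply/colP => i; rewrite !mxE. Qed.
Lemma tvecN x : tvec (- x) = - tvec x.
Proof. by apply/colP => i; rewrite !mxE. Qed.
Lemma tvecZ a x : tvec (a *: x) = a *: tvec x.
Proof. by apply/colP => i; rewrite !mxE. Qed.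
Lemma tvec0 : tvec (0 : 'M[C]_(m, n)) = 0.
Proof. by apply/colP => i; rewrite !mxE. Qed.

Lemma tvec_sum (I : Type) (s : seq I) (f : I -> 'M[C]_(m, n)) :
  tvec (\sum_(i <- s) f i) = \sum_(i <- s) tvec (f i).
Proof.
elim: s => [|i s IH]; first by rewrite !big_nil tvec0.
by rewrite !big_cons tvecD IH.
Qed.

Lemma tvec_delta (a : 'I_m) (c : 'I_n) :
  tvec (delta_mx a c) = delta_mx (mxtens_index (a, c)) 0.
Proof.
apply/colP => i; case: (mxtens_indexP i) => a' c'; rewrite !mxE.
by rewrite mxtens_indexK (can_eq (@mxtens_indexK m n)) xpair_eqE andbT.
Qed.

Lemma sum_mxtens (F : 'I_(m * n) -> C) :
  \sum_i F i = \sum_a \sum_c F (mxtens_index (a, c)).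
Proof.
rewrite pair_big (reindex (@mxtens_index m n)) /=; last first.
  by exists (@mxtens_unindex m n) => k _; rewrite ?mxtens_indexK ?mxtens_unindexK.
by apply: eq_bigr => -[a c].
Qed.

Lemma tens_tvec (A : 'M[C]_m) (B : 'M[C]_n) x :
  (A *t B) *m tvec x = tvec (A *m x *m B^T).
Proof.
apply/colP => i; case: (mxtens_indexP i) => a c; rewrite !mxE mxtens_indexK /=.
rewrite sum_mxtens exchange_big /=; apply: eq_bigr => c' _.
rewrite !mxE mulr_suml; apply: eq_bigr => a' _.
by rewrite tensmxE !mxE mxtens_indexK /=; ring.
Qed.

Lemma tvec_dot x y : (tvec x)^T *m tvec y = (dotmx x y)%:M.
Proof.
apply/matrixP => i j; rewrite !ord1 mxE [RHS]mxE eqxx mulr1n sum_mxtens.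
by apply: eq_bigr => a _; apply: eq_bigr => c _; rewrite !mxE mxtens_indexK.
Qed.

Lemma dotmxE x y : dotmx x y = \tr (x^T *m y).
Proof.
rewrite /dotmx exchange_big /=; apply: eq_bigr => c _; rewrite mxE.
by apply: eq_bigr => a _; rewrite mxE.
Qed.

End Tvec.

(** L is going to be K_i^(-1/2), times the parity operator when the generator is odd. This absorbs
    the sign rule, so that ordinary tensor products suffice. *)
Definition copr n (A K L : 'M[C]_n) (z1 z2 : C) : 'M[C]_(n * n) :=
  z1 *: (A *t K) + z2 *: (L *t A).

Section Coproduct.
Context (n : nat).
Implicit Types (A B K L : 'M[C]_n).

(** The scalars for passing A through LB and B through KA differ by the sign s, and so do the other
    two; hence the mixed terms cancel and only a supercommutator in each leg remains. *)
Lemma copr_comm A KA LA B KB LB z1 z2 (s w w' : C) :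
  s * s = 1 ->
  LB *m A = (s * w) *: (A *m LB) -> KA *m B = w *: (B *m KA) ->
  LA *m B = (s * w') *: (B *m LA) -> KB *m A = w' *: (A *m KB) ->
  KA *m KB = KB *m KA -> LA *m LB = LB *m LA -> s * w != 0 -> w' != 0 ->
  copr A KA LA z1 z2 *m copr B KB LB 1 1 =
  s *: (copr B KB LB 1 1 *m copr A KA LA z1 z2)
  + (z1 *: ((A *m B - s *: (B *m A)) *t (KA *m KB))
     + z2 *: ((LA *m LB) *t (A *m B - s *: (B *m A)))).
Proof.
move=> ss h1 h2 h3 h4 hK hL w0 w'0; rewrite /copr !scale1r.
rewrite !(mulmxDl, mulmxDr) -!(scalemxAl, scalemxAr) !tensmx_mul.
rewrite h2 h3 h1 h4 hK hL !(tensmxZl, tensmxZr, tensmxBl, tensmxBr).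
rewrite !(scalerDr, scalerBr, scalerA).
have -> : s * z1 * (s * w) = z1 * w by rewrite mulrAC !mulrA ss mul1r mulrC.
have -> : s * z2 * w' = z2 * (s * w') by ring.
by rewrite !addrA; apply/matrixP => i j; rewrite !mxE; ring.
Qed.

Lemma copr_adj g A B K L z1 z2 e :
  g *m A = e *: (B^T *m g) -> g *m K = K^T *m g -> g *m L = L^T *m g ->
  (g *t g) *m copr A K L z1 z2 = e *: ((copr B K L z1 z2)^T *m (g *t g)).
Proof.
move=> hA hK hL.
have -> : (copr B K L z1 z2)^T = z1 *: (B^T *t K^T) + z2 *: (L^T *t B^T).
  by rewrite /copr linearD !linearZ /= !trmx_tens.
rewrite /copr mulmxDl mulmxDr -!(scalemxAl, scalemxAr) !tensmx_mul hA hK hL.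
by rewrite !(tensmxZl, tensmxZr) scalerDr !scalerA [z1 * e]mulrC [z2 * e]mulrC.
Qed.

Lemma copr_weight M A K L z1 z2 c : M *m A = c *: (A *m M) ->
  M *m K = K *m M -> M *m L = L *m M ->
  (M *t M) *m copr A K L z1 z2 = c *: (copr A K L z1 z2 *m (M *t M)).
Proof.
move=> hA hK hL; rewrite /copr mulmxDl mulmxDr -!(scalemxAl, scalemxAr) !tensmx_mul.
by rewrite hA hK hL !(tensmxZl, tensmxZr) scalerDr !scalerA [z1 * c]mulrC [z2 * c]mulrC.
Qed.

(** In the second leg E passes Kn at the cost of the scalar v, in the first L passes X at the cost
    of u; their ratio is the twist of the commutator. For the mirror situation [copr_adB] the ratio
    is inverted, which is why the legs need separate families of operators. *)
Lemma copr_adA E K L X Kn u v : L *m X = u *: (X *m L) ->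
  Kn *m E = v *: (E *m Kn) -> v != 0 -> K *m Kn = Kn *m K ->
  copr E K L 1 1 *m (X *t Kn) = (E *m X - (u / v) *: (X *m E)) *t (K *m Kn)
    + (u / v) *: ((X *t Kn) *m copr E K L 1 1).
Proof.
move=> LX KnE v0 KKn; rewrite /copr !scale1r mulmxDl mulmxDr !tensmx_mul LX KnE KKn.
rewrite !(tensmxZl, tensmxZr, tensmxBl) scalerDr !scalerA divfK //.
by rewrite addrA subrK.
Qed.

Lemma copr_adB E K L X Ln u v : K *m X = v *: (X *m K) ->
  Ln *m E = u *: (E *m Ln) -> u != 0 -> L *m Ln = Ln *m L ->
  copr E K L 1 1 *m (Ln *t X) = (L *m Ln) *t (E *m X - (v / u) *: (X *m E))
    + (v / u) *: ((Ln *t X) *m copr E K L 1 1).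
Proof.
move=> KX LnE u0 LLn; rewrite /copr !scale1r mulmxDl mulmxDr !tensmx_mul KX LnE LLn.
rewrite !(tensmxZl, tensmxZr, tensmxBr) scalerDr !scalerA divfK //.
by rewrite [X in _ = _ + X]addrC addrA subrK addrC.
Qed.

End Coproduct.
End Tensor.

(** * Sparse matrices over the Laurent polynomials in h, for computation *)

(* The list of the (e, c) stands for the sum of the c h^e. *)
Definition lpol := seq (Z * Z).

Fixpoint ladd (p : lpol) : lpol -> lpol :=
  fix aux (q : lpol) : lpol :=
    match p, q with
    | [::], _ => q
    | _, [::] => p
    | (e, c) :: p', (e', c') :: q' =>
        match Z.compare e e' with
        | Lt => (e, c) :: ladd p' q
        | Gt => (e', c') :: aux q'
        | Eq => let d := Z.add c c' in
                if Z.eqb d 0 then ladd p' q' else (e, d) :: ladd p' q'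
        end
    end.
Definition lmono (t : Z * Z) (p : lpol) : lpol :=
  [seq (Z.add t.1 u.1, Z.mul t.2 u.2) | u <- p].
Definition lopp (p : lpol) : lpol := [seq (u.1, Z.opp u.2) | u <- p].
Fixpoint lmul (p q : lpol) : lpol :=
  if p is t :: p' then ladd (lmono t q) (lmul p' q) else [::].
Definition l1 : lpol := [:: (0, 1)%ZZ].
Definition lh (e : Z) : lpol := [:: (e, 1%ZZ)].
Definition leq (p q : lpol) : bool := nilp (ladd p (lopp q)).

Fixpoint lsum (s : seq lpol) : lpol := if s is p :: s' then ladd p (lsum s') else [::].

Definition svec := seq (N * lpol).
Fixpoint sadd (p : svec) : svec -> svec :=
  fix aux (q : svec) : svec :=
    match p, q with
    | [::], _ => q
    | _, [::] => p
    | (e, c) :: p', (e', c') :: q' =>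
        match N.compare e e' with
        | Lt => (e, c) :: sadd p' q
        | Gt => (e', c') :: aux q'
        | Eq => let d := ladd c c' in
                if nilp d then sadd p' q' else (e, d) :: sadd p' q'
        end
    end.
Definition sscale (p : lpol) (v : svec) : svec := [seq (t.1, lmul p t.2) | t <- v].

Definition smat := seq svec.
Fixpoint madd (A B : smat) : smat :=
  match A, B with
  | [::], _ => B
  | _, [::] => A
  | r :: A', r' :: B' => sadd r r' :: madd A' B'
  end.
Definition mscale (p : lpol) (A : smat) : smat := [seq sscale p r | r <- A].
Definition mopp (A : smat) : smat := mscale [:: (0, -1)%ZZ] A.
Definition mrow (B : smat) (k : N) : svec :=
  if N.ltb k 32 then nth [::] B (N.to_nat k) else [::].
Fixpoint rmul (r : svec) (B : smat) : svec :=
  if r is t :: r' then sadd (sscale t.2 (mrow B t.1)) (rmul r' B) else [::].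
Definition mmul (A B : smat) : smat := [seq rmul r B | r <- A].
Definition rcol (i j : N) (r : svec) : svec :=
  [seq (i, t.2) | t <- r & N.eqb t.1 j].
Fixpoint mcol (i j : N) (A : smat) : svec :=
  if A is r :: A' then rcol i j r ++ mcol (N.succ i) j A' else [::].
Definition mtr (A : smat) : smat := [seq mcol 0 (N.of_nat j) A | j <- iota 0 32].
Definition mzero (A : smat) : bool := all (all (fun t => nilp t.2)) A.
Definition meq (A B : smat) : bool := mzero (madd A (mopp B)).
Definition mbuild (f : nat -> nat -> lpol) : smat :=
  [seq [seq t <- [seq (N.of_nat c, f a c) | c <- iota 0 32] | ~~ nilp t.2]
     | a <- iota 0 32].

(* Diagonal matrices with monomial entries (e, c) *)
Definition sdiag := seq (Z * Z).
Fixpoint rscale (d : sdiag) (A : smat) : smat :=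
  match d, A with
  | t :: d', r :: A' => [seq (u.1, lmono t u.2) | u <- r] :: rscale d' A'
  | _, _ => [::]
  end.
Definition cscale (d : sdiag) (A : smat) : smat :=
  [seq [seq (u.1, lmono (nth (0, 0)%ZZ d (N.to_nat u.1)) u.2) | u <- r] | r <- A].
Fixpoint dmul (d d' : sdiag) : sdiag :=
  match d, d' with
  | t :: d1, t' :: d1' => (Z.add t.1 t'.1, Z.mul t.2 t'.2) :: dmul d1 d1'
  | _, _ => [::]
  end.
Definition dinv (d : sdiag) : sdiag := [seq (Z.opp t.1, t.2) | t <- d].

Definition rdot (r r' : svec) : lpol :=
  lsum (flatten [seq [seq lmul t.2 u.2 | u <- r' & N.eqb t.1 u.1]
                  | t <- r & N.ltb t.1 32]).
Fixpoint mdot (A B : smat) : lpol :=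
  match A, B with
  | r :: A', r' :: B' => ladd (rdot r r') (mdot A' B')
  | _, _ => [::]
  end.

Definition zpol := seq lpol.
Fixpoint zadd (p q : zpol) : zpol :=
  match p, q with
  | [::], _ => q
  | _, [::] => p
  | a :: p', b :: q' => ladd a b :: zadd p' q'
  end.
Definition zscale (a : lpol) (p : zpol) : zpol := [seq lmul a b | b <- p].
Fixpoint zmul (p q : zpol) : zpol :=
  if p is a :: p' then zadd (zscale a q) ([::] :: zmul p' q) else [::].
Definition zopp (p : zpol) : zpol := [seq lopp a | a <- p].
Definition zzero (p : zpol) : bool := all (fun a : lpol => nilp a) p.
Definition zeq (p q : zpol) : bool := zzero (zadd p (zopp q)).
Definition zsum (s : seq zpol) : zpol := foldr zadd [::] s.

(* Long division from the lowest term, for a divisor with lowest coefficient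
   1 or -1; the caller checks the result. *)
Fixpoint ldiv (fuel : nat) (m : Z) (p d : lpol) : option lpol :=
  match fuel, p, d with
  | _, [::], _ => Some [::]
  | S fuel', (e, c) :: _, (e0, c0) :: _ =>
      if Z.ltb m e then None else
      let t := (Z.sub e e0, Z.mul c c0) in
      match ldiv fuel' m (ladd p (lmono (t.1, Z.opp t.2) d)) d with
      | Some q => Some (t :: q)
      | None => None
      end
  | _, _, _ => None
  end.
Arguments ldiv : simpl never.
Definition ltop (p : lpol) : Z := (last (0, 0)%ZZ p).1.
(** Trial division, staying with a divisor as long as the quotient multiplies back to p. Success
    exhibits p as a product of members of ds, up to a sign and a power of h. The bound handed to
    [ldiv] stops the division once the quotient would exceed its possible degree. *)
Fixpoint lunit (fuel : nat) (ds : seq lpol) (p : lpol) : bool :=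
  match p, fuel, ds with
  | [:: (_, c)], _, _ => (Z.eqb c 1) || (Z.eqb c (-1))
  | _, S fuel', d :: ds' =>
      match ldiv 1000 (Z.add (Z.sub (ltop p) (ltop d)) (head (0, 0)%ZZ d).1) p d with
      | Some q => leq (lmul q d) p && lunit fuel' ds q
      | None => lunit fuel' ds' p
      end
  | _, _, _ => false
  end.

(** * Soundness of the sparse computations *)

Section Semantics.
Context (C : fieldType) (h : C).
Hypothesis h0 : h != 0.

Definition zint (c : Z) : C := (int_of_Z c)%:~R.
Definition zexp (e : Z) : C := h ^ int_of_Z e.

Lemma zintD c d : zint (Z.add c d) = zint c + zint d.
Proof. by rewrite /zint -rmorphD /= -rmorphD. Qed.
Lemma zintM c d : zint (Z.mul c d) = zint c * zint d.
Proof. by rewrite /zint -rmorphM /= -rmorphM. Qed.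
Lemma zintN c : zint (Z.opp c) = - zint c.
Proof. by rewrite /zint -rmorphN /= -rmorphN. Qed.
Lemma zexpD e f : zexp (Z.add e f) = zexp e * zexp f.
Proof.
rewrite /zexp -expfzDr //; congr (h ^ _).
exact: (rmorphD int_of_Z e f).
Qed.
Lemma zexpN e : zexp (Z.opp e) = (zexp e)^-1.
Proof.
rewrite /zexp invr_expz; congr (h ^ _).
exact: (rmorphN int_of_Z e).
Qed.

Definition lev (p : lpol) : C := \sum_(t <- p) zint t.2 * zexp t.1.

Lemma lev_nil : lev [::] = 0. Proof. exact: big_nil. Qed.
Lemma lev_cons t p : lev (t :: p) = zint t.2 * zexp t.1 + lev p.
Proof. exact: big_cons. Qed.

Lemma lev_add p q : lev (ladd p q) = lev p + lev q.
Proof.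
elim: p q => [|[e c] p IHp] q; first by rewrite lev_nil add0r; case: q.
elim: q => [|[e' c'] q IHq]; first by rewrite lev_nil addr0.
have -> : ladd ((e, c) :: p) ((e', c') :: q) =
    match Z.compare e e' with
    | Lt => (e, c) :: ladd p ((e', c') :: q)
    | Gt => (e', c') :: ladd ((e, c) :: p) q
    | Eq => if Z.eqb (Z.add c c') 0 then ladd p q
            else (e, Z.add c c') :: ladd p q
    end by [].
case: Z.compare_spec => [->|_|_].
- rewrite (fun_if lev) !lev_cons IHp /= zintD mulrDl [RHS]addrACA.
  case: Z.eqb_spec => // c0; rewrite -mulrDl -zintD c0 /zint rmorph0 /=.
  by rewrite mul0r add0r.
- by rewrite !lev_cons IHp lev_cons addrA.
- by rewrite !lev_cons IHq lev_cons /= addrCA.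
Qed.

Lemma lev_mono t p : lev (lmono t p) = zint t.2 * zexp t.1 * lev p.
Proof.
rewrite /lev big_map mulr_sumr; apply: eq_bigr => u _ /=.
by rewrite zintM zexpD mulrACA.
Qed.

Lemma lev_opp p : lev (lopp p) = - lev p.
Proof.
rewrite /lev big_map -sumrN; apply: eq_bigr => u _ /=.
by rewrite zintN mulNr.
Qed.

Lemma lev_mul p q : lev (lmul p q) = lev p * lev q.
Proof.
elim: p => [|t p IH]; first by rewrite !lev_nil mul0r.
by rewrite /= lev_add lev_mono IH lev_cons mulrDl.
Qed.

Lemma lev_h e : lev (lh e) = zexp e.
Proof. by rewrite lev_cons lev_nil addr0 mul1r. Qed.

Lemma lev_l1 : lev l1 = 1.
Proof. by rewrite lev_cons lev_nil addr0 mul1r. Qed.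

Lemma lev_sum s : lev (lsum s) = \sum_(p <- s) lev p.
Proof.
elim: s => [|p s IH]; first by rewrite big_nil lev_nil.
by rewrite big_cons /= lev_add IH.
Qed.

Lemma lev_eq p q : leq p q -> lev p = lev q.
Proof.
move=> /nilP pq; apply/eqP; rewrite -subr_eq0 -lev_opp -lev_add pq.
by rewrite lev_nil.
Qed.

Lemma lunit_neq0 ds : (forall d, d \in ds -> lev d != 0) ->
  forall fuel p, lunit fuel ds p -> lev p != 0.
Proof.
have mono e c : (Z.eqb c 1) || (Z.eqb c (-1)) -> lev [:: (e, c)] != 0.
  rewrite lev_cons lev_nil addr0 mulf_eq0 negb_or expfz_neq0 // andbT.
  by case/orP => /Z.eqb_spec ->; rewrite /zint ?rmorphN ?oppr_eq0 oner_neq0.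
move=> ds0 fuel; elim: fuel ds ds0 => [|fuel IH] ds ds0 p.
  by case: p => [|[e c] [|? ?]] //=; apply: mono.
have step : (match ds with [::] => false | d :: ds' =>
      match ldiv 1000 (Z.add (Z.sub (ltop p) (ltop d)) (head (0, 0)%ZZ d).1) p d with
      | Some q => leq (lmul q d) p && lunit fuel ds q
      | None => lunit fuel ds' p
      end end) -> lev p != 0.
  case: ds ds0 => [|d ds'] // ds0; case: ldiv => [q /andP [/lev_eq <- qu]|].
    rewrite lev_mul mulf_neq0 //; first exact: (IH (d :: ds')).
    by rewrite ds0 ?mem_head.
  by apply: IH => e eds; apply: ds0; rewrite in_cons eds orbT.
case: p step => [|[e c] [|t p]] step; [|exact: mono|];
  by case: ds ds0 step => [|d ds'] // ds0 step; apply: step.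
Qed.

Definition scoef (v : svec) (c : nat) : C :=
  \sum_(t <- v) (if N.to_nat t.1 == c then lev t.2 else 0).

Lemma scoef_nil c : scoef [::] c = 0. Proof. exact: big_nil. Qed.
Lemma scoef_cons t v c :
  scoef (t :: v) c = (if N.to_nat t.1 == c then lev t.2 else 0) + scoef v c.
Proof. exact: big_cons. Qed.

Lemma scoef_add p q c : scoef (sadd p q) c = scoef p c + scoef q c.
Proof.
elim: p q => [|[e a] p IHp] q; first by rewrite scoef_nil add0r; case: q.
elim: q => [|[e' a'] q IHq]; first by rewrite scoef_nil addr0.
have -> : sadd ((e, a) :: p) ((e', a') :: q) =
    match N.compare e e' with
    | Lt => (e, a) :: sadd p ((e', a') :: q)
    | Gt => (e', a') :: sadd ((e, a) :: p) q
    | Eq => if nilp (ladd a a') then sadd p q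
            else (e, ladd a a') :: sadd p q
    end by [].
case: N.compare_spec => [->|_|_].
- rewrite (fun_if (scoef ^~ c)) !scoef_cons IHp /= [RHS]addrACA.
  have -> : (if N.to_nat e' == c then lev a else 0) +
    (if N.to_nat e' == c then lev a' else 0) =
    if N.to_nat e' == c then lev (ladd a a') else 0.
    by case: eqP => _; rewrite ?lev_add ?addr0.
  case: nilP => // ->; rewrite lev_nil.
  by case: eqP => _; rewrite add0r.
- by rewrite !scoef_cons IHp scoef_cons addrA.
- by rewrite !scoef_cons IHq scoef_cons /= addrCA.
Qed.

Lemma scoef_scale p v c : scoef (sscale p v) c = lev p * scoef v c.
Proof.
rewrite /scoef big_map mulr_sumr; apply: eq_bigr => t _ /=.
by case: eqP => _; rewrite ?lev_mul ?mulr0.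
Qed.

Definition mcoef (A : smat) (a c : nat) : C := scoef (nth [::] A a) c.
Definition mev (A : smat) : 'M[C]_32 := \matrix_(a, c) mcoef A a c.

Lemma mev_add A B : mev (madd A B) = mev A + mev B.
Proof.
apply/matrixP => a c; rewrite !mxE /mcoef -scoef_add; congr scoef.
have s0 v : sadd [::] v = v by case: v.
have v0 v : sadd v [::] = v by case: v => [|[? ?] ?].
elim: A B (nat_of_ord a) => [|r A IH] [|r' B] [|i] //=;
  rewrite ?nth_nil ?s0 ?v0 //; exact: IH.
Qed.

Lemma mev_scale p A : mev (mscale p A) = lev p *: mev A.
Proof.
apply/matrixP => a c; rewrite !mxE /mcoef -scoef_scale; congr scoef.
by elim: A (nat_of_ord a) => [|r A IH] [|i] //=.
Qed.

Lemma mev_opp A : mev (mopp A) = - mev A.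
Proof.
by rewrite mev_scale lev_cons lev_nil addr0 (zintN 1) mulN1r scaleN1r.
Qed.

Lemma mev_zero A : mzero A -> mev A = 0.
Proof.
move=> /allP A0; apply/matrixP => a c; rewrite !mxE /mcoef.
have [aA|Aa] := ltnP a (size A); last by rewrite nth_default // scoef_nil.
have := A0 _ (mem_nth [::] aA); elim: (nth _ _ _) => [|t v IH] /=.
  by rewrite scoef_nil.
case/andP => /nilP t0 /IH v0.
by rewrite scoef_cons v0 t0 lev_nil addr0 if_same.
Qed.

Lemma mev_eq A B : meq A B -> mev A = mev B.
Proof.
by move=> /mev_zero /eqP; rewrite mev_add mev_opp subr_eq0 => /eqP.
Qed.

Lemma scoef_rmul r B c : scoef (rmul r B) c =
  \sum_(j < 32) scoef r j * mcoef B j c.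
Proof.
elim: r => [|t r IH] /=.
  by rewrite scoef_nil big1 // => j _; rewrite scoef_nil mul0r.
rewrite scoef_add scoef_scale IH.
under [RHS]eq_bigr => j _ do rewrite scoef_cons mulrDl.
rewrite big_split /=; congr (_ + _).
rewrite /mrow; case: N.ltb_spec => tlt.
  have tlt' : (N.to_nat t.1 < 32)%N by lia.
  rewrite (bigD1 (Ordinal tlt')) //= eqxx big1 ?addr0 // => j.
  by rewrite -val_eqE eq_sym => /negPf /= ->; rewrite mul0r.
rewrite scoef_nil mulr0 big1 // => j _; case: eqP => [tj|_]; last by rewrite mul0r.
by have := ltn_ord j; lia.
Qed.

Lemma mev_mul A B : mev (mmul A B) = mev A *m mev B.
Proof.
apply/matrixP => a c; rewrite !mxE /mcoef.
have -> : nth [::] (mmul A B) a = rmul (nth [::] A a) B.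
  by elim: A (nat_of_ord a) => [|r A IH] [|i] //=.
by rewrite scoef_rmul; apply: eq_bigr => j _; rewrite !mxE.
Qed.

Lemma mev_tr A : mev (mtr A) = (mev A)^T.
Proof.
apply/matrixP => a c; rewrite !mxE /mcoef (nth_map 0%N) ?size_iota //.
rewrite nth_iota // add0n.
suff H i0 : scoef (mcol i0 (N.of_nat a) A) c =
    if (N.to_nat i0 <= c)%N then scoef (nth [::] A (c - N.to_nat i0)) a else 0.
  by rewrite H /= subn0.
elim: A i0 => [|r A IH] i0 /=.
  by rewrite nth_nil !scoef_nil if_same.
have -> v w : scoef (v ++ w) c = scoef v c + scoef w c by rewrite /scoef big_cat.
have -> : scoef (rcol i0 (N.of_nat a) r) c =
    if N.to_nat i0 == c then scoef r a else 0.
  rewrite /scoef big_map /= big_filter big_mkcond /=.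
  case: eqP => _; last by rewrite big1 // => t _; case: ifP.
  apply: eq_bigr => t _; case: N.eqb_spec => [->|ta].
    by rewrite Nnat.Nat2N.id eqxx.
  by case: eqP => // taE; case: ta; lia.
rewrite IH Nnat.N2Nat.inj_succ; have [ci|ic|ci] := ltngtP (N.to_nat i0) c.
- have -> : (c - N.to_nat i0)%N = (c - (N.to_nat i0).+1).+1 by lia.
  by rewrite add0r.
- by rewrite addr0.
- by rewrite ci subnn /= addr0.
Qed.

Lemma mev_build f : mev (mbuild f) = \matrix_(a, c) lev (f a c).
Proof.
apply/matrixP => a c; rewrite !mxE /mcoef (nth_map 0%N) ?size_iota //.
rewrite nth_iota // add0n /scoef big_filter big_map big_mkcond /=.
transitivity (\sum_(0 <= i < 32) (if i == c then lev (f a i) else 0)).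
  rewrite /index_iota subn0; apply: eq_bigr => i _; rewrite Nnat.Nat2N.id.
  by case: nilP => [->|//]; rewrite lev_nil if_same.
rewrite big_mkord (bigD1 c) //= eqxx big1 ?addr0 // => i.
by rewrite -val_eqE => /negPf /= ->.
Qed.

Definition dev_ (d : sdiag) (i : nat) : C :=
  zint (nth (0, 0)%ZZ d i).2 * zexp (nth (0, 0)%ZZ d i).1.
Definition dev (d : sdiag) : 'M[C]_32 := diag_mx (\row_(j < 32) dev_ d j).

Lemma mev_rscale d A : mev (rscale d A) = dev d *m mev A.
Proof.
apply/matrixP => a c; rewrite mul_diag_mx !mxE /mcoef /dev_.
elim: d A (nat_of_ord a) => [|t d IH] A i /=.
  by rewrite !nth_nil scoef_nil mul0r mul0r.
case: A => [|r A]; first by rewrite nth_nil scoef_nil mulr0.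
case: i => [|i] //=; rewrite /scoef big_map mulr_sumr; apply: eq_bigr => u _ /=.
by case: eqP => _; rewrite ?lev_mono ?mulr0.
Qed.

Lemma mev_cscale d A : mev (cscale d A) = mev A *m dev d.
Proof.
apply/matrixP => a c; rewrite mul_mx_diag !mxE /mcoef /dev_.
elim: A (nat_of_ord a) => [|r A IH] [|i] //=; rewrite ?scoef_nil ?mul0r //.
rewrite /scoef big_map mulr_suml; apply: eq_bigr => u _ /=.
by case: eqP => [->|_]; rewrite ?lev_mono ?mul0r // mulrC.
Qed.

Lemma dev_mul d d' : dev (dmul d d') = dev d *m dev d'.
Proof.
rewrite mulmx_diag; congr diag_mx; apply/rowP => j; rewrite !mxE /dev_.
elim: d d' (nat_of_ord j) => [|t d IH] [|t' d'] [|i] //=;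
  rewrite ?nth_nil ?mul0r ?mulr0 //.
by rewrite zintM zexpD mulrACA.
Qed.

Lemma lev_rdot r r' : lev (rdot r r') =
  \sum_(j < 32) scoef r j * scoef r' j.
Proof.
rewrite /rdot lev_sum big_flatten /= big_map.
have E t : \sum_(p <- [seq lmul t.2 u.2 | u <- r' & N.eqb t.1 u.1]) lev p =
    lev t.2 * scoef r' (N.to_nat t.1).
  rewrite big_map big_filter big_mkcond mulr_sumr; apply: eq_bigr => u _ /=.
  case: N.eqb_spec => [->|tu]; first by rewrite eqxx lev_mul.
  by case: eqP => [tuE|_]; [case: tu; lia|rewrite mulr0].
under eq_bigr => t _ do rewrite E.
elim: r => [|t r IH].
  by rewrite big_nil big1 // => j _; rewrite scoef_nil mul0r.
under [in RHS]eq_bigr => j _ do rewrite scoef_cons mulrDl.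
rewrite [in RHS]big_split /= -IH; case: N.ltb_spec => tlt.
  rewrite big_cons; congr (_ + _).
  have tlt' : (N.to_nat t.1 < 32)%N by lia.
  rewrite (bigD1 (Ordinal tlt')) //= eqxx big1 ?addr0 // => j.
  by rewrite -val_eqE eq_sym => /negPf /= ->; rewrite mul0r.
rewrite [X in _ = X + _]big1 ?add0r // => j _.
case: eqP => [tj|_]; last by rewrite mul0r.
by have := ltn_ord j; lia.
Qed.

Lemma lev_mdot A B : (size A <= 32)%N ->
  lev (mdot A B) = \sum_a \sum_c mev A a c * mev B a c.
Proof.
have H n : (size A <= n)%N -> lev (mdot A B) =
    \sum_(a < n) \sum_(c < 32) mcoef A a c * mcoef B a c.
  rewrite /mcoef; elim: A B n => [|r A IH] B n.
    move=> _; rewrite lev_nil big1 // => a _; rewrite big1 // => c _.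
    by rewrite nth_nil scoef_nil mul0r.
  case: n => // n An; rewrite big_ord_recl /=.
  case: B => [|r' B]; last by rewrite lev_add lev_rdot (IH _ n).
  rewrite lev_nil big1 ?add0r => [|c _]; last by rewrite scoef_nil mulr0.
  rewrite big1 // => a _; rewrite big1 // => c _.
  by rewrite scoef_nil mulr0.
move=> /H ->.
by apply: eq_bigr => a _; apply: eq_bigr => c _; rewrite !mxE.
Qed.

Context (z : C).

Fixpoint zev (p : zpol) : C := if p is a :: p' then lev a + z * zev p' else 0.

Lemma zev_add p q : zev (zadd p q) = zev p + zev q.
Proof.
elim: p q => [|a p IH] [|b q] //=; rewrite ?add0r ?addr0 // lev_add IH.
by rewrite mulrDr addrACA.
Qed.

Lemma zev_scale a p : zev (zscale a p) = lev a * zev p.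
Proof.
by elim: p => [|b p IH] /=; rewrite ?mulr0 // lev_mul IH mulrDr mulrCA.
Qed.

Lemma zev_mul p q : zev (zmul p q) = zev p * zev q.
Proof.
elim: p => [|a p IH] /=; first by rewrite mul0r.
by rewrite zev_add zev_scale /= lev_nil add0r IH mulrDl mulrA.
Qed.

Lemma zev_opp p : zev (zopp p) = - zev p.
Proof.
by elim: p => [|a p IH] /=; rewrite ?oppr0 // lev_opp IH mulrN opprD.
Qed.

Lemma zev_zero p : zzero p -> zev p = 0.
Proof.
elim: p => [|a p IH] //= /andP [/nilP -> /IH ->].
by rewrite lev_nil mulr0 addr0.
Qed.

Lemma zev_eq p q : zeq p q -> zev p = zev q.
Proof.
by move=> /zev_zero /eqP; rewrite zev_add zev_opp subr_eq0 => /eqP.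
Qed.

Lemma zev_sum s : zev (zsum s) = \sum_(p <- s) zev p.
Proof.
elim: s => [|p s IH] /=; first by rewrite big_nil.
by rewrite zev_add IH big_cons.
Qed.

End Semantics.

(** * The data of the theorem as computable matrices *)

(** Exponents count powers of h, so those of q are doubled. The defining quotients are divided out:
    [m]_k is a sum of m powers of q^k, [2]^i_k = q^k - q^-k and [3]^i_k = q^(2k) - 1 + q^(-2k). *)
Definition qnc (m k : nat) : lpol :=
  [seq (Z_of_int (2 * k%:Z * (2 * j%:Z + 1 - m%:Z)), 1%ZZ) | j <- iota 0 m].
Definition qic2 (k : nat) : lpol :=
  [:: (Z_of_int (- (2 * k%:Z)), -1)%ZZ; (Z_of_int (2 * k%:Z), 1%ZZ)].
Definition qic3 (k : nat) : lpol :=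
  [:: (Z_of_int (- (4 * k%:Z)), 1%ZZ); (0, -1)%ZZ; (Z_of_int (4 * k%:Z), 1%ZZ)].
Definition lq (e : Z) : lpol := lh (2 * e).

Definition Ftabc (i : nat) : seq (nat * lpol * nat) :=
  let b := bar in
  let arr (j : nat) (a : lpol) (k : nat) := (j, a, k) in
  let qn1 m := qnc m 1 in
  match i with
  | 1 => [:: arr 1 (qn1 4) 8; arr 9 (qn1 3) 2; arr 10 (qn1 3) 3;
           arr 11 (qn1 2) 4; arr 12 l1 5; arr 13 l1 6; arr 14 l1 15;
           arr 16 l1 (b 14); arr (b 6) l1 (b 13); arr (b 5) l1 (b 12);
           arr (b 4) l1 (b 11); arr (b 3) l1 (b 10); arr (b 2) l1 (b 9);
           arr (b 8) l1 (b 1)]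
  | 2 => [:: arr 8 l1 9; arr 10 l1 11; arr 11 (qn1 2) 12; arr 3 l1 4;
           arr 4 (qn1 2) 5; arr 5 (qn1 3) 7; arr 13 l1 14; arr 6 l1 16;
           arr 15 l1 (b 6); arr 16 (qn1 2) (b 6); arr 17 l1 (b 6);
           arr (b 14) l1 (b 13); arr (b 7) l1 (b 5); arr (b 5) (qn1 2) (b 4);
           arr (b 4) (qn1 3) (b 3); arr (b 12) l1 (b 11);
           arr (b 11) (qn1 2) (b 10); arr (b 9) l1 (b 8)]
  | 3 => [:: arr 9 l1 10; arr 2 l1 3; arr 12 l1 13; arr 5 l1 6; arr 7 l1 17;
           arr 16 (qn1 3) (b 7); arr 17 (qnc 2 3) (b 7); arr (b 6) l1 (b 5);
           arr (b 13) l1 (b 12); arr (b 3) l1 (b 2); arr (b 10) l1 (b 9)]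
  | _ => [::]
  end%N.

Definition flook (tab : seq (nat * lpol * nat)) (a c : nat) : lpol :=
  lsum [seq t.1.2 | t <- tab & (a == t.2) && (c == t.1.1)].

Definition lsg (b : bool) : Z := if b then (-1)%ZZ else 1%ZZ.
Definition lsgn (b : bool) : lpol := [:: (0%ZZ, lsg b)].
Definition Ecoefc (i k j : nat) : lpol :=
  let f := flook (Ftabc i) in
  let b := bar in
  let s := lsgn (sgen i) in
  if (j <= 14)%N && (k <= 14)%N then f (b k) (b j)
  else if (18 <= j <= 31)%N && (18 <= k <= 31)%N then lmul s (f (b k) (b j))
  else if (15 <= j <= 17)%N && (k \in [:: 6; 7; 14]%N) then f (b k) j
  else if (15 <= k <= 17)%N && (b j \in [:: 6; 7; 14]%N) then lmul s (f k (b j))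
  else [::].

Definition munit (a c : nat) : smat :=
  mbuild (fun i j => if (i == a.-1) && (j == c.-1) then l1 else [::]).

Definition msub (A B : smat) : smat := madd A (mopp B).
Definition msum (s : seq smat) : smat := foldr madd [::] s.

(* Formal expressions for scalars, vectors and polynomials in z, so that the
   same expression can be computed and be read in the field *)
Inductive lexp :=
  | LQn of nat & nat | LQi2 of nat | LQi3 of nat | LP of nat | LN of nat
  | LC of Z | LM of lexp & lexp | LA of lexp & lexp | LB of lexp & lexp | LO of lexp.
Fixpoint lcomp (l : lexp) : lpol :=
  match l with
  | LQn m k => qnc m k
  | LQi2 k => qic2 k
  | LQi3 k => qic3 k
  | LP n => lq (Z.of_nat n)
  | LN n => lq (Z.opp (Z.of_nat n))
  | LC c => if Z.eqb c 0 then [::] else [:: (0%ZZ, c)]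
  | LM a b => lmul (lcomp a) (lcomp b)
  | LA a b => ladd (lcomp a) (lcomp b)
  | LB a b => ladd (lcomp a) (lopp (lcomp b))
  | LO a => lopp (lcomp a)
  end.
Fixpoint lwf (l : lexp) : bool :=
  match l with
  | LQn _ k | LQi2 k | LQi3 k => (0 < k)%N
  | LM a b | LA a b | LB a b => lwf a && lwf b
  | LO a => lwf a
  | _ => true
  end.

Inductive mexp :=
  | MU of nat & nat | MS of lexp & mexp | MA of mexp & mexp | MB of mexp & mexp
  | MO of mexp.
Fixpoint mcomp (m : mexp) : smat :=
  match m with
  | MU a c => munit a c
  | MS l a => mscale (lcomp l) (mcomp a)
  | MA a b => madd (mcomp a) (mcomp b)
  | MB a b => msub (mcomp a) (mcomp b)
  | MO a => mopp (mcomp a)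
  end.
Fixpoint mwf (m : mexp) : bool :=
  match m with
  | MU a c => (0 < a <= 32)%N && (0 < c <= 32)%N
  | MS l a => lwf l && mwf a
  | MA a b | MB a b => mwf a && mwf b
  | MO a => mwf a
  end.

Inductive zexpr :=
  | ZC of lexp | ZX | ZM of zexpr & zexpr | ZA of zexpr & zexpr
  | ZB of zexpr & zexpr | ZO of zexpr.
Fixpoint zcomp (p : zexpr) : zpol :=
  match p with
  | ZC l => [:: lcomp l]
  | ZX => [:: [::]; l1]
  | ZM a b => zmul (zcomp a) (zcomp b)
  | ZA a b => zadd (zcomp a) (zcomp b)
  | ZB a b => zadd (zcomp a) (zopp (zcomp b))
  | ZO a => zopp (zcomp a)
  end.
Fixpoint zwf (p : zexpr) : bool :=
  match p with
  | ZC l => lwf l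
  | ZX => true
  | ZM a b | ZA a b | ZB a b => zwf a && zwf b
  | ZO a => zwf a
  end.

(* E_0 and F_0 are scaled by [3]^i to clear the denominators. *)
Definition F0e : mexp :=
  let d := LQi3 1 in let b := bar in
  MA (MB (MB (MB (MA (MB (MS (LQn 2 6) (MU 15 (b 1)))
    (MS (LM d (LQn 4 1)) (MU 16 (b 1))))
    (MS (LM (LQn 2 2) (LQn 3 1)) (MU 17 (b 1))))
    (MS (LQn 3 1) (MU 32 (b 1)))) (MS d (MU 1 15)))
    (MS (LM d (LM (LQi2 1) (LQi2 1))) (MU 1 32)))
    (MS d (MA (MU 8 18) (MA (MU 9 19) (MA (MU 10 20) (MA (MU 11 21)
       (MA (MU 12 22) (MA (MU 13 23) (MU 14 24)))))))).
Definition E0e : mexp :=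
  let d := LQi3 1 in let b := bar in
  MA (MA (MA (MA (MB (MA (MO (MS (LQn 2 6) (MU 15 1)))
    (MS (LM d (LQn 4 1)) (MU 16 1)))
    (MS (LM (LQn 2 2) (LQn 3 1)) (MU 17 1)))
    (MS (LQn 3 1) (MU 32 1))) (MS d (MU (b 1) 15)))
    (MS (LM d (LM (LQi2 1) (LQi2 1))) (MU (b 1) 32)))
    (MS d (MA (MU 18 8) (MA (MU 19 9) (MA (MU 20 10) (MA (MU 21 11)
       (MA (MU 22 12) (MA (MU 23 13) (MU 24 14)))))))).

Definition Fc_expr (i : nat) : smat :=
  if i == 0%N then mcomp F0e else mbuild (fun a c => flook (Ftabc i) a.+1 c.+1).
Definition Ec_expr (i : nat) : smat :=
  if i == 0%N then mcomp E0e else mbuild (fun a c => Ecoefc i a.+1 c.+1).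

Definition Ftable : seq smat := Eval vm_compute in [seq Fc_expr i | i <- iota 0 4].
Definition Etable : seq smat := Eval vm_compute in [seq Ec_expr i | i <- iota 0 4].
Definition Fc (i : nat) : smat := nth [::] Ftable i.
Definition Ec (i : nat) : smat := nth [::] Etable i.

(* Exponents of h of the eigenvalues of K_i^{1/2} *)
Definition Ktable : seq sdiag := Eval vm_compute in
  [seq [seq (Z_of_int (kexp i a.+1), 1%ZZ) | a <- iota 0 32] | i <- iota 0 4].
Definition Kc (i : nat) : sdiag := nth [::] Ktable i.
Definition par1 (a : nat) : bool := vodd a.+1.
Definition dparc (p : bool) : sdiag := Eval vm_compute in
  [seq (0%ZZ, if p && par1 a then (-1)%ZZ else 1%ZZ) | a <- iota 0 32].
Definition Lc (i : nat) : sdiag := dmul (dinv (Kc i)) (dparc (sgen i)).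

(** The coproduct at spectral parameters 1, on a tensor written as a matrix: M x K_i + L_i x M^T. *)
Definition opc (M : smat) (i : nat) (x : smat) : smat :=
  madd (cscale (Kc i) (mmul M x)) (mmul (rscale (Lc i) x) (mtr M)).

(* A symmetric form on V for which E_i and F_i are adjoint up to sign *)
Definition gdiag (a : nat) : lpol :=
  if a \in [:: 1; 31]%N then lmul (qnc 3 1) (qnc 4 1)
  else if a \in [:: 2; 3; 7; 25; 29; 30]%N then l1
  else if a \in [:: 11; 16]%N then lmul (qnc 2 1) (qnc 3 1)
  else if a == 21%N then lopp (lmul (qnc 2 1) (qnc 3 1))
  else if a \in [:: 18; 19; 20; 22; 23; 24]%N then lopp (qnc 3 1)
  else if a == 15%N then [::] else if a == 17%N then qnc 2 3
  else if a == 32%N then lmul (lmul (qic2 1) (qic2 1)) (lmul (qnc 4 1) (qic3 1))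
  else qnc 3 1.
(** v_15, v_16, v_17 all have weight 0 and the form is not diagonal on them. v_32 also has weight 0
    but is orthogonal to them; its norm is dictated by the adjointness of E_0 and -F_0, which link
    it to v_1. *)
Definition gc : smat := Eval vm_compute in
  mbuild (fun a c => if a == c then gdiag a.+1 else
    if (a.+1, c.+1) \in [:: (15, 16); (16, 15); (16, 17); (17, 16)]%N
    then qnc 3 1 else [::]).

Definition lincomb (s : seq (lpol * nat * nat)) : smat :=
  foldr (fun t A => madd (mscale t.1.1 (munit t.1.2 t.2)) A) [::] s.

Definition u4ae : mexp :=
  MA (MB (MB (MA (MO (MS (LQi3 2)
      (MB (MS (LP 3) (MU 1 15)) (MS (LN 3) (MU 15 1)))))
    (MS (LQn 2 3) (MB (MS (LP 3) (MU 1 16)) (MS (LN 3) (MU 16 1)))))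
    (MS (LQn 3 1) (MB (MS (LP 3) (MU 1 17)) (MS (LN 3) (MU 17 1)))))
    (MS (LQn 2 3) (MA (MA (MB (MB (MA
      (MS (LP 5) (MU 8 14)) (MS (LN 5) (MU 14 8)))
      (MS (LP 4) (MU 9 13))) (MS (LN 4) (MU 13 9)))
      (MS (LP 1) (MU 10 12))) (MS (LN 1) (MU 12 10)))))
    (MS (LQi3 1) (MU 11 11)).

Definition u5ae : mexp :=
  let p e a c := MS (LP e) (MU a c) in let n e a c := MS (LN e) (MU a c) in
  let b := bar in
  MA (MA (MB (MA (MA (MS (LQi3 1) (MA (p 10 1 (b 1))
        (n 10 (b 1) 1)))
        (MS (LM (LQn 3 2) (LQn 4 1)) (MA (MA (MB (MB (MA (p 9 2 (b 2))
        (n 9 (b 2) 2))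
        (p 6 3 (b 3)))
        (n 6 (b 3) 3))
        (p 3 7 (b 7)))
        (n 3 (b 7) 7))))
        (MS (LM (LQn 4 1) (LQi3 1)) (MB (MB (MB (MA (MA (MB (MB
        (MA (MB (MA (MA (MB (MB (MA (MA (MA (MB (MB (MA (p 5 4 (b 4))
        (n 5 (b 4) 4))
        (p 4 5 (b 5)))
        (n 4 (b 5) 5))
        (p 1 6 (b 6)))
        (n 1 (b 6) 6))
        (p 10 8 (b 8)))
        (n 10 (b 8) 8))
        (p 9 9 (b 9)))
        (n 9 (b 9) 9))
        (p 6 10 (b 10)))
        (n 6 (b 10) 10))
        (p 4 12 (b 12)))
        (n 4 (b 12) 12))
        (p 1 13 (b 13)))
        (n 1 (b 13) 13))
        (MU 14 (b 14)))
        (MU (b 14) 14))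
        (MU 15 16))
        (MU 16 15))))
        (MS (LM (LQn 2 2) (LQi3 1)) (MB (p 5 11 (b 11))
        (n 5 (b 11) 11))))
        (MS (LM (LQn 2 2) (LQi3 2)) (MU 15 15)))
        (MS (LM (LQn 2 2) (LQn 3 1)) (MB (MA (MU 15 17) (MU 17 15)) (MU 17 17))).

(** The second and third vectors, of weights (8,1,0) and (7,0,1), are not named in the statement,
    where only their span matters; the third involves half-integral powers of q. The others are v_1
    (x) v_1, the u_4 and the u_5. *)
Definition sing_expr : seq smat :=
  [:: munit 1 1;
      lincomb [:: (lh (-4), 1, 8); (lopp (lh 4), 8, 1)]%N;
      lincomb [:: (lopp (lh (-6)), 1, 2); (lopp (lh 6), 2, 1); (lh 1, 8, 9);
                  (lopp (lh (-1)), 9, 8)]%N;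
      mcomp u4ae; munit 1 32; munit 32 1; mcomp u5ae; munit 32 32].
Definition singc : seq smat := Eval vm_compute in sing_expr.
Definition sc (k : nat) : smat := nth [::] singc k.
(* The coordinate of v_a (x) v_c which vanishes on all singular vectors but
   the k-th *)
Definition skey (k : nat) : nat * nat :=
  nth (0, 0)%N [:: (1, 1); (1, 8); (1, 2); (1, 17); (1, 32); (32, 1); (1, 31);
                   (32, 32)]%N k.

Definition sclass (k : nat) : weight :=
  nth (0, 0, 0) [:: (8, 0, 0); (8, 1, 0); (7, 0, 1); (4, 0, 0); (4, 0, 0);
                    (4, 0, 0); (0, 0, 0); (0, 0, 0)] k.

(* The orbit of E_0 under the adjoint action of the E_i, i > 0: the n-th node has
   the weight of v_(node n) and is the image of the node p under ad E_i, for
   (i, p) = nth _ parents n.-1. *)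
Definition nodes : seq nat :=
  [:: 31; 24; 23; 30; 22; 29; 21; 28; 20; 27; 19; 25; 26; 18; 17; 16; 15; 6; 7;
      14; 13; 5; 12; 4; 11; 3; 10; 2; 9; 8; 1]%N.
Definition node (n : nat) : nat := nth 0%N nodes n.
Definition parents : seq (nat * nat) :=
  [:: (1, 0); (2, 1); (1, 2); (3, 2); (3, 3); (2, 4); (2, 5); (2, 6); (2, 7);
      (3, 8); (2, 9); (3, 9); (2, 10); (3, 11); (2, 12); (1, 13); (2, 14);
      (3, 14); (1, 15); (1, 17); (3, 17); (3, 20); (2, 21); (2, 22); (2, 23);
      (2, 24); (3, 25); (3, 26); (2, 28); (1, 29)]%N.
(* ad E_i maps the node n to b / a times the node m, for (n, i, m, a, b) in this
   list, and to 0 if there is no such entry. *)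
Definition adrel : seq (nat * nat * nat * lpol * lpol) :=
  [seq (t.2.2, t.2.1, t.1, l1, l1) | t <- zip (iota 1 30) parents] ++
  let n2 := qnc 2 1 in let n3 := qnc 3 1 in
  [:: (4, 1, 5, l1, l1); (6, 1, 7, n3, n2); (8, 1, 9, n3, l1);
      (10, 1, 12, n3, l1); (15, 2, 17, n3, n2); (15, 3, 18, qnc 2 3, l1);
      (16, 2, 17, lmul n3 n3, l1); (18, 2, 21, l1, qnc 2 3);
      (19, 2, 20, n3, l1); (21, 1, 22, l1, l1); (23, 1, 24, l1, n2);
      (25, 1, 26, l1, n3); (27, 1, 28, l1, n3)]%N.
Definition adnext (n i : nat) : option (nat * lpol * lpol) :=
  ohead [seq (t.1.1.2, t.1.2, t.2) | t <- adrel & (t.1.1.1.1 == n) && (t.1.1.1.2 == i)].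

(** The twisted commutator for the first tensor leg if [sg] is true, for the second otherwise. Here
    m is the exponent for K_i^(1/2); it is doubled because the other leg contributes a factor of the
    same size to the ratio. *)
Definition adc (sg : bool) (i n : nat) (X : smat) : smat :=
  let m := (nth (0, 0)%ZZ (Kc i) (node n).-1).1 in
  let e := if sg then Z.opp (Z.add m m) else Z.add m m in
  msub (mmul (Ec i) X)
    (mscale [:: (e, lsg (sgen i && vodd (node n)))] (mmul X (Ec i))).
Definition families (sg : bool) : seq smat :=
  foldl (fun Xs t => rcons Xs (adc sg t.1 t.2 (nth [::] Xs t.2))) [:: Ec 0] parents.
Definition Knodes : seq sdiag :=
  foldl (fun Ks t => rcons Ks (dmul (Kc t.1) (nth [::] Ks t.2))) [:: Kc 0] parents.

(** The cyclotomic polynomials in q of the orders listed in [cyclo_orders]. Each divides q^n - 1 for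
    its order n, so none of them vanishes at a q which is not a root of unity. *)
Definition cyclo : seq lpol := Eval vm_compute in
  let x (e : Z) (c : Z) := ((2 * e)%ZZ, c) in
  [seq [seq x t.1 t.2 | t <- p] | p <-
   [:: [:: (0, -1); (1, 1)];
       [:: (0, 1); (1, 1)];
       [:: (0, 1); (1, 1); (2, 1)];
       [:: (0, 1); (2, 1)];
       [:: (0, 1); (1, -1); (2, 1)];
       [:: (0, 1); (1, 1); (2, 1); (3, 1); (4, 1); (5, 1); (6, 1)];
       [:: (0, 1); (4, 1)];
       [:: (0, 1); (3, 1); (6, 1)];
       [:: (0, 1); (2, -1); (4, 1)];
       [:: (0, 1); (1, -1); (2, 1); (3, -1); (4, 1); (5, -1); (6, 1)];
       [:: (0, 1); (8, 1)];
       [:: (0, 1); (3, -1); (6, 1)];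
       [:: (0, 1); (4, -1); (8, 1)]]]%ZZ.
Definition cyclo_orders : seq Z := [:: 1; 2; 3; 4; 6; 7; 8; 9; 12; 14; 16; 18; 24]%ZZ.
Definition check_cyclo : bool :=
  all2 (fun d n => let p := [:: (0, -1); (2 * n, 1)]%ZZ in
    if ldiv 1000 (2 * n) p d is Some q then leq (lmul q d) p else false)
    cyclo cyclo_orders.
Definition lunitc (p : lpol) : bool := lunit 200 cyclo p.

Definition Bc (i j : nat) : Z := Z_of_int (Btilde i j).
Definition rng (a n : nat) := iota a n.

(* X D = c D X, for a diagonal matrix D *)
Definition qcomm (t : Z * Z) (D : sdiag) (X : smat) : bool :=
  meq (rscale D X) (mscale [:: t] (cscale D X)).

Definition deq (d d' : sdiag) : bool :=
  all2 (fun t u => Z.eqb t.1 u.1 && Z.eqb t.2 u.2) d d'.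

Definition heights : seq nat :=
  [:: 16; 13; 12; 11; 10; 9; 9; 15; 14; 13; 12; 11; 10; 9; 8; 8; 8; 7; 6; 5; 4; 3;
      2; 1; 7; 7; 6; 5; 4; 3; 0; 0]%N.
Definition check_heights : bool :=
  all (fun i => all (fun a => all (fun t =>
    (nth 0 heights (N.to_nat t.1) < nth 0 heights a)%N) (nth [::] (Ec i) a))
    (rng 0 32)) (rng 1 3).
Definition check_K : bool :=
  all (fun i => (size (Kc i) == 32%N) && all (fun t => Z.eqb t.2 1) (Kc i)) (rng 0 4)
  && all (fun k => size (sc k) <= 32)%N (rng 0 8).

Definition check_weights : bool :=
  all (fun i => all (fun j => let s := lsg (sgen i && sgen j) in
    [&& qcomm (Bc j i, 1%ZZ) (Kc j) (Ec i), qcomm (Z.opp (Bc j i), 1%ZZ) (Kc j) (Fc i),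
        qcomm (Z.opp (Bc j i), s) (Lc j) (Ec i) & qcomm (Bc j i, s) (Lc j) (Fc i)])
    (rng 0 4)
    && deq (dmul (Lc i) (Lc i)) (dinv (dmul (Kc i) (Kc i)))) (rng 0 4).

Definition mdiag (d : sdiag) : smat :=
  mbuild (fun a c => if a == c then [:: nth (0, 0)%ZZ d a] else [::]).
Definition dbl (d : sdiag) : sdiag := dmul d d.
Definition check_EF : bool :=
  all (fun i => all (fun j =>
    let Y := msub (mmul (Ec i) (Fc j))
               (mscale [:: (0%ZZ, lsg (sgen i && sgen j))] (mmul (Fc j) (Ec i))) in
    if i == j then
      let d := Z_of_int (dgen i) in
      meq (mscale (ladd (lq d) (lopp (lq (Z.opp d)))) Y)
          (msub (mdiag (dbl (Kc i))) (mdiag (dinv (dbl (Kc i)))))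
    else mzero Y) (rng 1 3)) (rng 0 4).

Definition check_g : bool :=
  meq gc (mtr gc) && all (fun i =>
    qcomm (0, 1)%ZZ (Kc i) gc && qcomm (0, 1)%ZZ (Lc i) gc &&
    meq (mmul gc (Ec i)) (mscale [:: (0%ZZ, lsg (i == 0%N))] (mmul (mtr (Fc i)) gc)))
    (rng 0 4).
Definition mget (A : smat) (a c : nat) : lpol :=
  lsum [seq t.2 | t <- nth [::] A a & N.to_nat t.1 == c].
(* The inverse of the matrix of the form, up to a diagonal factor *)
Definition ginv : smat :=
  let n3 := qnc 3 1 in let g a := gdiag a in
  madd (mbuild (fun a c => if (a == c) && ~~ (14 <= a < 17)%N then l1 else [::]))
    (lincomb [:: (ladd (lmul (g 16) (g 17)) (lopp (lmul n3 n3)), 15, 15);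
                 (lopp (lmul n3 (g 17)), 15, 16); (lmul n3 n3, 15, 17);
                 (lopp (lmul n3 (g 17)), 16, 15); (lmul n3 n3, 17, 15);
                 (lopp (lmul n3 n3), 17, 17)]%N).
Definition gdet (a : nat) : lpol :=
  if (14 <= a < 17)%N then lopp (lmul (qnc 3 1) (lmul (qnc 3 1) (qnc 2 3)))
  else gdiag a.+1.
Definition check_ginv : bool :=
  meq (mmul gc ginv) (mbuild (fun a c => if a == c then gdet a else [::]))
  && all (fun a => lunitc (gdet a)) (rng 0 32).

Definition gx (x : smat) : smat := mmul (mmul gc x) gc.
Definition gramc (k : nat) : lpol := mdot (sc k) (gx (sc k)).
Definition check_sing : bool :=
  all (fun k =>
    [&& all (fun i => mzero (opc (Ec i) i (sc k)) &&
          meq (rscale (Kc i) (cscale (Kc i) (sc k)))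
              (mscale [:: (Z_of_int (dgen i * Defs.coord (sclass k) i), 1%ZZ)] (sc k)))
          (rng 1 3),
        all (fun j => let p := mdot (sc j) (gx (sc k)) in
          if j == k then lunitc p else nilp p) (rng 0 8) &
        all (fun j => let p := mget (sc k) (skey j).1.-1 (skey j).2.-1 in
          if j == k then lunitc p else nilp p) (rng 0 8)]) (rng 0 8).

(* A combination of the coordinates of the E_i x which is a multiple of the
   coordinate of x on v_1 (x) v_18 *)
Definition cert118 : seq smat :=
  let P (e0 : Z) (cs : seq Z) : lpol :=
    [seq (Z.add e0 (Z.mul 4 (Z.of_nat t.1)), t.2) | t <- zip (iota 0 (size cs)) cs] in
  [:: lincomb [:: (P (-5)%ZZ [:: 1; 2; 2; 1]%ZZ, 11, 11); (P (-5)%ZZ [:: 1; 1]%ZZ, 10, 12);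
                  (P (-15)%ZZ [:: -1; -1; -1; -1]%ZZ, 1, 15);
                  (P (-17)%ZZ [:: -1; -2; -2; -2; -1]%ZZ, 1, 16);
                  (P (-15)%ZZ [:: -1; -1; -1; -1]%ZZ, 1, 17)]%N;
      lincomb [:: (P (-3)%ZZ [:: -1; -1]%ZZ, 3, 11); (P (-2)%ZZ [:: 1; 1; 1]%ZZ, 10, 4);
                  (P (-14)%ZZ [:: 1; 1; 1; 1]%ZZ, 8, 6)]%N;
      lincomb [:: (P (-9)%ZZ [:: -1; -1; -1; -1]%ZZ, 9, 5)]%N].
(** The transpose of [opc] for the trace form on matrices. *)
Definition opTc (M : smat) (i : nat) (x : smat) : smat :=
  madd (cscale (Kc i) (mmul (mtr M) x)) (mmul (rscale (Lc i) x) M).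
Definition check_cert : bool :=
  let Y := foldr madd [::]
    [seq opTc (Ec i) i (nth [::] cert118 i.-1) | i <- rng 1 3] in
  lunitc (mget Y 0 17) && meq Y (mscale (mget Y 0 17) (munit 1 18)).

(* An entry (i, r, c) of the list says that the r-th row of E_i has a non-zero
   entry in column c, and its other entries in the known columns. *)
Fixpoint propagate (rows : bool) (known : seq nat) (rules : seq (nat * nat * nat)) :
    option (seq nat) :=
  match rules with
  | [::] => Some known
  | (i, r, c) :: rules' =>
      let R := nth [::] (Ec i) r.-1 in
      if (~~ rows || (r \in known)) && (0 < r <= 32)%N && (0 < c <= 32)%N &&
         lunitc (mget (Ec i) r.-1 c.-1) &&
         all (fun t => let m := (N.to_nat t.1).+1 in (m == c) || (m \in known)) R
      then propagate rows (c :: known) rules' else None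
  end.
(** Orders of elimination. [rules_leg] reaches the rows of v_2, ..., v_31 from that of v_1. Inside
    the row of v_1, [rules_first] uses E_2 and E_3, whose images avoid v_1, and starts from six
    distinguished coordinates and the one on v_18. Inside the row of v_32, [rules_last] uses all E_i
    and starts from v_1 and v_32. *)
Definition rules_leg : seq (nat * nat * nat) :=
  [:: (1, 1, 8); (2, 8, 9); (3, 9, 10); (1, 9, 2); (1, 10, 3); (2, 3, 4); (2, 4, 5);
      (2, 5, 7); (2, 10, 11); (2, 11, 12); (3, 5, 6); (3, 12, 13); (2, 13, 14);
      (1, 14, 16); (2, 16, 26); (3, 7, 17); (3, 17, 25); (3, 26, 27); (1, 26, 19);
      (1, 27, 20); (2, 6, 15); (2, 20, 21); (2, 21, 22); (2, 27, 28); (2, 28, 29);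
      (3, 22, 23); (3, 29, 30); (1, 15, 18); (2, 23, 24); (1, 24, 31)]%N.
Definition rules_first : seq (nat * nat * nat) :=
  [:: (2, 3, 4); (2, 4, 5); (2, 5, 7); (2, 8, 9); (2, 10, 11); (2, 11, 12);
      (2, 13, 14); (2, 18, 19); (2, 20, 21); (2, 21, 22); (2, 23, 24); (2, 16, 26);
      (2, 25, 27); (2, 27, 28); (2, 28, 29); (3, 2, 3); (3, 5, 6); (3, 9, 10);
      (3, 12, 13); (3, 7, 16); (3, 19, 20); (3, 22, 23); (3, 17, 25); (3, 29, 30);
      (2, 6, 15)]%N.
Definition rules_last : seq (nat * nat * nat) :=
  [:: (1, 9, 2); (1, 10, 3); (1, 11, 4); (1, 12, 5); (1, 13, 6); (1, 1, 8);
      (1, 14, 16); (1, 15, 18); (1, 26, 19); (1, 27, 20); (1, 28, 21); (1, 29, 22);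
      (1, 30, 23); (1, 24, 31); (2, 5, 7); (2, 8, 9); (2, 10, 11); (2, 11, 12);
      (2, 13, 14); (2, 23, 24); (2, 16, 26); (2, 25, 27); (2, 27, 28); (2, 28, 29);
      (3, 9, 10); (3, 12, 13); (3, 7, 17); (3, 17, 25); (3, 29, 30); (2, 6, 15)]%N.
Definition covers (n : nat) (o : option (seq nat)) : bool :=
  if o is Some known then all (fun a => a \in known) (rng 1 n) else false.
Definition check_rules : bool :=
  [&& covers 31 (propagate true [:: 1%N] rules_leg),
      covers 32 (propagate false [:: 1; 8; 2; 17; 31; 32; 18]%N rules_first),
      covers 32 (propagate false [:: 1; 32]%N rules_last),
      all (fun t => t.1.1 \in [:: 2; 3]%N) rules_first,
      nilp (nth [::] (Ec 2) 0), nilp (nth [::] (Ec 3) 0) &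
      all (fun i => nilp (nth [::] (Ec i) 31)) (rng 1 3)].

Definition LKnode (n : nat) : sdiag :=
  dmul (dinv (nth [::] Knodes n)) (dparc (vodd (node n))).
(** The constants a and b are the same for both values of [sg], so the two legs can be added up to
    one relation between whole nodes; n < n' is what the downward induction rests on. *)
Definition ad_ok (sg : bool) (Xs : seq smat) (n i : nat) : bool :=
  let X := nth [::] Xs n in
  let Y := adc sg i n X in
  let m := (nth (0, 0)%ZZ (Kc i) (node n).-1).1 in
  let s := lsg (sgen i && vodd (node n)) in
  let Kn := nth [::] Knodes n in
  [&& if sg then qcomm (Z.opp m, s) (Lc i) X else qcomm (m, 1%ZZ) (Kc i) X,
      if sg then qcomm (m, 1%ZZ) Kn (Ec i) else qcomm (Z.opp m, s) (LKnode n) (Ec i) &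
  if adnext n i is Some (n', a, b) then
    [&& meq (mscale a Y) (mscale b (nth [::] Xs n')), (n < n' < 31)%N, lunitc a,
        deq (nth [::] Knodes n') (dmul (Kc i) Kn) &
        deq (LKnode n') (dmul (Lc i) (LKnode n))]
  else mzero Y].
Definition check_ad (sg : bool) : bool :=
  let Xs := families sg in
  all (fun n => all (ad_ok sg Xs n) (rng 1 3)) (rng 0 31).
Definition check_adnext : bool :=
  all (fun n => let: (i, p) := nth (0, 0)%N parents n.-1 in
     [&& (0 < i < 4)%N, (p < n)%N &
     if adnext p i is Some (n', a, b) then (n' == n) && lunitc b else false])
    (rng 1 30).

Definition d3e : lexp := LQi3 1.
Definition zlin (e : Z) : zpol := [:: l1; lopp (lq e)].
Definition zP (n : nat) : zexpr := ZB (ZC (LC 1)) (ZM (ZC (LP n)) ZX).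
Definition zN (n : nat) : zexpr := ZB (ZC (LC 1)) (ZM (ZC (LN n)) ZX).
Definition z1 : zexpr := ZC (LC 1).
Fixpoint Lpow (a : lexp) (n : nat) : lexp :=
  match n with 0 => LC 1 | 1 => a | S n' => LM a (Lpow a n') end.
Fixpoint zpow (n : nat) : zexpr :=
  match n with 0 => z1 | 1 => ZX | S n' => ZM ZX (zpow n') end.
(* The entries of f_1 and f_0, times [3]^i *)
Definition alphae (s : bool) : lexp :=
  let p n := if s then LP n else LN n in let m n := if s then LN n else LP n in
  LM (LB (LA (LB (p 5) (p 1)) (LM (LC 2) (m 7))) (m 9)) (LQn 3 1).
Definition betae : lexp := LM (LM (Lpow (LQi2 1) 3) (LQn 2 2)) (LQn 4 1).
Definition gammae : lexp :=
  LM (LM (LM (LQi2 1) (LQi3 2)) (LQn 2 1)) (Lpow (LQn 3 1) 2).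
Definition mue : lexp := LM (LM (Lpow (LQi2 1) 3) (LQn 3 1)) (LQn 4 1).
Definition nue : lexp := LB (LA (LQn 2 7) (LQn 2 3)) (LQn 2 1).
Definition zetae : lexp := LM (LQn 4 1) (LQi3 2).
Definition xie : lexp :=
  LM (LM (LQn 2 2) (LQn 3 2)) (LA (LB (LB (LQn 2 8) (LQn 2 6)) (LQn 2 4)) (LQn 3 1)).
Definition etae : lexp := LM (Lpow (LQi2 1) 5) (LQn 4 1).
Definition rhoe : lexp := LM (LM (LM (LQi2 1) (Lpow (LQn 3 1) 2)) (LQn 3 3)) (LQn 4 1).
Definition zt (l : lexp) (n : nat) : zexpr := ZM (ZC l) (zpow n).
Definition f1e : seq (seq zexpr) :=
  let d := d3e in let zz := ZM ZX (ZB z1 ZX) in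
  let s := ZM (ZM (ZC mue) ZX) (ZA (ZC (LP 3)) (zt (LN 3) 1)) in
  let t := ZM (ZB z1 ZX)
    (ZA (ZB (ZC (LM d (LP 3))) (zt nue 1)) (zt (LM d (LN 3)) 2)) in
  let c := ZM (ZC gammae) zz in let r := ZM (ZC betae) zz in
  [:: [:: ZA (ZB (ZA (ZC (LO (LM d (LN 3)))) (zt (alphae true) 1))
                 (zt (alphae false) 2)) (zt (LM d (LP 3)) 3); r; r];
      [:: c; s; t]; [:: c; t; s]].
Definition f0e : seq (seq zexpr) :=
  let d := d3e in let zz := ZM ZX (ZB z1 (zpow 2)) in
  [:: [:: ZA (ZB (ZA (ZB (ZC (LM d (LN 6))) (zt (LM (LN 3) zetae) 1)) (zt xie 2))
                 (zt (LM (LP 3) zetae) 3)) (zt (LM d (LP 6)) 4);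
          ZM (ZC etae) zz];
      [:: ZM (ZC rhoe) zz;
          ZA (ZB (ZA (ZB (ZC (LM d (LP 6))) (zt (LM (LP 3) zetae) 1)) (zt xie 2))
                 (zt (LM (LN 3) zetae) 3)) (zt (LM d (LN 6)) 4)]].
(* The coefficients of R(z) on the singular vectors, times [rdene] *)
Definition rdene : zexpr := ZM (ZC d3e) (ZM (zN 4) (ZM (zN 6) (ZM (zP 6) (zP 8)))).
Definition rnume (i j : nat) : zexpr :=
  if (i == j) && (i == 0)%N then rdene
  else if (i == j) && (i == 1)%N then
    ZO (ZM (ZC (LM (LP 8) d3e)) (ZM (zN 8) (ZM (zN 4) (ZM (zN 6) (zP 6)))))
  else if (i == j) && (i == 2)%N then
    ZM (ZC (LM (LP 14) d3e)) (ZM (ZM (zN 6) (zN 8)) (ZM (zN 4) (zN 6)))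
  else if (3 <= i < 6)%N && (3 <= j < 6)%N then
    ZM (ZC (LP 5)) (ZM (zN 6) (nth z1 (nth [::] f1e (i - 3)) (j - 3)))
  else if (6 <= i < 8)%N && (6 <= j < 8)%N then
    ZM (ZC (LP 2)) (nth z1 (nth [::] f0e (i - 6)) (j - 6))
  else ZC (LC 0).
Definition rden : zpol := Eval vm_compute in zcomp rdene.
Definition rnums : seq (seq zpol) := Eval vm_compute in
  [seq [seq zcomp (rnume i j) | j <- rng 0 8] | i <- rng 0 8].
Definition rn (i j : nat) : zpol := nth [::] (nth [::] rnums i) j.
(* z^4 p(1/z) for p of degree at most 4 *)
Definition zrev4 (p : zpol) : zpol := [seq nth [::] p (4 - i) | i <- iota 0 5].
Definition check_rn : bool :=
  all (fun i => all (fun k =>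
    [&& zeq (zscale (gramc i) (rn i k)) (zscale (gramc k) (rn k i)),
        (size (rn i k) <= 5)%N &
        zeq (zsum [seq zmul (rn i j) (zrev4 (rn j k)) | j <- rng 0 8])
            (if i == k then zmul rden (zrev4 rden) else [::])])
    (rng 0 8)) (rng 0 8) && (size rden <= 5)%N.

Definition actA (XA : seq smat) (n : nat) (x : smat) : smat :=
  cscale (nth [::] Knodes n) (mmul (nth [::] XA n) x).
Definition actB (XB : seq smat) (n : nat) (x : smat) : smat :=
  mmul (rscale (LKnode n) x) (mtr (nth [::] XB n)).
Definition ptable (act : smat -> smat) : seq (seq lpol) :=
  let gs := [seq gx (act (sc k)) | k <- rng 0 8] in
  [seq [seq mdot (sc j) y | y <- gs] | j <- rng 0 8].
Definition pt (T : seq (seq lpol)) (j k : nat) : lpol := nth [::] (nth [::] T j) k.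
(** The equality of the pairings of s_j with R X_n s_k and with X_n R s_k, without denominators. On
    the left the norms from [pair_comm] are absorbed by the self-adjointness of R, which transposes
    its matrix to [rn i j]. *)
Definition tests_ok (TA TB : seq (seq lpol)) (j k : nat) : bool :=
  zeq (zsum [seq zmul (rn i j) [:: pt TB i k; pt TA i k] | i <- rng 0 8])
      (zsum [seq zmul (rn i k) [:: pt TA j i; pt TB j i] | i <- rng 0 8]).
Definition check_tests : bool :=
  let XA := families true in let XB := families false in
  all (fun n => let TA := ptable (actA XA n) in let TB := ptable (actB XB n) in
    all (fun j => all (tests_ok TA TB j) (rng 0 8)) (rng 0 8)) (rng 0 31).

(* The pairing of s_j with the image of s_k under the n-th node at (1, z) *)
Definition pair1 (n j k : nat) : zpol :=
  let XA := families true in let XB := families false in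
  [:: mdot (sc j) (gx (actA XA n (sc k))); mdot (sc j) (gx (actB XB n (sc k)))].

Definition zunit (u : lpol) (e : Z) (p : zpol) : bool :=
  lunitc u && zeq p (zscale u (zlin e)).

(** * Finite identities, by computation *)

Lemma check_cycloT : check_cyclo. Proof. by vm_compute. Qed.
Lemma check_weightsT : check_weights. Proof. by vm_compute. Qed.
Lemma check_heightsT : check_heights. Proof. by vm_compute. Qed.
Lemma check_KT : check_K. Proof. by vm_compute. Qed.
Lemma check_EFT : check_EF. Proof. by vm_compute. Qed.
Lemma check_gT : check_g. Proof. by vm_compute. Qed.
Lemma check_ginvT : check_ginv. Proof. by vm_compute. Qed.
Lemma check_singT : check_sing. Proof. by vm_compute. Qed.
Lemma check_certT : check_cert. Proof. by vm_compute. Qed.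
Lemma check_rulesT : check_rules. Proof. by vm_compute. Qed.
Lemma check_adnextT : check_adnext. Proof. by vm_compute. Qed.
Lemma check_adAT : check_ad true. Proof. by vm_compute. Qed.
Lemma check_adBT : check_ad false. Proof. by vm_compute. Qed.
Lemma check_rnT : check_rn. Proof. by vm_compute. Qed.
Lemma check_testsT : check_tests. Proof. by vm_compute. Qed.
(** In this and the following pairings the node has the difference of the weights of s_j and s_k:
    the nodes 19, 20, 27, 29, 30 have the weights of v_14, v_13, v_2, v_8, v_1. The linear factors
    found, 1 - q^e z for e = 8, 6, -4, -6, are those of the denominator of R(z). *)
Lemma check_pair_01 : let p := pair1 19 0 1 in zunit (head [::] p) 8 p.
Proof. by vm_compute. Qed.
Lemma check_pair_12 : let p := pair1 20 1 2 in zunit (head [::] p) 6 p.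
Proof. by vm_compute. Qed.
(** The determinant with rows a, b, c and columns 3, 4, 5 has no constant term; after division by z
    it is a unit times 1 - q^e z. *)
Definition det_unit (a b c : nat -> zpol) (e : Z) : bool :=
  let minor i j := zadd (zmul (b i) (c j)) (zopp (zmul (b j) (c i))) in
  let det := zadd (zadd (zmul (a 3%N) (minor 4%N 5%N)) (zmul (a 4%N) (minor 5%N 3%N)))
                  (zmul (a 5%N) (minor 3%N 4%N)) in
  if det is d0 :: det' then nilp d0 && zunit (head [::] det') e det' else false.
Lemma check_pair_det : det_unit (pair1 30 0) (pair1 29 1) (pair1 27 2) (-4).
Proof. by vm_compute. Qed.
Lemma check_pair_36 : let p := pair1 30 3 6 in zunit (head [::] p) (-6) p.
Proof. by vm_compute. Qed.
Lemma check_pair_37 : zzero (pair1 30 3 7).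
Proof. by vm_compute. Qed.
Lemma check_pair_47 : let p := pair1 30 4 7 in lunitc (head [::] p) && zeq p [:: head [::] p].
Proof. by vm_compute. Qed.
#[local] Opaque pair1.

(** * Passage to the field, for q = h^2 not a root of unity *)

Section FieldLevel.
Context (C : fieldType) (h : C).
Hypothesis h0 : h != 0.
Local Notation q := (h ^+ 2).
Hypothesis q_not_root : forall n : nat, (0 < n)%N -> q ^+ n != 1.
Local Notation lev := (lev h).
Local Notation mev := (mev h).
Local Notation dev := (dev h).
Local Notation zexpD := (zexpD h0).
Local Notation lev_mul := (lev_mul h0).
Local Notation lunit_neq0 := (lunit_neq0 h0).
Local Notation mev_scale := (mev_scale h0).
Local Notation mev_opp := (mev_opp h0).
Local Notation mev_eq := (mev_eq h0).
Local Notation mev_mul := (mev_mul h0).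
Local Notation mev_tr := (mev_tr h0).
Local Notation mev_rscale := (mev_rscale h0).
Local Notation mev_cscale := (mev_cscale h0).
Local Notation dev_mul := (dev_mul h0).
Local Notation lev_mdot := (lev_mdot h0).
Local Notation zev_scale := (zev_scale h0).
Local Notation zev_mul := (zev_mul h0).
Local Notation zev := (zev h).

Lemma q0 : q != 0. Proof. exact: expf_neq0. Qed.

Lemma zexpE (m : int) : zexp h (Z_of_int m) = h ^ m.
Proof. by rewrite /zexp Z_of_intK. Qed.

Lemma zexp2 (n : nat) : zexp h (Z_of_int (2 * n%:Z)) = q ^+ n.
Proof. by rewrite zexpE -exprM. Qed.

Lemma qzE (n : nat) : q ^+ n = h ^ (2 * n%:Z).
Proof. by rewrite -zexp2 zexpE. Qed.

Lemma qzVE (n : nat) : q ^- n = h ^ (- (2 * n%:Z)).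
Proof. by rewrite -invr_expz -qzE. Qed.

Lemma lev_lq (n : nat) : lev (lq (Z.of_nat n)) = q ^+ n.
Proof. by rewrite lev_h -zexp2; congr zexp; lia. Qed.

Lemma lev_lqN (n : nat) : lev (lq (Z.opp (Z.of_nat n))) = q ^- n.
Proof.
rewrite lev_h -zexp2 -zexpN //; congr zexp; lia.
Qed.

Lemma qpow_neq (k : nat) : (0 < k)%N -> q ^+ k - q ^- k != 0.
Proof.
move=> k0; apply: contraNneq (q_not_root (n := k + k) _); last by rewrite addn_gt0 k0.
by move/eqP; rewrite subr_eq0 exprD => /eqP {2}->; rewrite mulfV // expf_neq0 ?q0.
Qed.

Lemma qpow_neqD (k : nat) : (0 < k)%N -> q ^+ k + q ^- k != 0.
Proof.
move=> k0; apply: contraNneq (q_not_root (n := 4 * k) _); last by rewrite muln_gt0.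
move=> qk; have a0 : q ^+ k != 0 by rewrite expf_neq0 // q0.
have aa : q ^+ k * q ^+ k = -1.
  have := congr1 ( *%R (q ^+ k)) qk; rewrite mulr0 mulrDr mulfV //.
  by move=> /eqP; rewrite addr_eq0 => /eqP.
have -> : (4 * k = (k + k) + (k + k))%N by lia.
by rewrite exprD exprD aa mulrNN mulr1.
Qed.

Lemma lev_qnc m k : (0 < k)%N -> lev (qnc m k) = qn q m k.
Proof.
move=> k0; apply: (canRL (mulfK (qpow_neq k0))).
(* Multiplied by q^k - q^-k, the j-th power in the sum becomes t (j+1) - t j. *)
pose t (j : nat) := h ^ (2 * k%:Z * (2 * j%:Z - m%:Z)).
have -> : lev (qnc m k) = \sum_(0 <= j < m) h ^ (2 * k%:Z * (2 * j%:Z + 1 - m%:Z)).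
  rewrite /lev big_map /index_iota subn0; apply: eq_bigr => j _ /=.
  by rewrite mul1r zexpE.
rewrite mulr_suml; under eq_bigr => j _.
  have -> : h ^ (2 * k%:Z * (2 * j%:Z + 1 - m%:Z)) * (q ^+ k - q ^- k) =
      t j.+1 - t j.
    rewrite mulrBr qzVE qzE -!expfzDr //.
    by congr (h ^ _ - h ^ _); lia.
  over.
rewrite telescope_sumr // /t qzVE qzE.
by congr (h ^ _ - h ^ _); lia.
Qed.

Lemma lev_qic2 k : (0 < k)%N -> lev (qic2 k) = qi q 2 k.
Proof.
move=> k0; apply: (canRL (mulfK (qpow_neqD k0))).
rewrite !lev_cons lev_nil addr0; cbn [fst snd]; rewrite !zexpE (zintN C 1) mul1r mulN1r.
rewrite -qzVE -qzE muln2 -addnn exprD /= expr1; field.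
by rewrite expf_neq0 ?q0.
Qed.

Lemma lev_qic3 k : (0 < k)%N -> lev (qic3 k) = qi q 3 k.
Proof.
move=> k0; apply: (canRL (mulfK (qpow_neqD k0))).
rewrite !lev_cons lev_nil addr0; cbn [fst snd]; rewrite !zexpE (zintN C 1).
have -> : 4 * k%:Z = 2 * (2 * k)%N%:Z by lia.
rewrite -qzVE -qzE /zexp expr0z.
have -> : (k * 3 = k + k + k)%N by lia.
have -> : (2 * k = k + k)%N by lia.
rewrite !exprD /=; field.
by rewrite expf_neq0 ?q0.
Qed.

Lemma ixE (a : nat) (i : 'I_32) : (0 < a <= 32)%N -> (i == ix a) = (i.+1 == a).
Proof.
by case: a => // a /= a32; rewrite -val_eqE /= inordK ?eqSS.
Qed.

Definition in_range (t : nat * lpol * nat) : bool :=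
  (0 < t.1.1 <= 32)%N && (0 < t.2 <= 32)%N.

Lemma Ftab_range i : all in_range (Ftabc i).
Proof. by do 4?case: i => [|i]. Qed.

Lemma FtabE i : Ftab q i = [seq (t.1.1, lev t.1.2, t.2) | t <- Ftabc i].
Proof.
do 4?case: i => [|i] //=; by rewrite ?lev_qnc // ?lev_l1.
Qed.

Lemma FposE i (a c : 'I_32) :
  Fpos q i a c = lev (flook (Ftabc i) a.+1 c.+1).
Proof.
rewrite /Fpos FtabE big_map summxE /flook lev_sum big_map big_filter [RHS]big_mkcond.
apply: eq_big_seq => t /(allP (Ftab_range i)) /andP [t1 t2] /=.
rewrite !mxE !ixE //.
by case: ifP => _; rewrite ?mulr1 ?mulr0.
Qed.

Lemma FposE' i a c : (0 < a <= 32)%N -> (0 < c <= 32)%N ->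
  Fpos q i (ix a) (ix c) = lev (flook (Ftabc i) a c).
Proof.
by case: a c => [|a] [|c] //= a32 c32; rewrite FposE /ix /= !inordK.
Qed.

Lemma zint_lsg (b : bool) : zint C (lsg b) = (-1) ^+ b.
Proof. by case: b; rewrite /= ?(zintN C 1) ?expr0 ?expr1. Qed.

Lemma lev_lsgn (b : bool) : lev (lsgn b) = (-1) ^+ b.
Proof. by rewrite lev_cons lev_nil addr0 /= zint_lsg mulr1. Qed.

Lemma EcoefE i k j : (0 < k <= 32)%N -> (0 < j <= 32)%N ->
  Ecoef q i k j = lev (Ecoefc i k j).
Proof.
move=> k32 j32; rewrite /Ecoef /Ecoefc /bar.
case: ifP => [/andP [j14 k14]|_]; first by rewrite FposE' //; lia.
case: ifP => [/andP [jr kr]|_]; first by rewrite lev_mul lev_lsgn FposE' //; lia.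
case: ifP => [/andP [jr kr]|_].
  by rewrite FposE' //; move: kr; rewrite !inE; lia.
case: ifP => [/andP [jr kr]|_]; last by rewrite lev_nil.
by rewrite lev_mul lev_lsgn FposE' //; move: kr; rewrite !inE; lia.
Qed.

Lemma mev_munit a c : (0 < a <= 32)%N -> (0 < c <= 32)%N ->
  mev (munit a c) = delta_mx (ix a) (ix c).
Proof.
case: a c => [|a] [|c] //= a32 c32; rewrite mev_build; apply/matrixP => i j.
by rewrite !mxE !ixE // !eqSS (fun_if lev) lev_l1 lev_nil; case: ifP.
Qed.

Lemma mev_sub A B : mev (msub A B) = mev A - mev B.
Proof. by rewrite mev_add mev_opp. Qed.

Lemma mev_sum (s : seq smat) : mev (msum s) = \sum_(A <- s) mev A.
Proof.
elim: s => [|A s IH] /=; last by rewrite mev_add IH big_cons.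
rewrite big_nil; apply/matrixP => i j.
by rewrite !mxE /mcoef nth_nil scoef_nil.
Qed.

Lemma tablesE i : (i < 4)%N -> Ec i = Ec_expr i /\ Fc i = Fc_expr i.
Proof. by do 4?case: i => [|i] //; split; vm_compute. Qed.

Lemma mev_Ec i : (0 < i < 4)%N -> mev (Ec i) = Epos q i.
Proof.
case: i => // i i4; have [-> _] := tablesE i4.
by rewrite mev_build; apply/matrixP => a c; rewrite !mxE EcoefE //= ltn_ord.
Qed.

Lemma mev_Fc i : (0 < i < 4)%N -> mev (Fc i) = Fpos q i.
Proof.
case: i => // i i4; have [_ ->] := tablesE i4.
by rewrite mev_build; apply/matrixP => a c; rewrite !mxE FposE.
Qed.

#[local] Arguments Z.mul : simpl never.
Lemma cyclo_neq0 d : d \in cyclo -> lev d != 0.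
Proof.
have H (ds : seq lpol) ns : all (Z.ltb 0) ns ->
    all2 (fun d n => let p := [:: (0, -1); (2 * n, 1)]%ZZ in
      if ldiv 1000 (2 * n) p d is Some c then leq (lmul c d) p else false) ds ns ->
    forall d, d \in ds -> lev d != 0.
  elim: ds ns => [|e ds IH] [|n ns] //= /andP [n0 ns0] /andP [eP dsP] d'.
  rewrite inE => /orP [/eqP ->|/(IH _ ns0 dsP) //].
  case: ldiv eP => // c /(@lev_eq C h); rewrite lev_mul !lev_cons lev_nil addr0 /=.
  have -> : (2 * n)%ZZ = Z_of_int (2 * (Z.to_nat n)%:Z) by lia.
  rewrite zexp2 (zintN C 1) mulN1r !mul1r => cE.
  apply: contraTneq (q_not_root (n := Z.to_nat n) _) => [e0|]; last by lia.
  by rewrite e0 mulr0 in cE; rewrite -subr_eq0 addrC -cE eqxx.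
exact: (H _ cyclo_orders isT check_cycloT).
Qed.

Lemma lunitc_neq0 p : lunitc p -> lev p != 0.
Proof. exact: lunit_neq0 cyclo_neq0 _ _. Qed.

Lemma d3_neq0 : qi q 3 1 != 0.
Proof. by rewrite -lev_qic3 // lunitc_neq0. Qed.

Fixpoint lsem (l : lexp) : C :=
  match l with
  | LQn m k => qn q m k
  | LQi2 k => qi q 2 k
  | LQi3 k => qi q 3 k
  | LP n => q ^+ n
  | LN n => q ^- n
  | LC c => zint C c
  | LM a b => lsem a * lsem b
  | LA a b => lsem a + lsem b
  | LB a b => lsem a - lsem b
  | LO a => - lsem a
  end.

Lemma lcompE l : lwf l -> lev (lcomp l) = lsem l.
Proof.
elim: l => [m k|k|k|n|n|c|a IHa b IHb|a IHa b IHb|a IHa b IHb|a IHa].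
- exact: lev_qnc.
- exact: lev_qic2.
- exact: lev_qic3.
- by rewrite /= lev_lq.
- by rewrite /= lev_lqN.
- rewrite /=; case: Z.eqb_spec => [->|_ _]; first by rewrite lev_nil.
  by rewrite lev_cons lev_nil addr0 mulr1.
- by move=> /andP [/IHa + /IHb]; rewrite /= lev_mul => -> ->.
- by move=> /andP [/IHa + /IHb]; rewrite /= lev_add => -> ->.
- by move=> /andP [/IHa + /IHb]; rewrite /= lev_add lev_opp => -> ->.
- by move=> /IHa; rewrite /= lev_opp => ->.
Qed.

Fixpoint msem (V : lmodType C) (u : nat -> nat -> V) (m : mexp) : V :=
  match m with
  | MU a c => u a c
  | MS l a => lsem l *: msem u a
  | MA a b => msem u a + msem u b
  | MB a b => msem u a - msem u b
  | MO a => - msem u a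
  end.

Lemma mcompE m : mwf m -> mev (mcomp m) = msem (@e C) m.
Proof.
elim: m => [a c|l a IHa|a IHa b IHb|a IHa b IHb|a IHa].
- by move=> /andP [a32 c32]; exact: mev_munit.
- by move=> /andP [/lcompE + /IHa]; rewrite /= mev_scale => -> ->.
- by move=> /andP [/IHa + /IHb]; rewrite /= mev_add => -> ->.
- by move=> /andP [/IHa + /IHb]; rewrite /= mev_sub => -> ->.
- by move=> /IHa; rewrite /= mev_opp => ->.
Qed.

Fixpoint zsem (z : C) (p : zexpr) : C :=
  match p with
  | ZC l => lsem l
  | ZX => z
  | ZM a b => zsem z a * zsem z b
  | ZA a b => zsem z a + zsem z b
  | ZB a b => zsem z a - zsem z b
  | ZO a => - zsem z a
  end.

Lemma zcompE z p : zwf p -> zev z (zcomp p) = zsem z p.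
Proof.
elim: p => [l||a IHa b IHb|a IHa b IHb|a IHa b IHb|a IHa].
- by move=> /lcompE; rewrite /= mulr0 addr0.
- by rewrite /= lev_nil lev_l1 mulr0 addr0 mulr1 add0r.
- by move=> /andP [/IHa + /IHb]; rewrite /= zev_mul => -> ->.
- by move=> /andP [/IHa + /IHb]; rewrite /= zev_add => -> ->.
- by move=> /andP [/IHa + /IHb]; rewrite /= zev_add zev_opp => -> ->.
- by move=> /IHa; rewrite /= zev_opp => ->.
Qed.

Lemma sum8_15 (V : zmodType) (f : nat -> V) :
  \sum_(8 <= i < 15) f i = f 8 + (f 9 + (f 10 + (f 11 + (f 12 + (f 13 + f 14))))).
Proof. by rewrite unlock /= addr0. Qed.

Lemma mev_Fc0 : mev (Fc 0) = qi q 3 1 *: F0 q.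
Proof.
have -> : Fc 0 = mcomp F0e by vm_compute.
rewrite mcompE //; cbn [msem lsem F0e]; rewrite /F0 sum8_15.
have dK (a : C) : qi q 3 1 * (a / qi q 3 1) = a by rewrite mulrC divfK ?d3_neq0.
by rewrite !(scalerDr, scalerBr, scalerN) !scalerA !dK expr2.
Qed.

Lemma mev_Ec0 : mev (Ec 0) = qi q 3 1 *: E0 q.
Proof.
have -> : Ec 0 = mcomp E0e by vm_compute.
rewrite mcompE //; cbn [msem lsem E0e]; rewrite /E0 sum8_15.
have dK (a : C) : qi q 3 1 * (a / qi q 3 1) = a by rewrite mulrC divfK ?d3_neq0.
by rewrite !(scalerDr, scalerBr, scalerN) !scalerA !dK expr2.
Qed.

(** * Relations of the coproducts and the form on T *)

Lemma all_iota (P : nat -> bool) a n i : all P (rng a n) -> (a <= i < a + n)%N -> P i.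
Proof. by move=> /allP H ir; apply: H; rewrite mem_iota. Qed.

Lemma qcommP t D X : qcomm t D X ->
  dev D *m mev X = (zint C t.2 * zexp h t.1) *: (mev X *m dev D).
Proof.
move=> /mev_eq; rewrite mev_rscale mev_scale mev_cscale => ->.
by rewrite lev_cons lev_nil addr0.
Qed.

Lemma deqP d d' : deq d d' -> d = d'.
Proof.
elim: d d' => [|[e c] d IH] [|[e' c'] d'] //= /andP [/andP [/Z.eqb_spec -> /Z.eqb_spec ->]].
by move=> /IH ->.
Qed.

Lemma devC d d' : dev d *m dev d' = dev d' *m dev d.
Proof. exact: diag_mxC. Qed.

Lemma dev_tr d : (dev d)^T = dev d.
Proof. exact: tr_diag_mx. Qed.

Lemma Kc_prop i : (i < 4)%N -> size (Kc i) = 32%N /\ all (fun t => Z.eqb t.2 1) (Kc i).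
Proof.
move=> i4; have := check_KT; rewrite /check_K => /andP [H _].
by have /andP [/eqP -> ->] := all_iota H (i4 : 0 <= i < 0 + 4)%N.
Qed.

Lemma dev_inv i : (i < 4)%N -> dev (Kc i) *m dev (dinv (Kc i)) = 1%:M.
Proof.
move=> /Kc_prop [sK /allP cK]; rewrite mulmx_diag -diag_const_mx.
congr diag_mx; apply/rowP => j; rewrite !mxE /dev_.
have js : (j < size (Kc i))%N by rewrite sK.
rewrite (nth_map (0, 0)%ZZ) //=.
have /Z.eqb_spec -> := cK _ (mem_nth (0, 0)%ZZ js).
by rewrite !mul1r zexpN mulfV // expfz_neq0.
Qed.

Lemma zexp_neq0 e : zexp h e != 0. Proof. exact: expfz_neq0. Qed.

Lemma Bc_sym i j : (i < 4)%N -> (j < 4)%N -> Bc i j = Bc j i.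
Proof. by do 4?case: i => [|i] //; do 4?case: j => [|j]. Qed.

Lemma weightsP i j : (i < 4)%N -> (j < 4)%N ->
  let s := (-1) ^+ (sgen i && sgen j) in let b := zexp h (Bc i j) in
  [/\ dev (Kc j) *m mev (Ec i) = b *: (mev (Ec i) *m dev (Kc j)),
      dev (Kc j) *m mev (Fc i) = b^-1 *: (mev (Fc i) *m dev (Kc j)),
      dev (Lc j) *m mev (Ec i) = (s * b^-1) *: (mev (Ec i) *m dev (Lc j))
    & dev (Lc j) *m mev (Fc i) = (s * b) *: (mev (Fc i) *m dev (Lc j))].
Proof.
move=> i4 j4 s b; have H := all_iota check_weightsT (i4 : 0 <= i < 0 + 4)%N.
have {H} /andP [/all_iota /(_ (j4 : 0 <= j < 0 + 4)%N) /and4P [h1 h2 h3 h4] _] := H.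
have z1 : zint C 1 = 1 by [].
split.
- by rewrite (qcommP h1) z1 mul1r Bc_sym.
- by rewrite (qcommP h2) z1 mul1r Bc_sym // -zexpN.
- by rewrite (qcommP h3) zint_lsg Bc_sym // -zexpN.
- by rewrite (qcommP h4) zint_lsg Bc_sym.
Qed.

Lemma dev_dinv_dbl d : dev (dinv (dmul d d)) = dev (dinv d) *m dev (dinv d).
Proof.
rewrite -dev_mul; congr dev; elim: d => [|[e c] d IH] //=.
by rewrite IH Z.opp_add_distr.
Qed.

Lemma Lc2 i : (i < 4)%N ->
  dev (Lc i) *m dev (Lc i) = dev (dinv (Kc i)) *m dev (dinv (Kc i)).
Proof.
move=> i4; have /andP [_ /deqP H] := all_iota check_weightsT (i4 : 0 <= i < 0 + 4)%N.
by rewrite -dev_mul H dev_dinv_dbl.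
Qed.

Lemma mev_mdiag d : mev (mdiag d) = dev d.
Proof.
rewrite mev_build; apply/matrixP => a c; rewrite !mxE.
case: (eqVneq a c) => [->|ac]; first by rewrite eqxx mulr1n lev_cons lev_nil addr0.
by rewrite mulr0n; case: eqP => [/val_inj /eqP|_]; rewrite ?(negPf ac) ?lev_nil.
Qed.

(* q_i - q_i^-1 *)
Definition qdif (i : nat) : C :=
  zexp h (Z_of_int (2 * dgen i)) - (zexp h (Z_of_int (2 * dgen i)))^-1.

Lemma mev_supercomm A B b :
  mev (msub (mmul A B) (mscale [:: (0%ZZ, lsg b)] (mmul B A))) =
  mev A *m mev B - (-1) ^+ b *: (mev B *m mev A).
Proof. by rewrite mev_sub mev_scale !mev_mul -(lev_lsgn b). Qed.

Lemma mev_EF_rel p A B b M1 M2 X1 X2 : mev M1 = X1 -> mev M2 = X2 ->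
  meq (mscale p (msub (mmul A B) (mscale [:: (0%ZZ, lsg b)] (mmul B A))))
    (msub M1 M2) ->
  lev p *: (mev A *m mev B - (-1) ^+ b *: (mev B *m mev A)) = X1 - X2.
Proof.
by move=> <- <- /mev_eq E; rewrite -mev_supercomm -mev_scale E mev_sub.
Qed.

Lemma mev_mdiag_dbl d : mev (mdiag (dbl d)) = dev d *m dev d.
Proof. exact: etrans (mev_mdiag _) (dev_mul _ _). Qed.

Lemma mev_mdiag_dinv d :
  mev (mdiag (dinv (dbl d))) = dev (dinv d) *m dev (dinv d).
Proof. exact: etrans (mev_mdiag _) (dev_dinv_dbl _). Qed.

Lemma lev_qdif x : lev (ladd (lq x) (lopp (lq (Z.opp x)))) =
  zexp h (2 * x) - (zexp h (2 * x))^-1.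
Proof. by rewrite lev_add lev_opp !lev_h Z.mul_opp_r zexpN. Qed.

Lemma mev_adjoint A B D b :
  meq (mmul A B) (mscale [:: (0%ZZ, lsg b)] (mmul (mtr D) A)) ->
  mev A *m mev B = (-1) ^+ b *: ((mev D)^T *m mev A).
Proof. by move=> /mev_eq; rewrite mev_scale !mev_mul mev_tr -(lev_lsgn b). Qed.

Lemma mev_diag_inv A B f : meq (mmul A B) (mbuild (fun a c => if a == c then f a else [::])) ->
  (forall a : nat, (a < 32)%N -> lev (f a) != 0) -> mev A \in unitmx.
Proof.
move=> /mev_eq; rewrite mev_mul mev_build => AB f0.
suff : mev A *m mev B \in unitmx by rewrite unitmx_mul => /andP [].
have -> : mev A *m mev B = diag_mx (\row_(a < 32) lev (f a)).
  rewrite AB; apply/matrixP => a c; rewrite !mxE.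
  case: (eqVneq a c) => [->|ac]; first by rewrite eqxx mulr1n.
  by rewrite mulr0n; case: eqP => [/val_inj /eqP|_]; rewrite ?(negPf ac) ?lev_nil.
by rewrite unitmxE det_diag unitfE; apply/prodf_neq0 => a _; rewrite mxE f0.
Qed.

Lemma EF_relP i j : (i < 4)%N -> (0 < j < 4)%N ->
  let Y := mev (Ec i) *m mev (Fc j)
           - (-1) ^+ (sgen i && sgen j) *: (mev (Fc j) *m mev (Ec i)) in
  if i == j then qdif i *: Y = dev (Kc i) *m dev (Kc i)
                               - dev (dinv (Kc i)) *m dev (dinv (Kc i))
  else Y = 0.
Proof.
move=> i4 j4 Y; have H := all_iota check_EFT (i4 : 0 <= i < 0 + 4)%N.
have {H} := all_iota H (j4 : 1 <= j < 1 + 3)%N; cbv zeta.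
case: eqP => [_|_]; last by move=> /(@mev_zero C h) <-; rewrite /Y -mev_supercomm.
move=> /(mev_EF_rel (mev_mdiag_dbl _) (mev_mdiag_dinv _)) <-.
rewrite lev_qdif /qdif; congr ((zexp h _ - (zexp h _)^-1) *: _); lia.
Qed.

Definition copE (z1 z2 : C) (i : nat) :=
  copr (mev (Ec i)) (dev (Kc i)) (dev (Lc i)) z1 z2.
Definition copF (z1 z2 : C) (i : nat) :=
  copr (mev (Fc i)) (dev (Kc i)) (dev (Lc i)) z1 z2.
Definition copK (i : nat) := dev (Kc i) *t dev (Kc i).
Definition copKv (i : nat) := dev (dinv (Kc i)) *t dev (dinv (Kc i)).
Definition formG := mev gc *t mev gc.
Definition sv (k : nat) := tvec (mev (sc k)).

Lemma sgn_sq (b : bool) : (-1) ^+ b * (-1) ^+ b = 1 :> C.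
Proof. by case: b; rewrite ?mulrNN ?mulr1. Qed.

Lemma sgn_neq0 (b : bool) : (-1) ^+ b != 0 :> C.
Proof. by case: b; rewrite ?oppr_eq0 oner_neq0. Qed.

(** The supercommutator of E_i and F_j vanishes in each leg. The general parameters serve the case i
    = 0. *)
Lemma cop_EF z1 z2 i j : (i < 4)%N -> (0 < j < 4)%N -> i != j ->
  copE z1 z2 i *m copF 1 1 j =
  (-1) ^+ (sgen i && sgen j) *: (copF 1 1 j *m copE z1 z2 i).
Proof.
move=> i4 /andP [j0 j4] ij.
have [_ KF _ LF] := weightsP j4 i4; have [KE _ LE _] := weightsP i4 j4.
rewrite /copE /copF (@copr_comm _ _ _ _ _ _ _ _ _ _ ((-1) ^+ (sgen i && sgen j))
    (zexp h (Bc i j))^-1 (zexp h (Bc i j))) //.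
- have := EF_relP i4 (_ : 0 < j < 4)%N; rewrite (negPf ij) => -> //.
    by rewrite tens0mx tensmx0 !scaler0 !addr0.
  by rewrite j0.
- exact: sgn_sq.
- by rewrite KF Bc_sym.
- by rewrite LF andbC Bc_sym.
- exact: devC.
- exact: devC.
- by rewrite mulf_neq0 ?sgn_neq0 // invr_neq0 // zexp_neq0.
- exact: zexp_neq0.
Qed.

Lemma qdif_neq0 i : (0 < i < 4)%N -> qdif i != 0.
Proof.
move=> i14; rewrite /qdif.
suff [k k0 [->|->]] : exists2 k, (0 < k)%N &
    zexp h (Z_of_int (2 * dgen i)) = q ^+ k \/ zexp h (Z_of_int (2 * dgen i)) = q ^- k.
  - exact: qpow_neq.
  - by rewrite invrK -opprB oppr_eq0 qpow_neq.
case: i i14 => [|[|[|[|]]]] // _.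
- by exists 1%N => //; right; rewrite zexpE qzVE.
- by exists 1%N => //; left; rewrite zexpE qzE.
- by exists 3%N => //; left; rewrite zexpE qzE.
Qed.

Lemma cop_EFii i : (0 < i < 4)%N ->
  copE 1 1 i *m copF 1 1 i =
  (-1) ^+ (sgen i && sgen i) *: (copF 1 1 i *m copE 1 1 i)
  + (qdif i)^-1 *: (copK i *m copK i - copKv i *m copKv i).
Proof.
move=> i14; have i4 : (i < 4)%N by lia.
have [KE KF LE LF] := weightsP i4 i4.
rewrite /copE /copF (@copr_comm _ _ _ _ _ _ _ _ _ _ ((-1) ^+ (sgen i && sgen i))
    (zexp h (Bc i i))^-1 (zexp h (Bc i i))) //.
- have := EF_relP i4 i14; rewrite eqxx.
  set Y := _ - _ => H; congr (_ + _).
  have -> : Y = (qdif i)^-1 *: (dev (Kc i) *m dev (Kc i)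
      - dev (dinv (Kc i)) *m dev (dinv (Kc i))).
    by rewrite -H scalerA mulVf ?scale1r // qdif_neq0.
  rewrite !scale1r Lc2 // /copK /copKv !tensmx_mul.
  rewrite tensmxZl tensmxZr -scalerDr; congr (_ *: _).
  by rewrite tensmxBl tensmxBr addrA subrK.
- exact: sgn_sq.
- by rewrite mulf_neq0 ?sgn_neq0 // invr_neq0 // zexp_neq0.
- exact: zexp_neq0.
Qed.

Lemma copK_F i j : (i < 4)%N -> (j < 4)%N -> forall z1 z2,
  copK i *m copF z1 z2 j = (zexp h (Bc i j))^-1 *: (copF z1 z2 j *m copK i).
Proof.
move=> i4 j4 z1 z2; have [_ KF _ _] := weightsP j4 i4.
by apply: copr_weight; [rewrite KF Bc_sym|exact: devC|exact: devC].
Qed.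

Lemma gcP : mev gc = (mev gc)^T /\ forall i, (i < 4)%N ->
  [/\ dev (Kc i) *m mev gc = mev gc *m dev (Kc i),
      dev (Lc i) *m mev gc = mev gc *m dev (Lc i)
    & mev gc *m mev (Ec i) = (-1) ^+ (i == 0%N) *: ((mev (Fc i))^T *m mev gc)].
Proof.
have := check_gT; rewrite /check_g => /andP [g1 g2]; split.
  by rewrite -mev_tr; apply: mev_eq.
move=> i i4; have /andP [/andP [h1 h2] h3] := all_iota g2 (i4 : 0 <= i < 0 + 4)%N.
split.
- by rewrite (qcommP h1) /= mulr1 scale1r.
- by rewrite (qcommP h2) /= mulr1 scale1r.
- exact: mev_adjoint h3.
Qed.

Lemma formG_E z1 z2 i : (i < 4)%N -> formG *m copE z1 z2 i =
  (-1) ^+ (i == 0%N) *: ((copF z1 z2 i)^T *m formG).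
Proof.
move=> i4; have [_ /(_ i i4) [h1 h2 h3]] := gcP.
by apply: copr_adj => //; rewrite dev_tr.
Qed.

Lemma formG_sym : formG^T = formG.
Proof. by rewrite trmx_tens -gcP.1. Qed.

Lemma formG_unit : formG \in unitmx.
Proof.
suff gu : mev gc \in unitmx by apply: tensmx_unit.
have := check_ginvT; rewrite /check_ginv => /andP [gi gd].
apply: (mev_diag_inv gi) => a a32; apply: lunitc_neq0.
exact: (all_iota gd (a32 : 0 <= a < 0 + 32)%N).
Qed.

Lemma opcE M i x :
  copr (mev M) (dev (Kc i)) (dev (Lc i)) 1 1 *m tvec (mev x) =
  tvec (mev (opc M i x)).
Proof.
rewrite mev_add mev_cscale !mev_mul mev_rscale mev_tr tvecD.
by rewrite mulmxDl !scale1r !tens_tvec dev_tr.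
Qed.

Lemma copK_tvec D e x : meq (rscale D (cscale D x)) (mscale [:: (e, 1%ZZ)] x) ->
  (dev D *t dev D) *m tvec (mev x) = zexp h e *: tvec (mev x).
Proof.
move=> /mev_eq; rewrite mev_rscale mev_cscale mev_scale lev_cons lev_nil addr0.
rewrite /= mul1r => E; rewrite tens_tvec dev_tr -tvecZ -E; congr tvec.
by rewrite mulmxA.
Qed.

Lemma form_tvec G x y : mev G = (mev G)^T -> (size x <= 32)%N ->
  (tvec (mev x))^T *m (mev G *t mev G) *m tvec (mev y) =
  (lev (mdot x (mmul (mmul G y) G)))%:M.
Proof.
move=> Gs x32; rewrite -mulmxA tens_tvec -Gs tvec_dot; congr (_%:M).
by rewrite lev_mdot // !mev_mul.
Qed.

Lemma lev_mget A (a c : nat) : lev (mget A a c) = mcoef h A a c.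
Proof.
by rewrite /mget lev_sum big_map big_filter big_mkcond.
Qed.

Lemma check_sing_k k : (k < 8)%N ->
  [/\ forall i, (0 < i < 4)%N -> mzero (opc (Ec i) i (sc k)) /\
        meq (rscale (Kc i) (cscale (Kc i) (sc k)))
          (mscale [:: (Z_of_int (dgen i * Defs.coord (sclass k) i), 1%ZZ)] (sc k)),
      forall j, (j < 8)%N -> let p := mdot (sc j) (gx (sc k)) in
        if j == k then lunitc p else nilp p
    & forall j, (j < 8)%N -> let p := mget (sc k) (skey j).1.-1 (skey j).2.-1 in
        if j == k then lunitc p else nilp p].
Proof.
move=> k8; have := check_singT; rewrite /check_sing => H.
have {H} /and3P [h1 h2 h3] := all_iota H (k8 : 0 <= k < 0 + 8)%N; split.
- by move=> i i4; have /andP := all_iota h1 (i4 : 1 <= i < 1 + 3)%N.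
- by move=> j j8; apply: (all_iota h2 (j8 : 0 <= j < 0 + 8)%N).
- by move=> j j8; apply: (all_iota h3 (j8 : 0 <= j < 0 + 8)%N).
Qed.

Lemma sv_singular k i : (k < 8)%N -> (0 < i < 4)%N -> copE 1 1 i *m sv k = 0.
Proof.
move=> k8 i4; have [/(_ i i4) [H _] _ _] := check_sing_k k8.
by rewrite [LHS]opcE (mev_zero h H) tvec0.
Qed.

Lemma sv_weight k i : (k < 8)%N -> (0 < i < 4)%N ->
  copK i *m sv k = h ^ (dgen i * Defs.coord (sclass k) i) *: sv k.
Proof.
move=> k8 i4; have [/(_ i i4) [_ H] _ _] := check_sing_k k8.
by rewrite [LHS](copK_tvec H) zexpE.
Qed.

Lemma sc_size k : (k < 8)%N -> (size (sc k) <= 32)%N.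
Proof.
move=> k8; have := check_KT; rewrite /check_K => /andP [_ H].
exact: (all_iota H (k8 : 0 <= k < 0 + 8)%N).
Qed.

Lemma sv_gram j k : (j < 8)%N -> (k < 8)%N ->
  (sv j)^T *m formG *m sv k = (if j == k then lev (gramc k) else 0)%:M.
Proof.
move=> j8 k8; rewrite [LHS](form_tvec _ gcP.1 (sc_size j8)).
have [_ /(_ j j8) + _] := check_sing_k k8.
case: eqP => [-> _ //|_ /nilP]; rewrite /gx => ->.
by rewrite lev_nil.
Qed.

Lemma gram_neq0 k : (k < 8)%N -> lev (gramc k) != 0.
Proof.
move=> k8; have [_ /(_ k k8) + _] := check_sing_k k8; rewrite eqxx => H.
exact: lunitc_neq0 H.
Qed.

(** * Determination of all singular vectors of T *)

Lemma ix_ord (c : 'I_32) : ix c.+1 = c.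
Proof. by rewrite /ix /= inord_val. Qed.

(** Each rule is a linear relation with one unknown, whose coefficient is non-zero. V is the field
    when x lists the entries of a row, and a space of row vectors when x lists rows. *)
Lemma propagateP (V : lmodType C) (x : nat -> V) rows rules known known' :
  propagate rows known rules = Some known' ->
  (forall a, a \in known -> x a = 0) ->
  (forall t, t \in rules -> (rows -> x t.1.2 = 0) ->
     \sum_(c < 32) mcoef h (Ec t.1.1) t.1.2.-1 c *: x c.+1 = 0) ->
  forall a, a \in known' -> x a = 0.
Proof.
elim: rules known => [|[[i r] c] rules IH] known /=; first by move=> [->].
case: ifP => // /andP [/andP [/andP [/andP [rk _] c32] cu] /allP Rk] prop xk H.
apply: IH prop _ _ => [a|t tr]; last by apply: H; rewrite inE tr orbT.
rewrite inE => /orP [/eqP ->|]; last exact: xk.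
have c1 : (c.-1 < 32)%N by lia.
have := H (i, r, c) (mem_head _ _); rewrite (bigD1 (Ordinal c1)) //= big1 ?addr0.
  have xr : rows -> x r = 0 by move=> rr; apply: xk; rewrite rr in rk.
  move=> /(_ xr) /eqP; rewrite scaler_eq0 -lev_mget (negPf (lunitc_neq0 cu)) /=.
  have -> : c.-1.+1 = c by lia.
  by move=> /eqP.
move=> c' c'c; have [c'k|c'k] := boolP (c'.+1 \in known).
  by rewrite xk ?scaler0.
rewrite /mcoef /scoef big_seq big1 ?scale0r // => t tR; case: eqP => // tc'.
have := Rk t tR; rewrite tc' (negPf c'k) orbF => /eqP cE.
by case/eqP: c'c; apply: val_inj => /=; rewrite -cE.
Qed.

Definition singmx (x : 'M[C]_32) := forall i, (0 < i < 4)%N ->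
  mev (Ec i) *m x *m dev (Kc i) + dev (Lc i) *m x *m (mev (Ec i))^T = 0.

Lemma dot_op (A K L R x : 'M[C]_32) : K^T = K -> L^T = L ->
  dotmx R (A *m x *m K + L *m x *m A^T) = dotmx (A^T *m R *m K + L *m R *m A) x.
Proof.
move=> Ks Ls; rewrite !dotmxE mulmxDr mxtraceD [(_ + _)^T]linearD /=.
rewrite mulmxDl mxtraceD !trmx_mul trmxK Ks Ls !mulmxA; congr (_ + _).
  by rewrite mxtrace_mulC !mulmxA.
by rewrite mxtrace_mulC !mulmxA.
Qed.

Lemma mev_opTc M i R : mev (opTc M i R) =
  (mev M)^T *m mev R *m dev (Kc i) + dev (Lc i) *m mev R *m mev M.
Proof. by rewrite mev_add mev_cscale !mev_mul mev_rscale mev_tr. Qed.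

(** The f i are explicit multipliers for the equations E_i x = 0: by transposition, the pairing of Y
    with x is the sum of the pairings of the f i with the E_i x, and it is also p times an entry of
    x. *)
Lemma cert_zero (f : nat -> smat) Y p a c x : singmx x ->
  (0 < a <= 32)%N -> (0 < c <= 32)%N -> lev p != 0 ->
  meq Y (mscale p (munit a c)) ->
  mev Y = \sum_(1 <= i < 4) mev (opTc (Ec i) i (f i)) -> x (ix a) (ix c) = 0.
Proof.
move=> xs a32 c32 p0 /mev_eq YE Ysum.
have : dotmx (mev Y) x = 0.
  rewrite Ysum dotmxE linear_sum /= mulmx_suml linear_sum /= big_seq big1 // => i.
  rewrite mem_index_iota => i4; rewrite -dotmxE mev_opTc -dot_op ?dev_tr //.
  by rewrite (xs i i4) dotmxE mulmx0 mxtrace0.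
rewrite YE mev_scale mev_munit //.
have -> : dotmx (lev p *: delta_mx (ix a) (ix c)) x = lev p * x (ix a) (ix c).
  rewrite /dotmx (bigD1 (ix a)) //= (bigD1 (ix c)) //=.
  rewrite !mxE !eqxx mulr1 !big1 ?addr0 // => [i ia|j jc].
    by rewrite big1 // => j _; rewrite !mxE (negPf ia) mulr0 mul0r.
  by rewrite !mxE (negPf jc) andbF mulr0 mul0r.
by move=> /eqP; rewrite mulf_eq0 (negPf p0) => /eqP.
Qed.

Lemma mev_msum_rng (f : nat -> smat) a n :
  mev (msum [seq f i | i <- rng a n]) = \sum_(a <= i < a + n) mev (f i).
Proof. by rewrite mev_sum big_map /index_iota addKn. Qed.

Lemma singmx_118 x : singmx x -> x (ix 1) (ix 18) = 0.
Proof.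
move=> xs; have := check_certT; rewrite /check_cert; cbv zeta.
move=> /andP [/lunitc_neq0 u0 H].
apply: (cert_zero xs _ _ u0 H) => //.
exact: (mev_msum_rng (fun i => opTc (Ec i) i (nth [::] cert118 i.-1)) 1 3).
Qed.

Lemma dev_invl i : (i < 4)%N -> dev (dinv (Kc i)) *m dev (Kc i) = 1%:M.
Proof. by move=> /dev_inv /mulmx1C. Qed.

Lemma Lc_neq0 i j : (i < 4)%N -> (j < 32)%N -> dev_ h (Lc i) j != 0.
Proof.
move=> i4 j32; have : dev (Lc i) \in unitmx.
  suff : dev (Lc i) *m (dev (Lc i) *m (dev (Kc i) *m dev (Kc i))) = 1%:M.
    by case/mulmx1_unit.
  rewrite mulmxA Lc2 // -mulmxA (mulmxA (dev (dinv (Kc i))) (dev (Kc i))).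
  by rewrite dev_invl // mul1mx dev_invl.
rewrite unitmxE det_diag unitfE => /prodf_neq0 /(_ (Ordinal j32) isT).
by rewrite mxE.
Qed.

(** In row r, the term where E_i acts on the second leg involves only the row r of x, which is 0;
    what remains is a relation among the rows. *)
Lemma row_singmx x i (r : nat) : singmx x -> (0 < i < 4)%N -> (0 < r <= 32)%N ->
  row (ix r) x = 0 -> \sum_(c < 32) mcoef h (Ec i) r.-1 c *: row (ix c.+1) x = 0.
Proof.
move=> xs i4 r32 xr; have i4' : (i < 4)%N by lia.
have rE : ix r = r.-1 :> nat by rewrite /ix /= inordK //; lia.
have := congr1 (fun M => row (ix r) M *m dev (dinv (Kc i))) (xs i i4).
rewrite /= row0 mul0mx raddfD /= row_mul.
have -> : row (ix r) (dev (Lc i) *m x *m (mev (Ec i))^T) = 0.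
  have /rowP xE : row (ix r) (x *m (mev (Ec i))^T) = 0 by rewrite row_mul xr mul0mx.
  apply/rowP => d; rewrite -mulmxA mul_diag_mx; have := xE d.
  by rewrite !mxE => ->; rewrite mulr0.
rewrite addr0 -mulmxA dev_inv // mulmx1 row_mul => E; rewrite -[RHS]E.
apply/rowP => d; rewrite summxE mxE; apply: eq_bigr => c _.
by rewrite !mxE rE ix_ord.
Qed.

Lemma mul_dev (M : 'M[C]_32) d a c : (M *m dev d) a c = M a c * dev_ h d c.
Proof. by rewrite mul_mx_diag !mxE. Qed.

Lemma dev_mul_mx (M : 'M[C]_32) d a c : (dev d *m M) a c = dev_ h d a * M a c.
Proof. by rewrite mul_diag_mx !mxE. Qed.

(** As v_a does not occur in the image of E_i, row a of the equation comes only from E_i acting on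
    the second leg. *)
Lemma entry_singmx x i (a d : nat) : singmx x -> (0 < i < 4)%N -> (0 < a <= 32)%N ->
  (0 < d <= 32)%N -> nilp (nth [::] (Ec i) a.-1) ->
  \sum_(c < 32) mcoef h (Ec i) d.-1 c *: (x (ix a) (ix c.+1) : C^o) = 0.
Proof.
move=> xs i4 a32 d32 /nilP Ea; have i4' : (i < 4)%N by lia.
have aE : ix a = a.-1 :> nat by rewrite /ix /= inordK //; lia.
have dE : ix d = d.-1 :> nat by rewrite /ix /= inordK //; lia.
have := congr1 (fun M : 'M[C]_32 => M (ix a) (ix d)) (xs i i4); rewrite /= mxE [RHS]mxE.
rewrite mul_dev -mulmxA dev_mul_mx.
have -> : (mev (Ec i) *m x) (ix a) (ix d) = 0.
  by rewrite mxE big1 // => c _; rewrite mxE /mcoef aE Ea scoef_nil mul0r.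
rewrite mul0r add0r => /eqP; rewrite mulf_eq0.
rewrite (negPf (Lc_neq0 i4' (ltn_ord _))) /= => /eqP E; rewrite -[RHS]E.
rewrite mxE; apply: eq_bigr => c _.
by rewrite !mxE dE ix_ord /GRing.scale /= mulrC.
Qed.

Lemma coversP n o : covers n o -> exists2 known, o = Some known &
  forall a, (0 < a <= n)%N -> a \in known.
Proof.
case: o => // known H; exists known => // a an.
exact: (all_iota H (_ : 1 <= a < 1 + n)%N).
Qed.

Lemma rules_range rows rules known known' :
  propagate rows known rules = Some known' ->
  forall t, t \in rules -> (0 < t.1.2 <= 32)%N.
Proof.
elim: rules known => [|[[i r] c] rules IH] known //=.
case: ifP => // /andP [/andP [/andP [/andP [_ r32] _] _] _] /IH H t.
by rewrite inE => /orP [/eqP -> //|/H].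
Qed.

Lemma rules_gen : all (fun t => (0 < t.1.1 < 4)%N) (rules_leg ++ rules_last) &&
  all (fun t => (t.1.1 == 2%N) || (t.1.1 == 3%N)) rules_first.
Proof. by vm_compute. Qed.

(* The leading component of x, along v_1, is killed by E_2 and E_3, the next ones
   are determined by it, and what is left lies in v_32 (x) V. *)
Lemma singmx_eq0 x : singmx x ->
  (forall k, (k < 8)%N -> x (ix (skey k).1) (ix (skey k).2) = 0) -> x = 0.
Proof.
move=> xs xk; have x118 := singmx_118 xs.
have := check_rulesT; rewrite /check_rules => /and4P [].
move=> /coversP [kn1 P1 C1] /coversP [kn2 P2 C2] /coversP [kn3 P3 C3].
move=> /and4P [_ E2 E3 E32].
have /andP [/allP Rg /allP Rf] := rules_gen.
have row1 c : (0 < c <= 32)%N -> x (ix 1) (ix c) = 0.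
  move=> c32; apply: (propagateP (x := fun c => x (ix 1) (ix c) : C^o) P2).
  - move=> a; rewrite !inE => /or4P [/eqP ->|/eqP ->|/eqP ->|].
    + exact: (xk 0%N).
    + exact: (xk 1%N).
    + exact: (xk 2%N).
    case/or4P => [/eqP ->|/eqP ->|/eqP ->|/eqP -> //].
    + exact: (xk 3%N).
    + exact: (xk 6%N).
    + exact: (xk 4%N).
  - move=> t tr _; have t4 := rules_range P2 tr.
    by apply: entry_singmx => //; case/orP: (Rf t tr) => /eqP ->.
  - exact: C2.
have rows a : (0 < a <= 31)%N -> row (ix a) x = 0.
  move=> a31; apply: (propagateP (x := fun a => row (ix a) x) P1).
  - move=> b; rewrite inE => /eqP ->; apply/rowP => c.
    by rewrite !mxE -(ix_ord c) row1 //= ltn_ord.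
  - move=> t tr /(_ isT) xt; apply: row_singmx => //.
      by apply: Rg; rewrite mem_cat tr.
    exact: rules_range P1 t tr.
  - exact: C1.
have row32 c : (0 < c <= 32)%N -> x (ix 32) (ix c) = 0.
  move=> c32; apply: (propagateP (x := fun c => x (ix 32) (ix c) : C^o) P3).
  - move=> a; rewrite !inE => /orP [/eqP ->|/eqP ->].
    + exact: (xk 5%N).
    + exact: (xk 7%N).
  - move=> t tr _; have t4 := rules_range P3 tr.
    have t3 : (0 < t.1.1 < 4)%N by apply: Rg; rewrite mem_cat tr orbT.
    by apply: entry_singmx => //; apply: (all_iota E32).
  - exact: C3.
apply/matrixP => a c; rewrite [RHS]mxE -(ix_ord a) -(ix_ord c).
have [a31|a31] := leqP a.+1 31.
  have /rowP /(_ (ix c.+1)) : row (ix a.+1) x = 0 by apply: rows; rewrite a31.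
  by rewrite !mxE.
have -> : a.+1 = 32%N by have := ltn_ord a; lia.
by rewrite row32 //= ltn_ord.
Qed.

Definition keycoef (k : nat) : C := mev (sc k) (ix (skey k).1) (ix (skey k).2).

Lemma key_range k : (k < 8)%N ->
  [/\ (0 < (skey k).1 <= 32)%N & (0 < (skey k).2 <= 32)%N].
Proof. by do 8?case: k => [|k]. Qed.

Lemma keycoefE j k : (j < 8)%N -> (k < 8)%N ->
  (j != k -> mev (sc k) (ix (skey j).1) (ix (skey j).2) = 0) /\ keycoef k != 0.
Proof.
move=> j8 k8.
have cE i : (i < 8)%N -> mev (sc k) (ix (skey i).1) (ix (skey i).2) =
    lev (mget (sc k) (skey i).1.-1 (skey i).2.-1).
  move=> /key_range [i1 i2]; rewrite lev_mget mxE /ix /= !inordK //; lia.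
have [_ _ H] := check_sing_k k8; split=> [jk|].
  by have := H j j8; rewrite (negPf jk) cE // => /nilP ->; rewrite lev_nil.
by have := H k k8; rewrite eqxx /keycoef cE // => /lunitc_neq0.
Qed.

Lemma singular_span (y : 'cV[C]_(32 * 32)) :
  (forall i, (0 < i < 4)%N -> copE 1 1 i *m y = 0) ->
  exists b : 'I_8 -> C, y = \sum_k b k *: sv k.
Proof.
move=> ys; pose x : 'M[C]_32 := untvec y.
pose b (k : 'I_8) := x (ix (skey k).1) (ix (skey k).2) / keycoef k.
have copE_tvec u i : copE 1 1 i *m tvec u =
    tvec (mev (Ec i) *m u *m dev (Kc i) + dev (Lc i) *m u *m (mev (Ec i))^T).
  by rewrite /copE /copr mulmxDl !scale1r !tens_tvec dev_tr tvecD.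
have svs (k : 'I_8) i : (0 < i < 4)%N -> mev (Ec i) *m mev (sc k) *m dev (Kc i)
    + dev (Lc i) *m mev (sc k) *m (mev (Ec i))^T = 0.
  move=> i4; have := sv_singular (ltn_ord k) i4; rewrite copE_tvec => /(congr1 (@untvec C 32 32)).
  by rewrite tvecK => ->; rewrite -tvec0 tvecK.
exists b; rewrite -[LHS]untvecK -/x; suff -> : x = \sum_k b k *: mev (sc k).
  by rewrite tvec_sum; apply: eq_bigr => k _; rewrite tvecZ.
apply/eqP; rewrite -subr_eq0; apply/eqP; apply: singmx_eq0.
  move=> i i4; rewrite !mulmxBr !mulmxBl addrACA -opprD.
  have -> : mev (Ec i) *m x *m dev (Kc i) + dev (Lc i) *m x *m (mev (Ec i))^T = 0.
    have := ys i i4; rewrite -[y]untvecK copE_tvec => /(congr1 (@untvec C 32 32)).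
    by rewrite tvecK => ->; rewrite -tvec0 tvecK.
  rewrite sub0r mulmx_sumr mulmx_suml mulmx_sumr mulmx_suml -big_split /=.
  rewrite big1 ?oppr0 // => k _.
  by rewrite -!(scalemxAr, scalemxAl) -scalerDr svs // scaler0.
move=> j j8; rewrite [LHS]mxE [X in _ + X]mxE summxE (bigD1 (Ordinal j8)) //=.
rewrite big1 ?addr0.
  by rewrite [X in _ - X]mxE -/(keycoef j) divfK ?subrr ?(keycoefE j8 j8).2.
move=> k kj; rewrite mxE (keycoefE j8 (ltn_ord k)).1 ?mulr0 //.
by rewrite eq_sym.
Qed.

(** * T as a module with triangular structure *)

Definition EE (i : 'I_3) := copE 1 1 i.+1.
Definition FF (i : 'I_3) := copF 1 1 i.+1.
Definition KK (i : 'I_3) := copK i.+1.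
Definition KV (i : 'I_3) := copKv i.+1.
Definition ss (k : 'I_8) := sv k.
Definition cls (k : 'I_8) : weight := sclass k.
Definition chi (i : 'I_3) (t : weight) : C := h ^ (dgen i.+1 * Defs.coord t i.+1).
Definition gam (k : 'I_8) : C := lev (gramc k).
Definition height (k : 'I_(32 * 32)) : nat :=
  nth 0%N heights (mxtens_unindex k).1 + nth 0%N heights (mxtens_unindex k).2.

Lemma Ec_height i (a c : 'I_32) : (0 < i < 4)%N -> mev (Ec i) a c != 0 ->
  (nth 0%N heights c < nth 0%N heights a)%N.
Proof.
move=> i4; have := check_heightsT; rewrite /check_heights => H.
have {}H := all_iota H (i4 : 1 <= i < 1 + 3)%N.
have /allP {}H := all_iota H (ltn_ord a : 0 <= a < 0 + 32)%N.
rewrite mxE /mcoef /scoef => Eac.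
have /hasP [t tE /eqP <-] : has (fun t => N.to_nat t.1 == c) (nth [::] (Ec i) a).
  apply: contraNT Eac => /hasPn nt; rewrite big_seq big1 // => t tE.
  by rewrite (negPf (nt t tE)).
exact: H.
Qed.

Lemma height_E i k j : (0 < i < 4)%N -> copE 1 1 i k j != 0 ->
  (height j < height k)%N.
Proof.
move=> i4; rewrite /height; case: (mxtens_indexP k) => a c.
case: (mxtens_indexP j) => a' c'; rewrite !mxtens_indexK /= /copE /copr !scale1r.
rewrite mxE !tensmxE [dev (Kc i) _ _]mxE [dev (Lc i) _ _]mxE => H.
have : (mev (Ec i) a a' != 0) && (c == c') || (mev (Ec i) c c' != 0) && (a == a').
  apply: contraNT H; rewrite negb_or !negb_and !negbK => /andP [h1 h2].
  apply/eqP; rewrite (_ : _ * _ = 0) ?add0r.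
    by case/orP: h2 => [/eqP -> | /negPf ->]; rewrite ?mulr0 ?mulr0n ?mul0r.
  by case/orP: h1 => [/eqP -> | /negPf ->]; rewrite ?mulr0n ?mulr0 ?mul0r.
case/orP => /andP [/(Ec_height i4) Eh /eqP ->]; first by rewrite ltn_add2r.
by rewrite ltn_add2l.
Qed.

Lemma sub_ord3 (i : 'I_3) : (0 < i.+1 < 4)%N.
Proof. exact: (ltn_ord i). Qed.

Lemma tens1mx1 m n : (1%:M : 'M[C]_m) *t (1%:M : 'M[C]_n) = 1%:M.
Proof.
apply/matrixP => i j; case: (mxtens_indexP i) => a c; case: (mxtens_indexP j) => a' c'.
rewrite tensmxE !mxE (can_eq (@mxtens_indexK m n)) xpair_eqE.
by case: eqP; rewrite ?mul1r ?mul0r.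
Qed.

Lemma VV_triangular : triangular EE FF KK KV formG (fun i j => (zexp h (Bc i.+1 j.+1))^-1)
  (fun i j => (-1) ^+ (sgen i.+1 && sgen j.+1)) (fun i => (qdif i.+1)^-1)
  (fun=> 1) height ss cls chi gam.
Proof.
have i4 (i : 'I_3) : (i.+1 < 4)%N by exact: (ltn_ord i).
split.
- by move=> i; rewrite /KK /KV /copK /copKv tensmx_mul dev_inv //; exact: tens1mx1.
- by move=> i j; rewrite invr_eq0 zexp_neq0.
- by move=> i j; apply: copK_F.
- move=> i j; case: eqP => [->|/eqP ij].
    exact: cop_EFii (sub_ord3 j).
  by rewrite addr0; apply: cop_EF (sub_ord3 j) _.
- by move=> i k j; apply: height_E (sub_ord3 i).
- exact: formG_sym.
- exact: formG_unit.
- by move=> i; rewrite [LHS]formG_E // expr0.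
- by move=> k i; apply: sv_singular (sub_ord3 i).
- by move=> i k; apply: sv_weight (sub_ord3 i).
- by move=> i t; rewrite expfz_neq0.
- by move=> j k; apply: sv_gram.
- by move=> k; apply: gram_neq0.
- by move=> _; apply: oner_neq0.
- move=> x xs; apply: singular_span => -[|i] // i3.
  exact: (xs (Ordinal (i3 : (i < 3)%N))).
Qed.

Lemma hexp_inj (x y : int) : h ^ x * h ^ x = h ^ y * h ^ y -> x = y.
Proof.
have H (x' y' : int) : x' < y' -> h ^ x' * h ^ x' != h ^ y' * h ^ y'.
  move=> xy; have [n n0 yE] : exists2 n : nat, (0 < n)%N & y' = x' + n%:Z.
    by exists `|y' - x'|%N; lia.
  apply: contraNneq (q_not_root n0); rewrite yE expfzDr // -exprM mulnC exprM expr2.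
  rewrite mulrACA -[LHS]mulr1 => /mulfI /esym.
  by rewrite mulf_neq0 ?expfz_neq0 // => /(_ isT) <-.
move=> E; have [//|xy] := eqVneq x y.
have [/H|/H] : x < y \/ y < x by lia.
  by rewrite E eqxx.
by rewrite E eqxx.
Qed.

Lemma cls_sep j k : cls j != cls k ->
  exists i, chi i (cls j) * chi i (cls j) != chi i (cls k) * chi i (cls k).
Proof.
move=> jk; suff [i ijk] : exists i : 'I_3,
    dgen i.+1 * Defs.coord (cls j) i.+1 != dgen i.+1 * Defs.coord (cls k) i.+1.
  by exists i; apply: contra_neq ijk; apply: hexp_inj.
have : has (fun i => dgen i.+1 * Defs.coord (cls j) i.+1 !=
    dgen i.+1 * Defs.coord (cls k) i.+1) (iota 0 3).
  move: jk; rewrite /cls.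
  by case: j => [[|[|[|[|[|[|[|[|]]]]]]]] ?] //; case: k => [[|[|[|[|[|[|[|[|]]]]]]]] ?].
case/hasP => i; rewrite mem_iota => i3 ijk.
by exists (Ordinal (i3 : (i < 3)%N)).
Qed.

(** * The adjoint orbit of E_0 acting on T *)

Definition Knode n := dev (nth [::] Knodes n).
Definition Lnode n := dev (LKnode n).
Definition famX sg n := mev (nth [::] (families sg) n).
Definition adX sg i n := mev (adc sg i n (nth [::] (families sg) n)).
Definition calA n := famX true n *t Knode n.
Definition calB n := Lnode n *t famX false n.

Lemma mev_adc sg i n X : let m := (nth (0, 0)%ZZ (Kc i) (node n).-1).1 in
  mev (adc sg i n X) = mev (Ec i) *m mev X -
    ((-1) ^+ (sgen i && vodd (node n)) *
      (if sg then (zexp h m * zexp h m)^-1 else zexp h m * zexp h m))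
    *: (mev X *m mev (Ec i)).
Proof.
move=> m; rewrite mev_sub mev_scale !mev_mul lev_cons lev_nil addr0 zint_lsg.
congr (_ - (_ * _) *: _); rewrite -/m.
by case: sg; rewrite ?zexpN // zexpD.
Qed.

Lemma adP sg n i : (n < 31)%N -> (0 < i < 4)%N -> ad_ok sg (families sg) n i.
Proof.
move=> n31 i4; have : check_ad sg by case: sg; [exact: check_adAT|exact: check_adBT].
rewrite /check_ad => H; have {}H := all_iota H (n31 : 0 <= n < 0 + 31)%N.
exact: (all_iota H (i4 : 1 <= i < 1 + 3)%N).
Qed.

Lemma calA_E n i : (n < 31)%N -> (0 < i < 4)%N -> exists w : C,
  copE 1 1 i *m calA n = adX true i n *t (dev (Kc i) *m Knode n)
    + w *: (calA n *m copE 1 1 i).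
Proof.
move=> n31 i4; have := adP true n31 i4; rewrite /ad_ok => /and3P [/qcommP h1 /qcommP h2 _].
eexists; rewrite /calA /copE (copr_adA h1 h2); [| |exact: devC].
  congr (_ *t _ + _); rewrite /adX mev_adc /=; congr (_ - _ *: _).
  by rewrite zint_lsg zexpN mul1r invfM mulrA.
by rewrite mul1r zexp_neq0.
Qed.

Lemma calB_E n i : (n < 31)%N -> (0 < i < 4)%N -> exists w : C,
  copE 1 1 i *m calB n = (dev (Lc i) *m Lnode n) *t adX false i n
    + w *: (calB n *m copE 1 1 i).
Proof.
move=> n31 i4; have := adP false n31 i4; rewrite /ad_ok => /and3P [/qcommP h1 /qcommP h2 _].
eexists; rewrite /calB /copE (copr_adB h1 h2); [| |exact: devC].
  congr (_ *t _ + _); rewrite /adX mev_adc /=; congr (_ - _ *: _).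
  rewrite zint_lsg zexpN mul1r invfM invrK mulrCA; congr (_ * _).
  by case: (sgen i && _); rewrite ?invrN invr1.
by rewrite zint_lsg mulf_neq0 ?sgn_neq0 // zexp_neq0.
Qed.

Definition calX (z1 z2 : C) n := z1 *: calA n + z2 *: calB n.

(** The terms in which E_i has moved to the right carry different scalars in the two legs, but all
    of them kill x; only the twisted commutators survive. *)
Lemma calX_E z1 z2 n i (x : 'cV[C]_(32 * 32)) : (n < 31)%N -> (0 < i < 4)%N ->
  copE 1 1 i *m x = 0 ->
  copE 1 1 i *m (calX z1 z2 n *m x) =
  z1 *: (adX true i n *t (dev (Kc i) *m Knode n) *m x)
  + z2 *: ((dev (Lc i) *m Lnode n) *t adX false i n *m x).
Proof.
move=> n31 i4 Ex; have [w1 h1] := calA_E n31 i4; have [w2 h2] := calB_E n31 i4.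
move: Ex h1 h2; rewrite /calX; move: (copE 1 1 i) => P Ex h1 h2.
rewrite mulmxDl mulmxDr -!scalemxAl -!scalemxAr !mulmxA h1 h2 !mulmxDl -!scalemxAl.
by rewrite -!mulmxA Ex !mulmx0 !scaler0 !addr0.
Qed.

Lemma calX_ad z1 z2 n i (x : 'cV[C]_(32 * 32)) : (n < 31)%N -> (0 < i < 4)%N ->
  copE 1 1 i *m x = 0 ->
  if adnext n i is Some (n', a, b) then
    [/\ (n < n' < 31)%N, lev a != 0
      & lev a *: (copE 1 1 i *m (calX z1 z2 n *m x)) = lev b *: (calX z1 z2 n' *m x)]
  else copE 1 1 i *m (calX z1 z2 n *m x) = 0.
Proof.
move=> n31 i4 Ex; rewrite calX_E //.
have := adP true n31 i4; have := adP false n31 i4; rewrite /ad_ok.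
case: adnext => [[[n' a] b]|] => /and3P [_ _ HB] /and3P [_ _ HA]; last first.
  by rewrite /adX !mev_zero // tens0mx tensmx0 !mul0mx !scaler0 addr0.
case/and5P: HB => /mev_eq HB _ _ _ _; case/and5P: HA => /mev_eq HA nn' la /deqP hK /deqP hL.
split=> //; first exact: lunitc_neq0.
rewrite !mev_scale in HA HB.
have eA M : lev a *: (adX true i n *t M) = lev b *: (famX true n' *t M).
  by rewrite -!tensmxZl /adX HA.
have eB M : lev a *: (M *t adX false i n) = lev b *: (M *t famX false n').
  by rewrite -!tensmxZr /adX HB.
rewrite /calX /calA /calB /Knode /Lnode hK hL !dev_mul.
rewrite mulmxDl -!scalemxAl !scalerDr !scalerA ![lev a * _]mulrC ![lev b * _]mulrC.
by rewrite -!scalerA !(scalemxAl (lev a)) !(scalemxAl (lev b)) eA eB.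
Qed.

Definition pairA n j k : C := lev (pt (ptable (actA (families true) n)) j k).
Definition pairB n j k : C := lev (pt (ptable (actB (families false) n)) j k).

Lemma sum_rng (V : nmodType) (f : nat -> V) n :
  \sum_(i <- rng 0 n) f i = \sum_(i < n) f i.
Proof. by rewrite -(big_mkord xpredT f) /index_iota subn0. Qed.

Lemma ptE act j k : (j < 8)%N -> (k < 8)%N ->
  pt (ptable act) j k = mdot (sc j) (gx (act (sc k))).
Proof.
move=> j8 k8; rewrite /pt (nth_map 0%N) ?size_iota // nth_iota // add0n.
by rewrite -map_comp (nth_map 0%N) ?size_iota // nth_iota.
Qed.

Lemma pair_act (A B : 'M[C]_32) act j k : (j < 8)%N -> (k < 8)%N ->
  mev (act (sc k)) = A *m mev (sc k) *m B^T ->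
  (sv j)^T *m formG *m (A *t B *m sv k) = (lev (pt (ptable act) j k))%:M.
Proof.
move=> j8 k8 actE; rewrite tens_tvec -actE ptE //.
exact: (form_tvec _ gcP.1 (sc_size j8)).
Qed.

Lemma pair_calA n j k : (j < 8)%N -> (k < 8)%N ->
  (sv j)^T *m formG *m (calA n *m sv k) = (pairA n j k)%:M.
Proof.
move=> j8 k8; apply: pair_act => //.
by rewrite mev_cscale mev_mul dev_tr.
Qed.

Lemma pair_calB n j k : (j < 8)%N -> (k < 8)%N ->
  (sv j)^T *m formG *m (calB n *m sv k) = (pairB n j k)%:M.
Proof.
move=> j8 k8; apply: pair_act => //.
by rewrite mev_mul mev_rscale mev_tr.
Qed.

Lemma pair_calX z1 z2 n j k : (j < 8)%N -> (k < 8)%N ->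
  (sv j)^T *m formG *m (calX z1 z2 n *m sv k) =
  (z1 * pairA n j k + z2 * pairB n j k)%:M.
Proof.
move=> j8 k8; rewrite mulmxDl -!scalemxAl mulmxDr -!scalemxAr.
by rewrite pair_calA // pair_calB // !scale_scalar_mx -raddfD.
Qed.

Lemma testsP n j k : (n < 31)%N -> (j < 8)%N -> (k < 8)%N ->
  tests_ok (ptable (actA (families true) n)) (ptable (actB (families false) n)) j k.
Proof.
move=> n31 j8 k8; have := check_testsT; rewrite /check_tests; cbv zeta => H.
have {}H := all_iota H (n31 : 0 <= n < 0 + 31)%N.
have {}H := all_iota H (j8 : 0 <= j < 0 + 8)%N.
exact: (all_iota H (k8 : 0 <= k < 0 + 8)%N).
Qed.

Lemma zev2 z a b : zev z [:: a; b] = lev a + z * lev b.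
Proof. by rewrite /= mulr0 addr0. Qed.

Lemma tests_okE z TA TB j k : tests_ok TA TB j k ->
  \sum_(i < 8) zev z (rn i j) * (lev (pt TB i k) + z * lev (pt TA i k)) =
  \sum_(i < 8) zev z (rn i k) * (lev (pt TA j i) + z * lev (pt TB j i)).
Proof.
move=> /(@zev_eq C h z); rewrite !zev_sum !big_map !sum_rng => E.
rewrite (eq_bigr (fun i : 'I_8 => zev z (zmul (rn i j) [:: pt TB i k; pt TA i k]))).
  rewrite E; apply: eq_bigr => i _.
  by rewrite zev_mul zev2.
by move=> i _; rewrite zev_mul zev2.
Qed.

(** * The matrix of R(z) on the singular vectors *)

Definition phi (w : C) : 'M[C]_8 := \matrix_(i, k) (zev w (rn i k) / zev w rden).

Lemma check_rnP i k : (i < 8)%N -> (k < 8)%N ->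
  [&& zeq (zscale (gramc i) (rn i k)) (zscale (gramc k) (rn k i)),
      (size (rn i k) <= 5)%N &
      zeq (zsum [seq zmul (rn i j) (zrev4 (rn j k)) | j <- rng 0 8])
          (if i == k then zmul rden (zrev4 rden) else [::])].
Proof.
move=> i8 k8; have := check_rnT; rewrite /check_rn => /andP [H _].
have {}H := all_iota H (i8 : 0 <= i < 0 + 8)%N.
exact: (all_iota H (k8 : 0 <= k < 0 + 8)%N).
Qed.

Lemma size_rden : (size rden <= 5)%N. Proof. by []. Qed.

Lemma check_rn_cls : all (fun i => all (fun k => (sclass i == sclass k) ||
  zzero (rn i k)) (rng 0 8)) (rng 0 8).
Proof. by vm_compute. Qed.

Lemma phi_cls w j k : phi w j k != 0 -> cls j = cls k.
Proof.
have H := all_iota check_rn_cls (ltn_ord j : 0 <= j < 0 + 8)%N.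
have {H} /orP [/eqP //|/(@zev_zero C h w) E] := all_iota H (ltn_ord k : 0 <= k < 0 + 8)%N.
by rewrite mxE E mul0r eqxx.
Qed.

Lemma phi_sym w j k : gam j * phi w j k = gam k * phi w k j.
Proof.
have /and3P [/(@zev_eq C h w) E _ _] := check_rnP (ltn_ord j) (ltn_ord k).
by rewrite !zev_scale in E; rewrite !mxE !mulrA; congr (_ / _).
Qed.

Lemma zev_nth w p n : (size p <= n)%N -> zev w p = \sum_(i < n) lev (nth [::] p i) * w ^+ i.
Proof.
elim: p n => [|a p IH] n /=.
  by move=> _; rewrite big1 // => i _; rewrite nth_nil lev_nil mul0r.
case: n => // n pn; rewrite big_ord_recl /= mulr1 (IH n) // mulr_sumr; congr (_ + _).
by apply: eq_bigr => i _; rewrite /= exprS mulrCA.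
Qed.

Lemma zev_rev4 w p : w != 0 -> (size p <= 5)%N -> zev w (zrev4 p) = w ^+ 4 * zev w^-1 p.
Proof.
move=> w0 p5; rewrite (@zev_nth w _ 5) ?size_map ?size_iota // (zev_nth _ p5).
rewrite mulr_sumr (reindex_inj rev_ord_inj) /=; apply: eq_bigr => i _.
have i5 := ltn_ord i; rewrite (nth_map 0%N) ?size_iota; last by lia.
rewrite nth_iota; last by lia.
rewrite add0n mulrCA; congr (lev (nth _ _ _) * _); first by lia.
rewrite exprVn; apply: (canRL (mulfK (expf_neq0 _ w0))).
by rewrite -exprD; congr (_ ^+ _); lia.
Qed.

(** Multiplication by w^4 and both denominators gives a polynomial identity, in which [zrev4]
    supplies the factors taken at 1/w. *)
Lemma phi_unitary w : w != 0 -> zev w rden != 0 -> zev w^-1 rden != 0 ->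
  phi w *m phi w^-1 = 1%:M.
Proof.
move=> w0 d1 d2; apply/matrixP => i k; rewrite !mxE.
have /and3P [_ _ /(@zev_eq C h w)] := check_rnP (ltn_ord i) (ltn_ord k).
rewrite zev_sum big_map sum_rng => E.
have w4 : w ^+ 4 != 0 by rewrite expf_neq0.
apply: (mulfI (mulf_neq0 w4 (mulf_neq0 d1 d2))); rewrite mulr_sumr.
transitivity (\sum_(j < 8) zev w (zmul (rn i j) (zrev4 (rn j k)))).
  apply: eq_bigr => j _; rewrite !mxE zev_mul zev_rev4 //; last first.
    by case/and3P: (check_rnP (ltn_ord j) (ltn_ord k)).
  by field; rewrite d1 d2.
rewrite E; case: eqP => [/val_inj ->|/eqP ik].
  by rewrite eqxx mulr1 zev_mul zev_rev4 ?size_rden // mulrCA.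
by rewrite -val_eqE /= (negPf ik) mulr0.
Qed.

Section Solution.
Context (z : C).
Local Notation comm := (commutes EE FF KK KV).
Local Notation V := 'cV[C]_(32 * 32).

Lemma node0E : [/\ nth [::] Knodes 0 = Kc 0, LKnode 0 = Lc 0 &
  forall sg, nth [::] (families sg) 0 = Ec 0].
Proof. by split=> [||[]]; vm_compute. Qed.

Lemma calX0 z1 z2 : calX z1 z2 0 = copE z1 z2 0.
Proof.
have [hK hL hX] := node0E.
by rewrite /calX /calA /calB /Knode /Lnode /famX hK hL !hX.
Qed.

Lemma singularvP (x : V) : singularv EE x <->
  forall i, (0 < i < 4)%N -> copE 1 1 i *m x = 0.
Proof.
split=> [xs|xs i]; last exact: xs (sub_ord3 i).
by case=> // i i3; apply: (xs (Ordinal (i3 : (i < 3)%N))).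
Qed.

Lemma comm_copE X i : comm X -> (0 < i < 4)%N -> X *m copE 1 1 i = copE 1 1 i *m X.
Proof.
by case: i => // i cX i3; have [-> _ _ _] := cX (Ordinal (i3 : (i < 3)%N)).
Qed.

Lemma comm_singular X (x : V) : comm X -> singularv EE x -> singularv EE (X *m x).
Proof.
by move=> cX xs i; have [XE _ _ _] := cX i; rewrite mulmxA -XE -mulmxA xs mulmx0.
Qed.

Lemma zev_rden w : zev w rden = zsem w rdene.
Proof. by rewrite -zcompE. Qed.

Lemma solution_calX X n k : comm X -> acts_by ss X (phi z) -> (n < 31)%N ->
  X *m (calX z 1 n *m ss k) = calX 1 z n *m (X *m ss k).
Proof.
move=> cX Xs; have [d] : exists d, (31 <= n + d)%N by exists 31%N; rewrite leq_addl.
elim: d n => [|d IH] n nd n31; first by lia.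
pose y : V := X *m (calX z 1 n *m ss k) - calX 1 z n *m (X *m ss k).
suff y0 : y = 0 by apply/eqP; rewrite -subr_eq0; apply/eqP.
have sk := tri_s VV_triangular k; have Xsk := comm_singular cX sk.
have ys i : (0 < i < 4)%N -> copE 1 1 i *m y = 0.
  move=> i4; have XE := comm_copE cX i4.
  have := calX_ad 1 z n31 i4 ((singularvP _).1 Xsk i i4).
  have := calX_ad z 1 n31 i4 ((singularvP _).1 sk i i4).
  rewrite /y; case: adnext => [[[n' a] b]|]; last first.
    by move=> h1 h2; rewrite mulmxBr h2 (mulmxA (copE 1 1 i) X) -XE -(mulmxA X) h1 mulmx0 subrr.
  move=> [nn' a0 h1] [_ _ h2]; apply: (scalerI a0).
  rewrite scaler0 mulmxBr scalerBr h2 (mulmxA (copE 1 1 i) X) -XE -(mulmxA X) scalemxAr h1.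
  by rewrite -scalemxAr IH ?subrr //; lia.
have [b yE] := singular_span ys; rewrite yE big1 // => j _.
suff -> : b j = 0 by rewrite scale0r.
have /matrixP /(_ 0 0) := gram_span VV_triangular j b; rewrite -[\sum_k _]yE /y mulmxBr.
have XF i : X *m FF i = FF i *m X by have [] := cX i.
have -> : (ss j)^T *m formG *m (X *m (calX z 1 n *m ss k)) =
    (\sum_(i < 8) phi z i j * (pairB n i k + z * pairA n i k))%:M.
  rewrite (pair_comm VV_triangular j _ XF Xs) raddf_sum; apply: eq_bigr => i _.
  rewrite pair_calX // scale_scalar_mx mul1r addrC; congr ((_ * _)%:M).
  by rewrite phi_sym mulrAC mulfV ?mul1r // (tri_gam VV_triangular).
have -> : (ss j)^T *m formG *m (calX 1 z n *m (X *m ss k)) =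
    (\sum_(i < 8) phi z i k * (pairA n j i + z * pairB n j i))%:M.
  rewrite Xs !mulmx_sumr raddf_sum; apply: eq_bigr => i _.
  by rewrite -!scalemxAr pair_calX // scale_scalar_mx mul1r.
have -> : \sum_(i < 8) phi z i j * (pairB n i k + z * pairA n i k) =
    \sum_(i < 8) phi z i k * (pairA n j i + z * pairB n j i).
  have E := tests_okE z (testsP n31 (ltn_ord j) (ltn_ord k)).
  have /(congr1 ( *%R (zev z rden)^-1)) := E; rewrite !mulr_sumr => {}E.
  transitivity (\sum_(i < 8) (zev z rden)^-1 * (zev z (rn i j) *
      (pairB n i k + z * pairA n i k))).
    by apply: eq_bigr => i _; rewrite mxE mulrA [_^-1 * _]mulrC.
  rewrite E; apply: eq_bigr => i _.
  by rewrite mxE mulrA [_^-1 * _]mulrC.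
rewrite subrr !mxE mulr1n => /esym /eqP.
by rewrite mulf_eq0 (negPf (tri_gam VV_triangular j)) orbF => /eqP.
Qed.

(** Here the induction goes up from E_0: on singular vectors a node is a non-zero multiple of E_i
    applied to its parent, and X commutes with E_i. *)
Lemma intertwiner_calX X n (x : V) : comm X -> X *m copE z 1 0 = copE 1 z 0 *m X ->
  singularv EE x -> (n < 31)%N ->
  X *m (calX z 1 n *m x) = calX 1 z n *m (X *m x).
Proof.
move=> cX XE xs; have Xxs := comm_singular cX xs.
elim/ltn_ind: n => -[|n] IH n31; first by rewrite !calX0 !mulmxA XE.
have := check_adnextT; rewrite /check_adnext => H.
have := all_iota H (_ : 1 <= n.+1 < 1 + 30)%N; case: (nth _ _ _) => i p.
move=> /(_ n31) /and3P [i4 pn]; have p31 := ltn_trans pn n31.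
have := calX_ad 1 z p31 i4 ((singularvP _).1 Xxs i i4).
have := calX_ad z 1 p31 i4 ((singularvP _).1 xs i i4).
case: adnext => [[[n' a] b]|] // [_ _ h1] [_ _ h2] /andP [/eqP nE /lunitc_neq0 b0].
rewrite nE in h1 h2; apply: (scalerI b0).
rewrite -h2 -IH // scalemxAr -h1 -scalemxAr; congr (_ *: _).
by rewrite [LHS]mulmxA comm_copE // -mulmxA.
Qed.
End Solution.

(** * Uniqueness of the intertwiner *)

Section Uniqueness.
Context (z : C).
Hypothesis z0 : z != 0.
Hypothesis den0 : zsem z rdene != 0.
Local Notation comm := (commutes EE FF KK KV).
Local Notation V := 'cV[C]_(32 * 32).

Lemma zev_pair1 n j k : (j < 8)%N -> (k < 8)%N ->
  zev z (pair1 n j k) = pairA n j k + z * pairB n j k.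
Proof.
#[local] Transparent pair1.
by move=> j8 k8; rewrite /pairA /pairB !ptE // /pair1; cbv zeta; rewrite zev2.
Qed.

Lemma zunitP u e p : zunit u e p ->
  exists2 c, c != 0 & zev z p = c * (1 - zexp h (2 * e) * z).
Proof.
rewrite /zunit => /andP [lu pE]; exists (lev u); first exact: lunitc_neq0 lu.
rewrite (zev_eq h z pE) zev_scale; congr (_ * _).
by rewrite /zlin zev2 lev_l1 lev_opp lev_h mulrN mulrC.
Qed.

Lemma zunit_shift e p : (if p is d0 :: p' then nilp d0 && zunit (head [::] p') e p'
    else false) -> exists2 u, u != 0 & zev z p = z * (u * (1 - zexp h (2 * e) * z)).
Proof.
case: p => // d0 p /andP [/nilP -> /zunitP [u u0 pE]].
by exists u => //; rewrite -pE /= lev_nil add0r.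
Qed.

Lemma zconstP p : lunitc (head [::] p) && zeq p [:: head [::] p] ->
  zev z p != 0.
Proof.
move=> /andP [/lunitc_neq0 p0 /(@zev_eq C h z) ->].
by rewrite /= mulr0 addr0.
Qed.

Lemma zexp_q n : zexp h (2 * Z.of_nat n) = q ^+ n.
Proof. by rewrite -lev_lq lev_h. Qed.

Lemma zexp_qV n : zexp h (2 * Z.opp (Z.of_nat n)) = q ^- n.
Proof. by rewrite -lev_lqN lev_h. Qed.

Lemma den_factors w : zsem w rdene != 0 ->
  [/\ 1 - q ^- 4 * w != 0, 1 - q ^- 6 * w != 0, 1 - q ^+ 6 * w != 0
    & 1 - q ^+ 8 * w != 0].
Proof.
rewrite /rdene /zN /zP; cbn [zsem lsem]; rewrite !mulf_eq0 !negb_or.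
by case/and5P.
Qed.

Lemma det_zev (a b c : nat -> zpol) e : det_unit a b c e ->
  1 - zexp h (2 * e) * z != 0 ->
  let a' i := zev z (a i) in let b' i := zev z (b i) in let c' i := zev z (c i) in
  a' 3%N * (b' 4%N * c' 5%N - b' 5%N * c' 4%N) + a' 4%N * (b' 5%N * c' 3%N - b' 3%N * c' 5%N)
    + a' 5%N * (b' 3%N * c' 4%N - b' 4%N * c' 3%N) != 0.
Proof.
rewrite /det_unit; cbv zeta => /zunit_shift [u u0 E] e0.
by rewrite !(zev_add, zev_mul, zev_opp) in E; rewrite E !mulf_neq0.
Qed.

Lemma unique_facts : 
  [/\ zev z (pair1 19 0 1) != 0, zev z (pair1 20 1 2) != 0,
      let a i := zev z (pair1 30 0 i) in let b i := zev z (pair1 29 1 i) in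
      let c i := zev z (pair1 27 2 i) in
      a 3%N * (b 4%N * c 5%N - b 5%N * c 4%N) + a 4%N * (b 5%N * c 3%N - b 3%N * c 5%N)
        + a 5%N * (b 3%N * c 4%N - b 4%N * c 3%N) != 0,
      zev z (pair1 30 3 6) != 0
    & zev z (pair1 30 3 7) = 0 /\ zev z (pair1 30 4 7) != 0].
Proof.
have [n4 n6 p6 p8] := den_factors den0.
have unitE u e p : zunit u e p -> 1 - zexp h (2 * e) * z != 0 -> zev z p != 0.
  by move=> /zunitP [c c0 ->] e0; rewrite mulf_neq0.
split.
- by apply: (unitE _ _ _ check_pair_01); rewrite (zexp_q 8).
- by apply: (unitE _ _ _ check_pair_12); rewrite (zexp_q 6).
- by apply: (@det_zev (pair1 30 0) (pair1 29 1) (pair1 27 2) _ check_pair_det); rewrite (zexp_qV 4).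
- by apply: (unitE _ _ _ check_pair_36); rewrite (zexp_qV 6).
- by split; [exact: (zev_zero h z check_pair_37)|exact: (zconstP check_pair_47)].
Qed.

Section Row.
Context (D : 'M[C]_(32 * 32)) (dl : 'M[C]_8).
Hypothesis cD : comm D.
Hypothesis DE : D *m copE z 1 0 = copE 1 z 0 *m D.
Hypothesis Ds : acts_by ss D dl.
Hypothesis dl_cls : forall j k, dl j k != 0 -> cls j = cls k.

(** A vanishing row j makes s_j orthogonal to the image of D. Applied to D X_n s_k = X_n D s_k, this
    is a relation among the entries of column k. *)
Lemma row_rel n (j k : 'I_8) : (n < 31)%N -> (forall i, dl j i = 0) ->
  \sum_(i < 8) dl i k * zev z (pair1 n j i) = 0.
Proof.
move=> n31 dj; have DF i : D *m FF i = FF i *m D by have [] := cD i.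
have E := intertwiner_calX cD DE (tri_s VV_triangular k) n31.
have /matrixP /(_ 0 0) : (ss j)^T *m formG *m (D *m (calX z 1 n *m ss k)) = 0.
  rewrite (pair_comm VV_triangular j _ DF Ds) big1 // => i _.
  by rewrite dj mulr0 mul0r scale0r.
rewrite E Ds !mulmx_sumr [RHS]mxE summxE => H; rewrite -[RHS]H.
apply: eq_bigr => i _; rewrite -!scalemxAr pair_calX // mul1r zev_pair1 //.
by rewrite !mxE eqxx mulr1n.
Qed.

Lemma dl0 j k : cls j != cls k -> dl j k = 0.
Proof. by move=> jk; apply: contraNeq jk => /dl_cls ->. Qed.

Lemma row_rel1 n (j k : 'I_8) : (n < 31)%N -> (forall i, dl j i = 0) ->
  (forall i, i != k -> cls i != cls k) -> zev z (pair1 n j k) != 0 ->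
  forall i, dl k i = 0.
Proof.
move=> n31 dj ck p0 i; have [<-|ik] := eqVneq k i; last first.
  by apply: dl0; rewrite eq_sym ck // eq_sym.
have := row_rel k n31 dj; rewrite (bigD1 k) //= big1 ?addr0.
  by move=> /eqP; rewrite mulf_eq0 (negPf p0) orbF => /eqP.
by move=> j' j'k; rewrite dl0 ?mul0r // ck.
Qed.

Local Notation "## i" := (Ordinal (isT : (i < 8)%N)) (at level 0, i at level 0).

Lemma row_rel3 n (j k : 'I_8) : (n < 31)%N -> (forall i, dl j i = 0) ->
  cls k = cls ##3 ->
  dl ##3 k * zev z (pair1 n j 3) + dl ##4 k * zev z (pair1 n j 4)
    + dl ##5 k * zev z (pair1 n j 5) = 0.
Proof.
move=> n31 dj kE; rewrite -(row_rel k n31 dj).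
rewrite (bigD1 ##3) //= (bigD1 ##4) //= (bigD1 ##5) //= big1 ?addr0 ?addrA //.
move=> i i345; rewrite dl0 ?mul0r // kE; move: i345.
by case: i => [[|[|[|[|[|[|[|[|]]]]]]]] ?].
Qed.

Lemma row_rel2 n (j k : 'I_8) : (n < 31)%N -> (forall i, dl j i = 0) ->
  cls k = cls ##6 ->
  dl ##6 k * zev z (pair1 n j 6) + dl ##7 k * zev z (pair1 n j 7) = 0.
Proof.
move=> n31 dj kE; rewrite -(row_rel k n31 dj).
rewrite (bigD1 ##6) //= (bigD1 ##7) //= big1 ?addr0 //.
move=> i i345; rewrite dl0 ?mul0r // kE; move: i345.
by case: i => [[|[|[|[|[|[|[|[|]]]]]]]] ?].
Qed.

Lemma cramer3 (a3 a4 a5 b3 b4 b5 c3 c4 c5 x3 x4 x5 : C) :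
  a3 * (b4 * c5 - b5 * c4) + a4 * (b5 * c3 - b3 * c5) + a5 * (b3 * c4 - b4 * c3) != 0 ->
  x3 * a3 + x4 * a4 + x5 * a5 = 0 -> x3 * b3 + x4 * b4 + x5 * b5 = 0 ->
  x3 * c3 + x4 * c4 + x5 * c5 = 0 -> [/\ x3 = 0, x4 = 0 & x5 = 0].
Proof.
set d := _ + _ => d0 ha hb hc; split; apply: (mulfI d0); rewrite mulr0.
- transitivity ((x3 * a3 + x4 * a4 + x5 * a5) * (b4 * c5 - b5 * c4)
    + (x3 * b3 + x4 * b4 + x5 * b5) * (c4 * a5 - c5 * a4)
    + (x3 * c3 + x4 * c4 + x5 * c5) * (a4 * b5 - a5 * b4)); first by rewrite /d; ring.
  by rewrite ha hb hc !mul0r !addr0.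
- transitivity ((x3 * a3 + x4 * a4 + x5 * a5) * (b5 * c3 - b3 * c5)
    + (x3 * b3 + x4 * b4 + x5 * b5) * (c5 * a3 - c3 * a5)
    + (x3 * c3 + x4 * c4 + x5 * c5) * (a5 * b3 - a3 * b5)); first by rewrite /d; ring.
  by rewrite ha hb hc !mul0r !addr0.
- transitivity ((x3 * a3 + x4 * a4 + x5 * a5) * (b3 * c4 - b4 * c3)
    + (x3 * b3 + x4 * b4 + x5 * b5) * (c3 * a4 - c4 * a3)
    + (x3 * c3 + x4 * c4 + x5 * c5) * (a3 * b4 - a4 * b3)); first by rewrite /d; ring.
  by rewrite ha hb hc !mul0r !addr0.
Qed.

(** Rows vanish in a cascade: 0 gives 1, and 1 gives 2. Rows 0, 1, 2 each give one relation for the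
    three unknowns of a column of weight (4,0,0), with non-zero determinant. Rows 3 and 4 then give
    a triangular system for weight (0,0,0), as the pairing of 3 with 7 is zero. *)
Lemma difference_eq0 : dl ##0 ##0 = 0 -> forall j k, dl j k = 0.
Proof.
move=> d00; have [h1 h2 det0 h4 [h5 h6]] := unique_facts.
have r0 i : dl ##0 i = 0.
  have [->//|i0] := eqVneq i ##0; apply: dl0; move: i0.
  by case: i => [[|[|[|[|[|[|[|[|]]]]]]]] ?].
have c1 i : i != ##1 -> cls i != cls ##1.
  by case: i => [[|[|[|[|[|[|[|[|]]]]]]]] ?].
have c2 i : i != ##2 -> cls i != cls ##2.
  by case: i => [[|[|[|[|[|[|[|[|]]]]]]]] ?].
have r1 := @row_rel1 19 ##0 ##1 isT r0 c1 h1.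
have r2 := @row_rel1 20 ##1 ##2 isT r1 c2 h2.
have r345 k : cls k = cls ##3 -> [/\ dl ##3 k = 0, dl ##4 k = 0 & dl ##5 k = 0].
  move=> kE; apply: cramer3 det0 _ _ _.
  - exact: (row_rel3 (n := 30) (j := ##0)).
  - exact: (row_rel3 (n := 29) (j := ##1)).
  - exact: (row_rel3 (n := 27) (j := ##2)).
have r3 i : dl ##3 i = 0.
  by have [/r345 []|ik] := eqVneq (cls i) (cls ##3); last by rewrite dl0 // eq_sym.
have r4 i : dl ##4 i = 0.
  by have [/r345 []|ik] := eqVneq (cls i) (cls ##3); last by rewrite dl0 // eq_sym.
have r5 i : dl ##5 i = 0.
  by have [/r345 []|ik] := eqVneq (cls i) (cls ##3); last by rewrite dl0 // eq_sym.
have r67 k : cls k = cls ##6 -> dl ##6 k = 0 /\ dl ##7 k = 0.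
  move=> kE; have := row_rel2 (n := 30) (j := ##3) isT r3 kE.
  rewrite h5 mulr0 addr0 => /eqP; rewrite mulf_eq0 (negPf h4) orbF => /eqP d6.
  split=> //; have := row_rel2 (n := 30) (j := ##4) isT r4 kE.
  by rewrite d6 mul0r add0r => /eqP; rewrite mulf_eq0 (negPf h6) orbF => /eqP.
have r6 i : dl ##6 i = 0.
  by have [/r67 []|ik] := eqVneq (cls i) (cls ##6); last by rewrite dl0 // eq_sym.
have r7 i : dl ##7 i = 0.
  by have [/r67 []|ik] := eqVneq (cls i) (cls ##6); last by rewrite dl0 // eq_sym.
move=> [[|[|[|[|[|[|[|[|]]]]]]]] j8] k //; rewrite (bool_irrelevance j8 isT).
- exact: r0.
- exact: r1.
- exact: r2.
- exact: r3.
- exact: r4.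
- exact: r5.
- exact: r6.
- exact: r7.
Qed.

End Row.
End Uniqueness.

(** * The solution and its characterization *)

Local Notation comm := (commutes EE FF KK KV).
Local Notation V := 'cV[C]_(32 * 32).
Local Notation o0 := (Ordinal (isT : (0 < 8)%N)).

Lemma copE0_F z1 z2 i : copE z1 z2 0 *m FF i = FF i *m copE z1 z2 0.
Proof. by have := cop_EF z1 z2 (isT : (0 < 4)%N) (sub_ord3 i) isT; rewrite expr0 scale1r. Qed.

(** X and the coproducts of E_0 commute with the F_i, so the relation spreads from the s_k, where it
    is the node 0 of [solution_calX]. *)
Lemma solution_E z X : comm X -> acts_by ss X (phi z) ->
  X *m copE z 1 0 = copE 1 z 0 *m X.
Proof.
move=> cX Xs; have XF i : X *m FF i = FF i *m X by have [] := cX i.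
have H : forall x : V, X *m (copE z 1 0 *m x) = copE 1 z 0 *m (X *m x).
  apply: (Fgen_ind VV_triangular (P := fun x => X *m (copE z 1 0 *m x) = copE 1 z 0 *m (X *m x))).
  - split=> [|a x y hx hy]; first by rewrite !mulmx0.
    by rewrite !mulmxDr -!scalemxAr hx hy.
  - move=> i x Hx; rewrite (mulmxA (copE z 1 0)) copE0_F -!(mulmxA (FF i)).
    rewrite (mulmxA X (FF i)) XF -(mulmxA (FF i)) Hx (mulmxA X (FF i)) XF.
    by rewrite -(mulmxA (FF i) X) (mulmxA (copE 1 z 0) (FF i)) copE0_F !mulmxA.
  - by move=> k; rewrite -!calX0; exact: (solution_calX (n := 0) k cX Xs isT).
apply/matrixP => i j; have /colP /(_ i) := H (delta_mx j 0).
by rewrite !mulmxA -!colE !mxE.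
Qed.

Lemma copE_tr z1 z2 : (copE z1 z2 0)^T *m formG = - (formG *m copF z1 z2 0).
Proof.
have /(congr1 trmx) := formG_E z1 z2 (isT : (0 < 4)%N).
by rewrite expr1 scaleN1r linearN /= !trmx_mul trmxK formG_sym.
Qed.

Lemma solution_exists w : exists Y, comm Y /\ acts_by ss Y (phi w).
Proof. by apply: (ext_exists VV_triangular) => j k; apply: phi_cls. Qed.

Section Solution.
Context (z : C).
Hypothesis z0 : z != 0.
Hypothesis den0 : zsem z rdene != 0.
Hypothesis denV0 : zsem z^-1 rdene != 0.

(* The form intertwines E_0 and -F_0, and the solution at 1/z, which is self-adjoint,
   is the inverse of the solution at z. *)
Lemma solution_F X : comm X -> acts_by ss X (phi z) ->
  X *m copF z^-1 1 0 = copF 1 z^-1 0 *m X.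
Proof.
move=> cX Xs; have [Y [cY Ys]] := solution_exists z^-1.
have XF i : X *m FF i = FF i *m X by have [] := cX i.
have YF i : Y *m FF i = FF i *m Y by have [] := cY i.
have XY : X *m Y = 1%:M.
  apply: (comm_eq VV_triangular (phi := 1%:M)).
  - by move=> i; rewrite -mulmxA YF mulmxA XF mulmxA.
  - by move=> i; rewrite mul1mx mulmx1.
  - move=> k; rewrite -mulmxA Ys mulmx_sumr -(phi_unitary (w := z)) ?zev_rden //.
    under eq_bigr => j _ do rewrite -scalemxAr Xs scaler_sumr.
    rewrite exchange_big; apply: eq_bigr => i _; rewrite [in RHS]mxE scaler_suml.
    by apply: eq_bigr => j _; rewrite scalerA mulrC.
  - move=> k; rewrite mul1mx (bigD1 k) //= mxE eqxx scale1r big1 ?addr0 // => j jk.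
    by rewrite mxE (negPf jk) scale0r.
have GY := self_adjoint VV_triangular cY Ys (phi_sym z^-1).
have YE := solution_E cY Ys.
have FY : copF z^-1 1 0 *m Y = Y *m copF 1 z^-1 0.
  apply: (can_inj (mulKmx formG_unit)); apply: oppr_inj.
  rewrite (mulmxA formG) -mulNmx -copE_tr -mulmxA GY mulmxA -trmx_mul YE.
  by rewrite trmx_mul -mulmxA copE_tr mulmxN (mulmxA Y^T) -GY mulmxA.
by rewrite -[LHS]mulmx1 -(mulmx1C XY) mulmxA -(mulmxA X) FY mulmxA XY mul1mx.
Qed.

Lemma phi00 : phi z o0 o0 = 1.
Proof.
have /(@zev_eq C h z) E : zeq (rn 0 0) rden by vm_compute.
by rewrite mxE E mulfV // zev_rden.
Qed.

Lemma comm_choice X : comm X -> exists dl : 'M[C]_8, acts_by ss X dl /\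
  forall j k, dl j k != 0 -> cls j = cls k.
Proof.
move=> cX.
have H k : exists b : 'I_8 -> C, X *m ss k = \sum_j b j *: ss j.
  exact: (tri_span VV_triangular (comm_singular cX (tri_s VV_triangular k))).
have [b bE] := choice H; exists (\matrix_(j, k) b k j); split=> [k|j k].
  by rewrite bE; apply: eq_bigr => j _; rewrite mxE.
rewrite mxE => bkj; apply/eqP; apply: contraNT bkj => jk; apply/eqP.
apply: (hwv_span VV_triangular cls_sep (k0 := k)) jk; rewrite -bE; split.
  exact: comm_singular (tri_s VV_triangular k).
move=> i; have [_ _ XK _] := cX i.
rewrite !(mulmxA (KK i) X) -XK -!(mulmxA X) (mulmxA (KK i) X) -XK -(mulmxA X).
by rewrite (hwv_s VV_triangular k).2 -scalemxAr.
Qed.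

Theorem intertwiner_iff X :
  [/\ comm X, X *m copE z 1 0 = copE 1 z 0 *m X,
      X *m copF z^-1 1 0 = copF 1 z^-1 0 *m X & X *m ss o0 = ss o0] <->
  comm X /\ acts_by ss X (phi z).
Proof.
split=> [[cX XE XF Xs]|[cX Xs]]; last first.
  split=> //; [exact: solution_E|exact: solution_F|].
  rewrite Xs (bigD1 o0) //= phi00 scale1r big1 ?addr0 // => i i0.
  have [->|/phi_cls] := eqVneq (phi z i o0) 0; first by rewrite scale0r.
  by move: i0; case: i => [[|[|[|[|[|[|[|[|]]]]]]]] ?].
split=> //; have [Y [cY Ys]] := solution_exists z.
suff -> : X = Y by [].
have YE := solution_E cY Ys.
have cD : comm (X - Y).
  move=> i; have [h1 h2 h3 h4] := cX i; have [g1 g2 g3 g4] := cY i.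
  by split; rewrite mulmxBl mulmxBr ?h1 ?h2 ?h3 ?h4 ?g1 ?g2 ?g3 ?g4.
have [dl [Ds dcls]] := comm_choice cD.
have DE : (X - Y) *m copE z 1 0 = copE 1 z 0 *m (X - Y).
  by rewrite mulmxBl mulmxBr XE YE.
have Y0 : Y *m ss o0 = ss o0.
  rewrite Ys (bigD1 o0) //= phi00 scale1r big1 ?addr0 // => i i0.
  have [->|/phi_cls] := eqVneq (phi z i o0) 0; first by rewrite scale0r.
  by move: i0; case: i => [[|[|[|[|[|[|[|[|]]]]]]]] ?].
(* The normalization on v_1 (x) v_1 makes the first entry of the difference vanish, which starts the
   cascade. *)
have dl0 := difference_eq0 z0 den0 cD DE Ds dcls.
have {}dl0 j k : dl j k = 0.
  apply: dl0; have := span_free VV_triangular (b := fun j => dl j o0) _ o0; apply.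
  by rewrite -Ds mulmxBl Xs Y0 subrr.
apply/eqP; rewrite -subr_eq0; apply/eqP.
apply: (comm_eq VV_triangular (phi := 0)) => [i|i|k|k].
- by have [] := cD i.
- by rewrite mul0mx mulmx0.
- by rewrite Ds; apply: eq_bigr => j _; rewrite dl0 mxE.
- by rewrite mul0mx big1 // => j _; rewrite mxE scale0r.
Qed.

End Solution.

(** * Comparison with the matrices and coefficients of the statement *)

Lemma rnume_wf : all (fun i => all (fun j => zwf (rnume i j)) (rng 0 8)) (rng 0 8).
Proof. by vm_compute. Qed.

Lemma rnE i j : (i < 8)%N -> (j < 8)%N -> rn i j = zcomp (rnume i j).
Proof. by do 8?case: i => [|i] //; do 8?case: j => [|j] //; vm_compute. Qed.

Lemma phiE w (i j : 'I_8) : phi w i j = zsem w (rnume i j) / zsem w rdene.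
Proof.
have H := all_iota rnume_wf (ltn_ord i : 0 <= i < 0 + 8)%N.
have {}H := all_iota H (ltn_ord j : 0 <= j < 0 + 8)%N.
by rewrite mxE rnE // zcompE // zev_rden.
Qed.

Lemma tvec_msem m : tvec (msem (@e C) m) = msem (@vv C) m.
Proof.
elim: m => [a c|l a IH|a IHa b IHb|a IHa b IHb|a IH] /=.
- exact: tvec_delta.
- by rewrite tvecZ IH.
- by rewrite tvecD IHa IHb.
- by rewrite tvecB IHa IHb.
- by rewrite tvecN IH.
Qed.

Lemma sv_msem k m : mwf m -> sc k = mcomp m -> sv k = msem (@vv C) m.
Proof. by move=> wf kE; rewrite -tvec_msem -mcompE // -kE. Qed.

Lemma sv_vv k a c : sc k = munit a c -> (0 < a <= 32)%N -> (0 < c <= 32)%N ->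
  sv k = vv C a c.
Proof.
by move=> kE a32 c32; rewrite (@sv_msem k (MU a c)) //= a32.
Qed.

Lemma sv_u4a : sv 3 = u4a q.
Proof. by rewrite (@sv_msem 3 u4ae) //; vm_compute. Qed.

Lemma sv_u5a : sv 6 = u5a q.
Proof. by rewrite (@sv_msem 6 u5ae) //; vm_compute. Qed.

Lemma block4_proof (i : 'I_3) : (3 + i < 8)%N.
Proof. by rewrite -[8%N]/(3 + 5)%N ltn_add2l (leq_trans (ltn_ord i)). Qed.
Lemma block5_proof (i : 'I_2) : (6 + i < 8)%N.
Proof. by rewrite -[8%N]/(6 + 2)%N ltn_add2l. Qed.
Definition block4 (i : 'I_3) : 'I_8 := Ordinal (block4_proof i).
Definition block5 (i : 'I_2) : 'I_8 := Ordinal (block5_proof i).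

Lemma block4_inj : injective block4.
Proof. by move=> i j /(congr1 val) /= /addnI /val_inj. Qed.
Lemma block5_inj : injective block5.
Proof. by move=> i j /(congr1 val) /= /addnI /val_inj. Qed.

Lemma block4_cls k : (cls k == cls (block4 0)) = (k \in codom block4).
Proof.
apply/eqP/codomP => [|[i ->]]; last by case: i => [[|[|[|]]] ?].
case: k => [[|[|[|[|[|[|[|[|]]]]]]]] k8] // _.
- by exists 0; apply: val_inj.
- by exists (Ordinal (isT : (1 < 3)%N)); apply: val_inj.
- by exists (Ordinal (isT : (2 < 3)%N)); apply: val_inj.
Qed.

Lemma block5_cls k : (cls k == cls (block5 0)) = (k \in codom block5).
Proof.
apply/eqP/codomP => [|[i ->]]; last by case: i => [[|[|]] ?].
case: k => [[|[|[|[|[|[|[|[|]]]]]]]] k8] // _.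
- by exists 0; apply: val_inj.
- by exists (Ordinal (isT : (1 < 2)%N)); apply: val_inj.
Qed.

Lemma qn_inv (x : C) m k : qn x^-1 m k = qn x m k.
Proof.
rewrite /qn !exprVn !invrK -[X in X / _]opprB -[X in _ / X]opprB.
by rewrite invrN mulrNN.
Qed.

Lemma qi3_inv (x : C) k : qi x^-1 3 k = qi x 3 k.
Proof.
rewrite /qi !exprVn !invrK (_ : (-1) ^+ 3.-1 = 1 :> C) ?mul1r.
  by rewrite [X in X / _]addrC [X in _ / X]addrC.
by rewrite expr2 mulrNN mulr1.
Qed.

Lemma alpha_inv (x : C) :
  alpha x^-1 = (x ^- 5 - x^-1 + 2 * x ^+ 7 - x ^+ 9) * qn x 3 1 / qi x 3 1.
Proof. by rewrite /alpha qn_inv qi3_inv !exprVn !invrK. Qed.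

Lemma alphaE : alpha q = lsem (alphae true) / qi q 3 1 /\
  alpha q^-1 = lsem (alphae false) / qi q 3 1.
Proof. by rewrite alpha_inv. Qed.

Lemma f1E z (i j : 'I_3) :
  f1 q z i j = zsem z (nth z1 (nth [::] f1e i) j) / qi q 3 1.
Proof.
have [a1 a2] := alphaE; rewrite mxE a1 a2 /beta /gamma /mu /nu.
have := d3_neq0; have := q0.
case: i => [[|[|[|]]] ?] //; case: j => [[|[|[|]]] ?] //;
  cbn [nth nat_of_ord f1e zsem lsem zpow zt mue nue betae gammae alphae Lpow d3e z1];
  change (zint C 1) with (1 : C);
  move: (qi q 3 1) (lsem (alphae true)) (lsem (alphae false)) => d al al' q0 d0;
  field; rewrite d0 ?q0 //.
Qed.

Lemma f0E z (i j : 'I_2) :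
  f0 q z i j = zsem z (nth z1 (nth [::] f0e i) j) / qi q 3 1.
Proof.
rewrite mxE /zeta /xi /eta /rho.
have := d3_neq0; have := q0.
case: i => [[|[|]] ?] //; case: j => [[|[|]] ?] //;
  cbn [nth nat_of_ord f0e zsem lsem zpow zt zetae xie etae rhoe Lpow d3e z1];
  change (zint C 1) with (1 : C);
  move: (qi q 3 1) => d q0 d0;
  field; rewrite d0 ?q0 //.
Qed.

Lemma block4K (i j : 'I_3) :
  rnume (block4 i) (block4 j) =
  ZM (ZC (LP 5)) (ZM (zN 6) (nth z1 (nth [::] f1e i) j)).
Proof. by case: i => [[|[|[|]]] ?] //; case: j => [[|[|[|]]] ?]. Qed.

Lemma block5K (i j : 'I_2) :
  rnume (block5 i) (block5 j) = ZM (ZC (LP 2)) (nth z1 (nth [::] f0e i) j).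
Proof. by case: i => [[|[|]] ?] //; case: j => [[|[|]] ?]. Qed.

Lemma cls_block4 i : cls (block4 i) = (4, 0, 0).
Proof. by case: i => [[|[|[|]]] ?]. Qed.

Lemma cls_block5 i : cls (block5 i) = (0, 0, 0).
Proof. by case: i => [[|[|]] ?]. Qed.

Local Notation o1 := (Ordinal (isT : (1 < 8)%N)).
Local Notation o2 := (Ordinal (isT : (2 < 8)%N)).

Inductive ord8_spec : 'I_8 -> Prop :=
  | Ord80 : ord8_spec o0
  | Ord81 : ord8_spec o1
  | Ord82 : ord8_spec o2
  | Ord84 i : ord8_spec (block4 i)
  | Ord85 i : ord8_spec (block5 i).

Lemma ord8P i : ord8_spec i.
Proof.
have [/codomP [j ->]|i4] := boolP (i \in codom block4); first exact: Ord84.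
have [/codomP [j ->]|i5] := boolP (i \in codom block5); first exact: Ord85.
move: i4 i5; rewrite -block4_cls -block5_cls.
case: i => [[|[|[|[|[|[|[|[|]]]]]]]] i8] // _ _; rewrite (bool_irrelevance i8 isT).
- exact: Ord80.
- exact: Ord81.
- exact: Ord82.
Qed.

Lemma phi_off w i j : cls i != cls j -> phi w i j = 0.
Proof. by move=> ij; apply: contraNeq ij => /phi_cls ->. Qed.

Section Decomposition.
Context (z : C).
Hypothesis den0 : zsem z rdene != 0.
Local Notation c1 := (q ^+ 8 * ((1 - q ^- 8 * z) / (1 - q ^+ 8 * z))).
Local Notation c2 := (q ^+ 14 * (((1 - q ^- 6 * z) * (1 - q ^- 8 * z))
                      / ((1 - q ^+ 6 * z) * (1 - q ^+ 8 * z)))).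
Local Notation g1 := ((q ^+ 5 / ((1 - q ^- 4 * z) * (1 - q ^+ 6 * z)
                        * (1 - q ^+ 8 * z))) *: f1 q z).
Local Notation g0 := ((q ^+ 2 / ((1 - q ^- 4 * z) * (1 - q ^- 6 * z)
                        * (1 - q ^+ 6 * z) * (1 - q ^+ 8 * z))) *: f0 q z).

Lemma zsem_rdene : zsem z rdene = qi q 3 1 * ((1 - q ^- 4 * z) *
  ((1 - q ^- 6 * z) * ((1 - q ^+ 6 * z) * (1 - q ^+ 8 * z)))).
Proof. by []. Qed.

Lemma blockmx4_off (g : 'M[C]_3) i j : cls i != (4, 0, 0) -> blockmx block4 g i j = 0.
Proof.
move=> ic; apply: blockmx0; rewrite -block4_cls cls_block4.
by rewrite (negPf ic).
Qed.

Lemma blockmx5_off (g : 'M[C]_2) i j : cls i != (0, 0, 0) -> blockmx block5 g i j = 0.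
Proof.
move=> ic; apply: blockmx0; rewrite -block5_cls cls_block5.
by rewrite (negPf ic).
Qed.

Lemma phi_decomp : phi z = classmx C cls (8, 0, 0) - c1 *: classmx C cls (8, 1, 0)
  + c2 *: classmx C cls (7, 0, 1) + blockmx block4 g1 + blockmx block5 g0.
Proof.
have := den_factors den0 => -[n4 n6 p6 p8]; have d0 := d3_neq0.
have entry (i j : 'I_8) (A B D G H : 'M[C]_8) (x y : C) :
    (A - x *: B + y *: D + G + H) i j =
    A i j - x * B i j + y * D i j + G i j + H i j by rewrite !mxE.
apply/matrixP => i j; rewrite entry; have [ij|ij] := eqVneq (cls i) (cls j); last first.
  rewrite phi_off //; apply/esym.
  have cl0 l : classmx C cls l i j = 0.
    by apply: contraNeq ij => /classmx_cls ->.
  have b4 : blockmx block4 g1 i j = 0.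
    by apply: contraNeq ij => /(blockmx_cls block4_cls) ->.
  have b5 : blockmx block5 g0 i j = 0.
    by apply: contraNeq ij => /(blockmx_cls block5_cls) ->.
  by rewrite !cl0 b4 b5 !mulr0 oppr0 !addr0.
move: ij; case: (ord8P i) => [|||a|a]; case: (ord8P j) => [|||b|b] //;
  rewrite ?cls_block4 ?cls_block5 // => _.
- rewrite blockmx4_off // blockmx5_off // phiE !mxE /= !(mulr0, subr0, addr0).
  by rewrite mulfV.
- rewrite blockmx4_off // blockmx5_off // phiE zsem_rdene ![classmx _ _ _ _ _]mxE /=.
  rewrite !(mulr0, mulr1, sub0r, addr0); change (zint C 1) with (1 : C).
  move: (q ^+ 6) (q ^+ 8) (q ^+ 14) (q ^- 4) (q ^- 6) (q ^- 8) n4 n6 p6 p8.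
  by move: (qi q 3 1) d0 => d d0 a b c e f g n4 n6 p6 p8; field; rewrite d0 n4 n6 p6 p8.
- rewrite blockmx4_off // blockmx5_off // phiE zsem_rdene ![classmx _ _ _ _ _]mxE /=.
  rewrite !(mulr0, mulr1, subr0, add0r, addr0); change (zint C 1) with (1 : C).
  move: (q ^+ 6) (q ^+ 8) (q ^+ 14) (q ^- 4) (q ^- 6) (q ^- 8) n4 n6 p6 p8.
  by move: (qi q 3 1) d0 => d d0 a b c e f g n4 n6 p6 p8; field; rewrite d0 n4 n6 p6 p8.
- rewrite (blockmx5_off _ (i := block4 a)) ?cls_block4 // blockmxE; last exact: block4_inj.
  rewrite phiE block4K ![classmx _ _ _ _ _]mxE !cls_block4 !andbF !mulr0n.
  rewrite [g1 _ _]mxE f1E zsem_rdene /zN; cbn [zsem lsem].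
  move: (zsem z (nth _ _ _)) => x; change (zint C 1) with (1 : C).
  move: (q ^+ 6) (q ^+ 8) (q ^+ 5) (q ^+ 2) (q ^- 4) (q ^- 6) (q ^- 8) n4 n6 p6 p8.
  move: (qi q 3 1) d0 => d d0 a' b' c e f g i' n4 n6 p6 p8.
  by field; rewrite d0 n4 n6 p6 p8.
- rewrite (blockmx4_off _ (i := block5 a)) ?cls_block5 // blockmxE; last exact: block5_inj.
  rewrite phiE block5K ![classmx _ _ _ _ _]mxE !cls_block5 !andbF !mulr0n.
  rewrite [g0 _ _]mxE f0E zsem_rdene; cbn [zsem lsem].
  move: (zsem z (nth _ _ _)) => x; change (zint C 1) with (1 : C).
  move: (q ^+ 6) (q ^+ 8) (q ^+ 5) (q ^+ 2) (q ^- 4) (q ^- 6) (q ^- 8) n4 n6 p6 p8.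
  move: (qi q 3 1) d0 => d d0 a' b' c e f g i' n4 n6 p6 p8.
  by field; rewrite d0 n4 n6 p6 p8.
Qed.
End Decomposition.

(** * The half powers of the K_i and the sign rule *)

Lemma comm_inv n (X A B : 'M[C]_n) : A *m B = 1%:M -> X *m A = A *m X -> X *m B = B *m X.
Proof.
move=> AB XA; rewrite -[LHS]mul1mx -(mulmx1C AB) !mulmxA -(mulmxA B) -XA.
by rewrite -!mulmxA AB mulmx1.
Qed.

Lemma Kc0_prod : dmul (dmul (dbl (Kc 1)) (dmul (dbl (dbl (Kc 2))) (dbl (Kc 3)))) (Kc 0)
  = dparc false.
Proof. by vm_compute. Qed.

Lemma dev_dparc p : dev (dparc p) = if p then parmx C else 1%:M.
Proof.
have dE : dparc p = [seq (0%ZZ, lsg (p && vodd a.+1)) | a <- iota 0 32].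
  by case: p; vm_compute.
have -> : dev (dparc p) = diag_mx (\row_j (-1) ^+ (p && vodd j.+1)).
  congr diag_mx; apply/rowP => j.
  rewrite !mxE dE /dev_ (nth_map 0%N) ?size_iota // nth_iota // add0n.
  by rewrite zint_lsg mulr1.
case: p {dE} => //; rewrite -diag_const_mx; congr diag_mx.
by apply/rowP => j; rewrite !mxE.
Qed.

(** The operator W is the half power of K_1^2 K_2^4 K_3^2, whose inverse is that of K_0; so
    commutation with the other K_i is enough. *)
Lemma comm_copK0 X : commutes EE FF KK KV X ->
  X *m copK 0 = copK 0 *m X /\ X *m copKv 0 = copKv 0 *m X.
Proof.
move=> cX; pose W := dmul (dbl (Kc 1)) (dmul (dbl (dbl (Kc 2))) (dbl (Kc 3))).
have XK i : (0 < i < 4)%N -> X *m copK i = copK i *m X.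
  by case: i => // i i3; have [_ _ -> _] := cX (Ordinal (i3 : (i < 3)%N)).
have tM (A B A' B' : 'M[C]_32) : (A *m B) *t (A' *m B') = (A *t A') *m (B *t B').
  by rewrite tensmx_mul.
have cM A B : X *m A = A *m X -> X *m B = B *m X -> X *m (A *m B) = (A *m B) *m X.
  by move=> XA XB; rewrite mulmxA XA -mulmxA XB mulmxA.
have XW : X *m (dev W *t dev W) = (dev W *t dev W) *m X.
  rewrite /W /dbl !dev_mul !tM.
  have K1 := XK 1%N isT; have K2 := XK 2%N isT; have K3 := XK 3%N isT.
  exact: (cM _ _ (cM _ _ K1 K1) (cM _ _ (cM _ _ (cM _ _ K2 K2) (cM _ _ K2 K2)) (cM _ _ K3 K3))).
have WK : (dev W *t dev W) *m copK 0 = 1%:M.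
  by rewrite /copK -tM -dev_mul Kc0_prod dev_dparc tens1mx1.
have KKv : copK 0 *m copKv 0 = 1%:M by rewrite /copK /copKv -tM dev_inv // tens1mx1.
by have XK0 := comm_inv WK XW; split; last exact: comm_inv KKv XK0.
Qed.

Lemma dev_Lc i : dev (Lc i) =
  if sgen i then dev (dinv (Kc i)) *m parmx C else dev (dinv (Kc i)).
Proof. by rewrite dev_mul dev_dparc; case: sgen; rewrite ?mulmx1. Qed.

Lemma stens_dev (A : 'M[C]_32) i : stens (dev (dinv (Kc i))) (sgen i) A = dev (Lc i) *t A.
Proof. by rewrite /stens dev_Lc; case: sgen. Qed.

Lemma KcE i : (i < 4)%N -> Kc i = [seq (Z_of_int (kexp i a.+1), 1%ZZ) | a <- iota 0 32].
Proof. by do 4?case: i => [|i] //; vm_compute. Qed.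

Lemma dev_KcE i : (i < 4)%N -> dev (Kc i) = diag_mx (\row_j h ^ kexp i j.+1) /\
  dev (dinv (Kc i)) = diag_mx (\row_j h ^ (- kexp i j.+1)).
Proof.
move=> i4; rewrite KcE // /dinv -map_comp; split; congr diag_mx; apply/rowP => j;
  rewrite !mxE /dev_ (nth_map 0%N) ?size_iota // nth_iota // add0n mul1r.
  by rewrite zexpE.
by rewrite zexpN zexpE invr_expz.
Qed.
End FieldLevel.

(** * The complex exponential and the half power h of q *)

Section Exponential.
Context (R : realType).
Implicit Types a b w : R[i].

Lemma cexpD a b : cexp (a + b) = cexp a * cexp b.
Proof.
case: a => a1 a2; case: b => b1 b2; rewrite /cexp /= expRD cosD sinD.
by apply/eqP; rewrite eq_complex /=; apply/andP; split; apply/eqP; ring.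
Qed.

Lemma cexp0 : cexp (0 : R[i]) = 1.
Proof. by rewrite /cexp /= expR0 cos0 sin0 mulr1 mulr0. Qed.

Lemma cexp_neq0 a : cexp a != 0.
Proof.
have : cexp (a - a) != 0 by rewrite subrr cexp0 oner_neq0.
by rewrite cexpD mulf_eq0 negb_or => /andP [].
Qed.

Lemma cexpN a : cexp (- a) = (cexp a)^-1.
Proof.
apply: (mulfI (cexp_neq0 a)).
by rewrite -cexpD subrr cexp0 mulfV // cexp_neq0.
Qed.

Lemma cexpZ (m : int) a : cexp (m%:~R * a) = cexp a ^ m.
Proof.
have H (n : nat) : cexp (n%:R * a) = cexp a ^+ n.
  elim: n => [|n IH]; first by rewrite mul0r cexp0.
  by rewrite -natr1 mulrDl mul1r cexpD IH exprSr.
case: m => n; first by rewrite -pmulrn H.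
by rewrite NegzE mulrNz mulNr cexpN -pmulrn H exprnN.
Qed.

Lemma qpow_half (logq : R[i]) (m : int) : qpow logq (m%:~R / 2%:R) = cexp (logq / 2%:R) ^ m.
Proof. by rewrite /qpow -cexpZ; congr cexp; rewrite mulrAC mulrA. Qed.

End Exponential.

(** * Translation to the notions of the statement *)

Section Modules.
Context (R : realType) (logq : R[i]).
Local Notation C := R[i].
Local Notation h := (cexp (logq / 2%:R)).
Local Notation q := (h ^+ 2).
Hypothesis q_not_root : forall n : nat, (0 < n)%N -> q ^+ n != 1.
Let h0 : h != 0 := cexp_neq0 (logq / 2%:R).
Local Notation V := 'cV[C]_(32 * 32).
Local Notation VV_triangular := (VV_triangular h0 q_not_root).
Local Notation cls_sep := (cls_sep h0 q_not_root).

Lemma KhalfE i : (i < 4)%N ->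
  Khalf logq i = dev h (Kc i) /\ KhalfV logq i = dev h (dinv (Kc i)).
Proof.
move=> i4; have [-> ->] := dev_KcE h i4; split; congr diag_mx; apply/rowP => j.
  by rewrite !mxE qpow_half.
by rewrite !mxE -mulrNz qpow_half.
Qed.

Lemma coact_K z1 z2 (i : 'I_4) : coact q logq z1 z2 (GK i) = copK h i /\
  coact q logq z1 z2 (GKV i) = copKv h i.
Proof. by have [hK hV] := KhalfE (ltn_ord i); rewrite /= /stens hK hV. Qed.

(** The factor [3]^i is the one that cleared the denominators of E_0 and F_0; F_0 acts on V(z) with
    z^-1, hence the inverse parameters. *)
Lemma coact_0 z1 z2 : copE h z1 z2 0 = qi q 3 1 *: coact q logq z1 z2 (GE ord0) /\
  copF h z1^-1 z2^-1 0 = qi q 3 1 *: coact q logq z1 z2 (GF ord0).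
Proof.
have [hK hV] := KhalfE (isT : (0 < 4)%N).
rewrite /= /Eact /Fact /= hK hV !(stens_dev h0 _ 0).
rewrite /copE /copF /copr (mev_Ec0 h0 q_not_root) (mev_Fc0 h0 q_not_root).
split; rewrite /stens !(tensmxZl, tensmxZr) scalerDr !scalerA;
  by rewrite ![qi _ _ _ * _]mulrC.
Qed.

Lemma ord4_lift (i : 'I_4) : i != ord0 -> exists j : 'I_3, i = lift ord0 j.
Proof. by case: (unliftP ord0 i) => [j ->|->] //; exists j. Qed.

Lemma coact_lift z1 z2 (j : 'I_3) :
  [/\ coact q logq z1 z2 (GE (lift ord0 j)) = EE h j,
      coact q logq z1 z2 (GF (lift ord0 j)) = FF h j,
      coact q logq z1 z2 (GK (lift ord0 j)) = KK h j
    & coact q logq z1 z2 (GKV (lift ord0 j)) = KV h j].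
Proof.
have jE : lift ord0 j = j.+1 :> nat by [].
have j4 := sub_ord3 j; have [hK hV] := KhalfE (j4 : (j.+1 < 4)%N).
rewrite /coact /Eact /Fact jE hK hV !eqn0Ngt !(stens_dev h0) /=.
rewrite -(mev_Ec h0 q_not_root j4) -(mev_Fc h0 q_not_root j4).
by rewrite /EE /FF /copE /copF /copr !scale1r; split.
Qed.

#[local] Opaque copE copF copK copKv EE FF KK KV coact.

(** Generators of non-zero index do not see the spectral parameters. The two arguments of P allow
    one transfer principle for stability, for commutation and for intertwining. *)
Lemma coact_posP (P : 'M[C]_(32 * 32) -> 'M[C]_(32 * 32) -> Prop) z1 z2 w1 w2 :
  (forall x, gen_index x != ord0 -> P (coact q logq z1 z2 x) (coact q logq w1 w2 x)) <->
  forall j, [/\ P (EE h j) (EE h j), P (FF h j) (FF h j), P (KK h j) (KK h j)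
             & P (KV h j) (KV h j)].
Proof.
split=> [H j|H x].
  have [hE hF hK hV] := coact_lift z1 z2 j; have [gE gF gK gV] := coact_lift w1 w2 j.
  split.
  - by have := H (GE (lift ord0 j)) isT; rewrite hE gE.
  - by have := H (GF (lift ord0 j)) isT; rewrite hF gF.
  - by have := H (GK (lift ord0 j)) isT; rewrite hK gK.
  - by have := H (GKV (lift ord0 j)) isT; rewrite hV gV.
have H' j := (coact_lift z1 z2 j, coact_lift w1 w2 j).
case: x => i; rewrite /gen_index => /ord4_lift [j ->]; have [hE hF hK hV] := H j;
  have [[kE kF kK kV] [gE gF gK gV]] := H' j.
- by rewrite kK gK.
- by rewrite kV gV.
- by rewrite kE gE.
- by rewrite kF gF.
Qed.

Lemma submoduleE W : submodule q logq W <-> substable (EE h) (FF h) (KK h) (KV h) W.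
Proof.
have HP := coact_posP (fun A _ => forall w, w \in W -> A *m w \in W) 1 1 1 1.
split=> [/HP Ws j w wW|Ws]; last first.
  apply/HP => j; split=> w wW; have [h1 h2 h3 h4] := Ws j w wW.
  - exact: h1.
  - exact: h2.
  - exact: h3.
  - exact: h4.
by have [h1 h2 h3 h4] := Ws j; split; [exact: h1|exact: h2|exact: h3|exact: h4].
Qed.

Lemma irreducibleE W : irreducible q logq W <-> irrv (EE h) (FF h) (KK h) (KV h) W.
Proof.
by split=> -[/submoduleE Ws W0 Wmin]; split=> // W' /submoduleE; apply: Wmin.
Qed.

Lemma singularE l (w : V) : singular q logq l w <-> hwv (EE h) (KK h) (chi h) l w.
Proof.
have qE (x : int) : q ^ x = h ^ x * h ^ x by rewrite -expfzMl -expr2.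
split=> [ws|[ws wK] i /ord4_lift [j ->]].
  split=> j; have := ws (lift ord0 j) isT; have [-> _ -> _] := coact_lift 1 1 j.
    by case.
  by case=> _ ->; rewrite qE.
have [-> _ -> _] := coact_lift 1 1 j; split; first exact: ws.
by rewrite wK qE.
Qed.

Lemma isLE l W : isL q logq l W <-> isLv (EE h) (FF h) (KK h) (KV h) (chi h) l W.
Proof.
by split=> -[/irreducibleE irr [w [wW w0 /singularE ws]]]; split=> //; exists w.
Qed.

Lemma kills_othersE l X : kills_others q logq l X <->
  killsv (EE h) (FF h) (KK h) (KV h) (chi h) l X.
Proof.
by split=> H W /irreducibleE irr nL; apply: H => // /isLE.
Qed.

Lemma is_projE l P : is_proj q logq l P <-> is_projv (EE h) (FF h) (KK h) (KV h) (chi h) l P.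
Proof.
by split=> -[P1 /kills_othersE P0]; split=> // W /isLE; apply: P1.
Qed.

Lemma is_ftensE m (iota : 'I_m -> 'I_8) f k0 (u : 'I_m -> V) X :
  (forall j, u j = ss h (iota j)) ->
  is_ftens q logq (cls k0) u f X <->
  is_ftensv (EE h) (FF h) (KK h) (KV h) (ss h) cls (chi h) iota f k0 X.
Proof.
move=> uE; split=> -[cX kX Xu]; split.
- by apply/(coact_posP (fun A B => X *m A = B *m X) 1 1 1 1).
- exact/kills_othersE.
- by move=> j; rewrite -uE Xu; apply: eq_bigr => i _; rewrite uE.
- exact/(coact_posP (fun A B => X *m A = B *m X) 1 1 1 1).
- exact/kills_othersE.
- by move=> j; rewrite uE Xu; apply: eq_bigr => i _; rewrite uE.
Qed.

Lemma projP k0 : commutes (EE h) (FF h) (KK h) (KV h) (proj q logq (cls k0)) /\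
  acts_by (ss h) (proj q logq (cls k0)) (classmx C cls (cls k0)).
Proof.
apply: (projv_spec VV_triangular cls_sep); apply/is_projE; apply: xgetPex.
by have [P /is_projE PP] := projv_exists VV_triangular cls_sep k0; exists P.
Qed.

Lemma ftensP m (iota : 'I_m -> 'I_8) f k0 (u : 'I_m -> V) :
  injective iota -> (forall k, (cls k == cls k0) = (k \in codom iota)) ->
  (forall j, u j = ss h (iota j)) ->
  commutes (EE h) (FF h) (KK h) (KV h) (ftens q logq (cls k0) u f) /\
  acts_by (ss h) (ftens q logq (cls k0) u f) (blockmx iota f).
Proof.
move=> iinj icls uE.
have : is_ftensv (EE h) (FF h) (KK h) (KV h) (ss h) cls (chi h) iota f k0
    (ftens q logq (cls k0) u f).
  apply/(is_ftensE _ _ _ uE); apply: xgetPex.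
  have [X /(is_ftensE _ _ _ uE) XX] := ftensv_exists VV_triangular cls_sep f iinj icls.
  by exists X.
by move=> Xf; split; [case: Xf|exact: (ftensv_spec VV_triangular cls_sep iinj icls Xf)].
Qed.

Lemma intertwinerE z X : z != 0 -> intertwiner q logq z X <->
  [/\ commutes (EE h) (FF h) (KK h) (KV h) X, X *m copE h z 1 0 = copE h 1 z 0 *m X
    & X *m copF h z^-1 1 0 = copF h 1 z^-1 0 *m X].
Proof.
move=> z0; have d0 := d3_neq0 h0 q_not_root.
have [e1 f1] := coact_0 z 1; have [e2 f2] := coact_0 1 z; rewrite invr1 in f1 f2.
split=> [Xz|[cX XE XF]].
  split.
  - by apply/(coact_posP (fun A B => X *m A = B *m X) z 1 1 z) => x _; apply: Xz.
  - by rewrite e1 e2 -scalemxAr -scalemxAl Xz.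
  - by rewrite f1 f2 -scalemxAr -scalemxAl Xz.
have [XK XV] := comm_copK0 h0 cX.
have X0 (A B : 'M[C]_(32 * 32)) :
    X *m (qi q 3 1 *: A) = (qi q 3 1 *: B) *m X -> X *m A = B *m X.
  by rewrite -scalemxAr -scalemxAl => /(scalerI d0).
move=> x; have [|x0] := eqVneq (gen_index x) ord0; last first.
  exact: (coact_posP (fun A B => X *m A = B *m X) z 1 1 z).2 cX x x0.
case: x => i; rewrite /gen_index => ->.
- by rewrite (coact_K z 1 ord0).1 (coact_K 1 z ord0).1; exact: XK.
- by rewrite (coact_K z 1 ord0).2 (coact_K 1 z ord0).2; exact: XV.
- by move: XE; rewrite e1 e2 => /X0.
- by move: XF; rewrite f1 f2 => /X0.
Qed.

Lemma u4E j : u4 q j = ss h (block4 j).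
Proof.
case: j => [[|[|[|]]] ?] //; first by rewrite [RHS](sv_u4a h0 q_not_root).
  by rewrite [RHS](sv_vv h0 q_not_root (_ : sc 4 = munit 1 32)).
by rewrite [RHS](sv_vv h0 q_not_root (_ : sc 5 = munit 32 1)).
Qed.

Lemma u5E j : u5 q j = ss h (block5 j).
Proof.
case: j => [[|[|]] ?] //; first by rewrite [RHS](sv_u5a h0 q_not_root).
by rewrite [RHS](sv_vv h0 q_not_root (_ : sc 7 = munit 32 32)).
Qed.

Lemma sub1_neq0 (x z : C) : x != 0 -> z != x^-1 -> 1 - x * z != 0.
Proof.
move=> x0; apply: contra => /eqP xz; apply/eqP/(mulfI x0).
by rewrite mulfV //; apply/eqP; rewrite eq_sym -subr_eq0 xz.
Qed.

Lemma zsem_neq0 z : z != q ^+ 4 -> z != q ^+ 6 -> z != q ^- 6 -> z != q ^- 8 ->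
  zsem h z rdene != 0.
Proof.
move=> z1 z2 z3 z4; have q0 n : q ^+ n != 0 by rewrite !expf_neq0.
rewrite zsem_rdene; apply: mulf_neq0; first exact: (d3_neq0 h0 q_not_root).
by rewrite !mulf_neq0 //; apply: sub1_neq0; rewrite ?invr_eq0 ?invrK.
Qed.

End Modules.

Theorem theorem7p4 (R : realType) (q logq : R[i])
    (q_neq0 : q != 0) (logqE : cexp logq = q)
    (q_not_root : forall n : nat, (0 < n)%N -> q ^+ n != 1) :
  exists S : seq R[i],
  forall z : R[i], z != 0 -> z \notin S ->
  forall X : 'M[R[i]]_(32 * 32),
    (intertwiner q logq z X /\ X *m vv R[i] 1 1 = vv R[i] 1 1) <->
    X = proj q logq (8, 0, 0)
        - (q ^+ 8 * ((1 - q ^- 8 * z) / (1 - q ^+ 8 * z)))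
            *: proj q logq (8, 1, 0)
        + (q ^+ 14 * (((1 - q ^- 6 * z) * (1 - q ^- 8 * z))
                      / ((1 - q ^+ 6 * z) * (1 - q ^+ 8 * z))))
            *: proj q logq (7, 0, 1)
        + ftens q logq (4, 0, 0) (u4 q)
            ((q ^+ 5 / ((1 - q ^- 4 * z) * (1 - q ^+ 6 * z)
                        * (1 - q ^+ 8 * z))) *: f1 q z)
        + ftens q logq (0, 0, 0) (u5 q)
            ((q ^+ 2 / ((1 - q ^- 4 * z) * (1 - q ^- 6 * z)
                        * (1 - q ^+ 6 * z) * (1 - q ^+ 8 * z))) *: f0 q z).
Proof.
(* The square root of q must be the one belonging to [logq], since the half weights act through
   it. *)
have qE : q = cexp (logq / 2%:R) ^+ 2.
  by rewrite -logqE expr2 -cexpD -splitr.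
(* The zeros of the denominators at z and at 1/z. *)
exists [:: q ^+ 4; q ^- 4; q ^+ 6; q ^- 6; q ^+ 8; q ^- 8] => z z0.
rewrite !inE !negb_or => /and5P [z1 z2 z3 z4 /andP [z5 z6]] X.
clear logqE q_neq0; move: q qE q_not_root z1 z2 z3 z4 z5 z6.
set h := cexp _ => _ -> q_not_root z1 z2 z3 z4 z5 z6.
have h0 : h != 0 := cexp_neq0 _.
have zV (x : R[i]) : z != x^-1 -> z^-1 != x by apply: contra => /eqP <-; rewrite invrK.
have den0 := zsem_neq0 q_not_root z1 z3 z4 z6.
have denV0 : zsem h z^-1 rdene != 0.
  by apply: zsem_neq0 => //; apply: zV; rewrite ?invrK.
have v11 : vv R[i] 1 1 = ss h (Ordinal (isT : (0 < 8)%N)).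
  by rewrite [RHS](sv_vv h0 q_not_root (_ : sc 0 = munit 1 1)).
set Y := (X in _ <-> _ = X).
have [cY Ys] : commutes (EE h) (FF h) (KK h) (KV h) Y /\ acts_by (ss h) Y (phi h z).
  rewrite (phi_decomp h0 q_not_root den0) /Y -!scaleNr.
  have [p1 a1] := projP q_not_root (Ordinal (isT : (0 < 8)%N)).
  have [p2 a2] := projP q_not_root (Ordinal (isT : (1 < 8)%N)).
  have [p3 a3] := projP q_not_root (Ordinal (isT : (2 < 8)%N)).
  have F4 f := ftensP q_not_root f block4_inj block4_cls (u4E q_not_root).
  have F5 f := ftensP q_not_root f block5_inj block5_cls (u5E q_not_root).
  split.
    apply: commutesD (F5 _).1; apply: commutesD (F4 _).1; apply: commutesD (commutesZ _ p3).
    exact: commutesD p1 (commutesZ _ p2).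
  apply: acts_byD (F5 _).2; apply: acts_byD (F4 _).2; apply: acts_byD (acts_byZ _ a3).
  exact: acts_byD a1 (acts_byZ _ a2).
have Xiff := intertwiner_iff h0 q_not_root z0 den0 denV0 X.
rewrite v11; split=> [[/(intertwinerE q_not_root X z0) [cX XE XF] X11]|->].
  have [_ Xs] := Xiff.1 (And4 cX XE XF X11).
  apply: (comm_eq (VV_triangular h0 q_not_root) _ _ Xs Ys) => i.
    by have [_ h2 _ _] := cX i.
  by have [_ h2 _ _] := cY i.
have [cY' YE YF Y11] := (intertwiner_iff h0 q_not_root z0 den0 denV0 Y).2 (conj cY Ys).
split; last exact: Y11.
apply/(intertwinerE q_not_root Y z0); exact: And3 cY' YE YF.
Qed.
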